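(* Let $\varphi:\mathbb D\to\mathbb D$ be analytic. Let $\sigma:[0,1)\to(0,\infty)$ be continuous and integrable such that $\omega_\sigma(r)=\int_r^1(t-r)\sigma(t)\,dt$ is (I)-admissible, and set $G(z)=\omega_\sigma(|z|)/(1-|z|)$ for $z\in\mathbb D$. (i) If $\displaystyle\lim_{|z|\to1^-}\frac{G(z)}{G(\varphi(z))}=0$, then $C_\varphi$ is compact on $\mathcal A^2_\sigma(\mathbb D)$. (ii) If $\omega_\sigma$ satisfies condition $(\kappa)$ and $\displaystyle\lim_{|z|\to1^-}\frac{1-|\varphi(z)|}{1-|z|}=\infty$, then $C_\varphi$ is compact on $\mathcal A^2_\sigma(\mathbb D)$.
   Context: $\mathbb D$ is the open unit disc, $dA=dx\,dy/\pi$, $C_\varphi f=f\circ\varphi$. $\mathcal A^2_\sigma(\mathbb D)$ is the space of analytic $f$ on $\mathbb D$ with $\int_{\mathbb D}|f(z)|^2\sigma(|z|)\,dA(z)<\infty$. A positive integrable $\omega\in C^2[0,1)$ is (I)-admissible if: (W1) $\omega$ non-increasing; (W2) there is $\delta>0$ with $r\mapsto\omega(r)(1-r)^{-(1+\delta)}$ non-decreasing on $[0,1)$; (W3) $\lim_{r\to1^-}\omega(r)=0$; (W4(I)) $\omega$ convex and $\lim_{r\to1^-}\omega'(r)=0$. Writing $\tilde\omega_\sigma(x)=\omega_\sigma(1-x)$, the weight $\omega_\sigma$ satisfies condition $(\kappa)$ if $\displaystyle\lim_{\eta\to0^+}\limsup_{x\to0^+}\frac{\tilde\omega_\sigma(\eta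 x)}{\eta\,\tilde\omega_\sigma(x)}=0$. *)

(* Defs.v *)
From HB Require Import structures.
From mathcomp Require Import all_boot all_order all_algebra.
From mathcomp Require Import all_classical all_reals all_analysis.
From mathcomp Require Import complex.
Set Implicit Arguments. Unset Strict Implicit. Unset Printing Implicit Defensive.
Import Order.TTheory GRing.Theory Num.Theory.
Import numFieldNormedType.Exports.
Local Open Scope classical_set_scope.
Local Open Scope ring_scope.
Local Open Scope complex_scope.

Section Defs.
Variable R : realType.

Definition cabs (z : R[i]) : R := Num.sqrt (complex.Re z ^+ 2 + complex.Im z ^+ 2).
Definition disc : set R[i] := [set z | cabs z < 1].

(* complex differentiability (the derivative is taken with complex scalars) *)
Definition analytic_on (A : set R[i]) (f : R[i] -> R[i]) :=
  forall z, A z -> @derivable R[i] R[i]^o R[i]^o f z 1.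

Definition cplx (p : R * R) : R[i] := p.1 +i* p.2.

Definition area_meas := ((@lebesgue_measure R) \x (@lebesgue_measure R))%E.

Definition A2norm2 (sigma : R -> R) (f : R[i] -> R[i]) : \bar R :=
  (\int[area_meas]_(p in [set p : R * R | (cabs (cplx p) < 1)%R])
     ((cabs (f (cplx p))) ^+ 2 * sigma (cabs (cplx p)) / pi)%:E)%E.

Definition inA2 (sigma : R -> R) (f : R[i] -> R[i]) :=
  analytic_on disc f /\ (A2norm2 sigma f < +oo)%E.

Definition Ccomp_compact (sigma : R -> R) (phi : R[i] -> R[i]) :=
  (forall f, inA2 sigma f -> inA2 sigma (f \o phi)) /\
  forall u : nat -> R[i] -> R[i], (forall n, inA2 sigma (u n)) ->
    (exists M : R, forall n, (A2norm2 sigma (u n) <= M%:E)%E) ->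
    exists (k : nat -> nat) (g : R[i] -> R[i]),
      {homo k : m n / (m < n)%N >-> (m < n)%N} /\ inA2 sigma g /\
      ((fun n => A2norm2 sigma ((u (k n) \o phi) - g)) @ \oo --> 0%E).

Definition omega_of (sigma : R -> R) (r : R) : R :=
  fine (\int[@lebesgue_measure R]_(t in `[r, 1%R[) ((t - r) * sigma t)%R%:E)%E.

Definition I01 : set R := `[0, 1[.

Definition C2_on_I01 (w w1 w2 : R -> R) :=
  {within I01, continuous w} /\ {within I01, continuous w1} /\
  {within I01, continuous w2} /\
  (forall r : R, 0 < r < 1 -> is_derive r 1 w (w1 r) /\ is_derive r 1 w1 (w2 r)).

Definition I_admissible (w : R -> R) :=
  (forall r, I01 r -> 0 < w r) /\
  (@lebesgue_measure R).-integrable I01 (EFin \o w) /\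
  exists w1 w2 : R -> R, C2_on_I01 w w1 w2 /\
  (* W1 *) (forall r s, I01 r -> I01 s -> r <= s -> w s <= w r) /\
  (* W2 *) (exists delta : R, 0 < delta /\ forall r s, I01 r -> I01 s -> r <= s ->
        w r * (1 - r) `^ (- (1 + delta)) <= w s * (1 - s) `^ (- (1 + delta))) /\
  (* W3 *) (w x @[x --> 1^'-] --> 0) /\
  (* W4 *) (forall x y t, I01 x -> I01 y -> 0 <= t <= 1 ->
        w (t * x + (1 - t) * y) <= t * w x + (1 - t) * w y) /\
           (w1 x @[x --> 1^'-] --> 0).

Definition kappa_cond (w : R -> R) :=
  let wt := fun x => w (1 - x) in
  (fun eta : R => limf_esup (fun x : R => (wt (eta * x) / (eta * wt x))%:E) (0%R^'+))
    @ 0%R^'+ --> 0%E.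

Definition Gw (w : R -> R) (z : R[i]) : R := w (cabs z) / (1 - cabs z).

End Defs.
Arguments disc {R}.
Arguments I01 {R}.
Arguments area_meas {R}.

(* Main.v *)
Require Import Defs.
From HB Require Import structures.
From mathcomp Require Import all_boot all_order all_algebra.
From mathcomp Require Import all_classical all_reals all_analysis.
From mathcomp Require Import measurable_realfun complex ring lra zify.
Import Order.TTheory GRing.Theory Num.Theory.
Import numFieldNormedType.Exports Normc.
Local Open Scope classical_set_scope.
Local Open Scope ring_scope.

(* Write N_f(r) for the mean of |f|^2 over the circle |z| = r. In polar
   coordinates the norm of f is the integral of r sigma(r) N_f(r). The
   function G is non-increasing, and by (W2) it is doubling and comparable
   to the integral of sigma over [r, 1).

   Littlewood's subordination principle, obtained by integrating the Poisson
   inequality for |f|^2 at phi(z), gives N_{f o phi}(r) <= C N_f(rho) as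
   soon as phi maps a slightly larger disc than |z| <= r into |w| < rho. If
   it does not, then |phi(z)| >= rho for some |z| close to r, and the
   hypothesis of (i) together with monotonicity and doubling yields G(r) <=
   C eps G(rho). Integrating over the level sets of N_f and N_{f o phi}
   (layer cake), the part of the norm of f o phi beyond some radius r1 is at
   most eps times the norm of f, uniformly in f. Compactness follows: a
   bounded sequence has a locally uniform limit along a subsequence
   (Montel), Fatou bounds its norm, and the part of the norm inside |z| <=
   r1 is controlled by uniform convergence on a compact disc.

   For (ii), condition (kappa) provides eta with G(1 - eta x) < eps G(1 - x)
   for small x, and 1 - |z| < eta (1 - |phi(z)|) near the boundary, so (i)
   applies.

   Holomorphy is complex differentiability, so Cauchy's theory is built from
   Goursat's argument, applied in the polar parameters (r, t). *)

(** An inequality between the circle means of [f o phi] at [r] and of [f] at [rho] does not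
    integrate directly, since the admissible [rho] depends on [r] in an uncontrolled way. Level sets
    remove this obstacle. The mean of [|f|^2] increases with the radius, so a superlevel set of it
    is an interval ending at 1, whose mass is bounded below by [tail] near its left end. At the same
    level, the superlevel set for [f o phi] contains only radii where [Grad] is a small multiple of
    that [tail], and doubling bounds its mass. Each passage from a radius to one with half the
    distance to 1 costs a factor [Cdbl], hence the fourth power in the estimate. Boundedness of the
    operator is not presupposed: it is the same estimate with [e = 1]. Two choices shape the
    analytic part. Circles are cut into two half circles, so that polar coordinates reduce to
    one-variable substitutions through [atan]. The mean value property tolerates one circle without
    differentiability, so that it applies to difference quotients, known only to be continuous at
    their base point. *)

Notation cRe := complex.Re.
Notation cIm := complex.Im.

Ltac itv_lra := apply/andP; split; lra.

(** * Modulus, real and imaginary parts, and topology of [R[i]] *)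

Section ComplexBasics.
Variable R : realType.
Implicit Types (z w : R[i]).

Lemma cabsE z : `|z| = (cabs z)%:C%C.
Proof. by case: z. Qed.

Lemma cabs_ge0 z : 0 <= cabs z.
Proof. exact: sqrtr_ge0. Qed.

Lemma cabs_normc z : cabs z = normc z.
Proof. by case: z. Qed.

Lemma cabsM z w : cabs (z * w) = cabs z * cabs w.
Proof. by rewrite !cabs_normc normcM. Qed.

Lemma cabsV z : cabs z^-1 = (cabs z)^-1.
Proof. by rewrite !cabs_normc normcV. Qed.

Lemma cabsN z : cabs (- z) = cabs z.
Proof. by rewrite !cabs_normc normcN. Qed.

Lemma cabsC z w : cabs (z - w) = cabs (w - z).
Proof. by rewrite -cabsN opprB. Qed.

Lemma cabs0 : cabs (0 : R[i]) = 0.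
Proof. by rewrite cabs_normc normc0. Qed.

Lemma ler_cabsD z w : cabs (z + w) <= cabs z + cabs w.
Proof. by rewrite !cabs_normc le_normcD. Qed.

Lemma ler_cabsB z w : cabs (z - w) <= cabs z + cabs w.
Proof. by rewrite -(cabsN w) ler_cabsD. Qed.

Lemma ler_cabs_dist z w : cabs z - cabs w <= cabs (z - w).
Proof. by rewrite lerBlDr -{1}(subrK w z) ler_cabsD. Qed.

Lemma cabs_eq0 z : (cabs z == 0) = (z == 0).
Proof.
apply/eqP/eqP => [|->]; last exact: cabs0.
by rewrite cabs_normc => /eq0_normc.
Qed.

Lemma cabs_gt0 z : (0 < cabs z) = (z != 0).
Proof. by rewrite lt_neqAle cabs_ge0 andbT eq_sym cabs_eq0. Qed.

Lemma cabs_sqr z : cabs z ^+ 2 = cRe z ^+ 2 + cIm z ^+ 2.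
Proof. by rewrite sqr_sqrtr // addr_ge0 ?sqr_ge0. Qed.

Lemma cabsR (x : R) : cabs x%:C%C = `|x|.
Proof. by rewrite /cabs /= expr0n addr0 sqrtr_sqr. Qed.

Lemma ler_Re z : `|cRe z| <= cabs z.
Proof.
by rewrite -(@ler_pXn2r _ 2) ?nnegrE ?cabs_ge0 // real_normK ?num_real //
  cabs_sqr lerDl sqr_ge0.
Qed.

Lemma ler_Im z : `|cIm z| <= cabs z.
Proof.
by rewrite -(@ler_pXn2r _ 2) ?nnegrE ?cabs_ge0 // real_normK ?num_real //
  cabs_sqr lerDr sqr_ge0.
Qed.

Lemma ler_ReIm z : cabs z <= `|cRe z| + `|cIm z|.
Proof.
rewrite -(@ler_pXn2r _ 2) ?nnegrE ?cabs_ge0 ?addr_ge0 //.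
rewrite cabs_sqr sqrrD !real_normK ?num_real //.
by rewrite lerD2r lerDl mulrn_wge0 // mulr_ge0.
Qed.

Lemma cabs_conj z : cabs (conjc z) = cabs z.
Proof. by case: z => a b; rewrite /cabs /= sqrrN. Qed.

Lemma conj_mulc z : z * conjc z = (cabs z ^+ 2)%:C%C.
Proof. by rewrite cabs_sqr; case: z => a b; simpc; rewrite /= !expr2 addrC; congr Complex; ring. Qed.

Lemma cReD z w : cRe (z + w) = cRe z + cRe w.
Proof. by case: z; case: w. Qed.
Lemma cReN z : cRe (- z) = - cRe z.
Proof. by case: z. Qed.
Lemma cReB z w : cRe (z - w) = cRe z - cRe w.
Proof. by rewrite cReD cReN. Qed.
Lemma cImD z w : cIm (z + w) = cIm z + cIm w.
Proof. by case: z; case: w. Qed.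
Lemma cImN z : cIm (- z) = - cIm z.
Proof. by case: z. Qed.
Lemma cImB z w : cIm (z - w) = cIm z - cIm w.
Proof. by rewrite cImD cImN. Qed.
Lemma cReM z w : cRe (z * w) =
  cRe z * cRe w - cIm z * cIm w.
Proof. by case: z; case: w. Qed.
Lemma cImM z w : cIm (z * w) =
  cRe z * cIm w + cIm z * cRe w.
Proof. by case: z => a b; case: w => c d; simpc => /=; rewrite addrC (mulrC b). Qed.

(** In the order of [R[i]] a positive element has zero imaginary part, so every ball has a real
    radius and limits can be handled with real [e]. *)
Lemma cvgc_ballP (T : Type) (F : set_system T) {FF : Filter F} (f : T -> R[i]) (l : R[i]^o) :
  (f @ F --> l) <-> (forall e : R, 0 < e -> \forall t \near F, cabs (f t - l) < e).
Proof.
split.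
  move=> /(@cvgrPdist_lt R[i] R[i]^o) h e e0.
  have := h e%:C%C; rewrite ltcR => /(_ e0).
  by apply: filterS => t; rewrite cabsE ltcR cabsC.
move=> h; apply/(@cvgrPdist_lt R[i] R[i]^o) => -[e e'] ; rewrite ltcE /= => /andP[/eqP-> e0].
have := h e e0; apply: filterS => t.
by rewrite cabsE ltcR cabsC.
Qed.

Lemma nbhsc_ballP (z : R[i]^o) (A : set R[i]) :
  nbhs z A <-> exists2 e : R, 0 < e & forall w, cabs (w - z) < e -> A w.
Proof.
split.
  move=> /nbhs_ballP[[e e'] /=]; rewrite ltcE /= => /andP[/eqP-> e0] h.
  exists e => // w wz; apply: h; rewrite /ball /= cabsE ltcR cabsC //.
move=> [e e0 h]; apply/nbhs_ballP; exists e%:C%C => /=; first by rewrite ltcR.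
move=> w; rewrite /ball /= cabsE ltcR cabsC; exact: h.
Qed.

Lemma continuous_cplx (p : R * R) : {for p, continuous (fun p : R * R => cplx p : R[i]^o)}.
Proof.
apply/cvgc_ballP => e e0.
have e20 : 0 < e / 2 by rewrite divr_gt0.
have c1 : (fun q : R * R => q.1) @ p --> p.1 by exact: cvg_fst.
have c2 : (fun q : R * R => q.2) @ p --> p.2 by exact: cvg_snd.
have h1 : \forall q \near p, `|p.1 - q.1| < e / 2.
  by move/cvgrPdist_lt : c1; apply.
have h2 : \forall q \near p, `|p.2 - q.2| < e / 2.
  by move/cvgrPdist_lt : c2; apply.
near=> q.
rewrite (le_lt_trans (ler_ReIm _)) // [e]splitr ltrD //= distrC; near: q => //.
Unshelve. all: by end_near. Qed.

Lemma continuous_Re (z : R[i]^o) : {for z, continuous (@complex.Re R : R[i]^o -> R)}.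
Proof.
apply/(@cvgrPdist_lt R R R[i]^o (nbhs z)) => e e0; apply/nbhsc_ballP; exists e => // w wz.
by rewrite -cReB (le_lt_trans (ler_Re _)) // cabsC.
Qed.

Lemma continuous_Im (z : R[i]^o) : {for z, continuous (@complex.Im R : R[i]^o -> R)}.
Proof.
apply/(@cvgrPdist_lt R R R[i]^o (nbhs z)) => e e0; apply/nbhsc_ballP; exists e => // w wz.
by rewrite -cImB (le_lt_trans (ler_Im _)) // cabsC.
Qed.

Lemma continuous_cabs (z : R[i]^o) : {for z, continuous (@cabs R : R[i]^o -> R)}.
Proof.
apply/(@cvgrPdist_lt R R R[i]^o (nbhs z)) => e e0; apply/nbhsc_ballP; exists e => // w wz.
rewrite (le_lt_trans _ wz) // ler_norml.
have := ler_cabs_dist w z; have := ler_cabs_dist z w.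
by rewrite (cabsC z w); lra.
Qed.

End ComplexBasics.

(** * Integrals of continuous functions over a segment *)

Definition rint {R : realType} (a b : R) (f : R -> R) : R :=
  \int[@lebesgue_measure R]_(x in `[a, b]) f x.

(** Continuity is two-sided at the endpoints too, so the property passes to subsegments and follows
    at once from joint continuity of a function of two variables. *)
Definition ctsI {R : realType} (a b : R) (f : R -> R) :=
  forall x, a <= x <= b -> {for x, continuous f}.

Section RealIntegral.
Variable R : realType.
Implicit Types (a b c : R) (f g : R -> R).
Local Notation mu := (@lebesgue_measure R).

Lemma ctsI_sub a b c d f : a <= c -> d <= b -> ctsI a b f -> ctsI c d f.
Proof.
move=> ac db h x /andP[cx xd]; apply: h.
by rewrite (le_trans ac cx) (le_trans xd db).
Qed.

Lemma ctsI_within a b f : ctsI a b f -> {within `[a, b], continuous f}.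
Proof.
move=> h; apply: continuous_in_subspaceT => x.
by rewrite inE /= in_itv /= => /h.
Qed.

Lemma ctsI_integrable a b f : ctsI a b f -> mu.-integrable `[a, b] (EFin \o f).
Proof.
move=> h; apply: continuous_compact_integrable; first exact: segment_compact.
exact: ctsI_within.
Qed.

Lemma ctsIB a b f g : ctsI a b f -> ctsI a b g -> ctsI a b (fun x => f x - g x).
Proof. by move=> hf hg x xab; apply: cvgB; [exact: hf|exact: hg]. Qed.

Lemma ctsIM a b f g : ctsI a b f -> ctsI a b g -> ctsI a b (fun x => f x * g x).
Proof. by move=> hf hg x xab; apply: cvgM; [exact: hf|exact: hg]. Qed.

Lemma ctsI_cst a b c : ctsI a b (fun=> c).
Proof. by move=> x _; exact: cvg_cst. Qed.

Lemma rint_cst a b c : a <= b -> rint a b (fun=> c) = c * (b - a).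
Proof.
move=> ab; rewrite /rint Rintegral_cst //= lebesgue_measure_itv /= lte_fin.
have [//|] := ltP a b; rewrite le_eqVlt ltNge ab orbF => /eqP->.
by rewrite subrr.
Qed.

Lemma rintD a b f g : ctsI a b f -> ctsI a b g ->
  rint a b (fun x => f x + g x) = rint a b f + rint a b g.
Proof. by move=> hf hg; rewrite /rint RintegralD //; exact: ctsI_integrable. Qed.

Lemma rintB a b f g : ctsI a b f -> ctsI a b g ->
  rint a b (fun x => f x - g x) = rint a b f - rint a b g.
Proof. by move=> hf hg; rewrite /rint RintegralB //; exact: ctsI_integrable. Qed.

Lemma rintZ a b c f : ctsI a b f -> rint a b (fun x => c * f x) = c * rint a b f.
Proof. by move=> hf; rewrite /rint RintegralZl //; exact: ctsI_integrable. Qed.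

Lemma eq_rint a b f g : (forall x, a <= x <= b -> f x = g x) -> rint a b f = rint a b g.
Proof.
by move=> h; apply: eq_Rintegral => x; rewrite inE /= in_itv /= => /h.
Qed.

Lemma le_rint a b f g : ctsI a b f -> ctsI a b g ->
  (forall x, a <= x <= b -> f x <= g x) -> rint a b f <= rint a b g.
Proof.
move=> hf hg h; apply: le_Rintegral => //; try exact: ctsI_integrable.
Qed.

Lemma rint_ge0 a b f : (forall x, a <= x <= b -> 0 <= f x) -> 0 <= rint a b f.
Proof. by move=> h; apply: Rintegral_ge0 => x /=; rewrite in_itv /= => /h. Qed.

Lemma rint_bound a b f M : a <= b -> ctsI a b f ->
  (forall x, a <= x <= b -> `|f x| <= M) -> `|rint a b f| <= M * (b - a).
Proof.
move=> ab hf h; rewrite ler_norml -mulNr -!rint_cst //.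
by apply/andP; split; apply: le_rint => //; do ?[exact: ctsI_cst];
  move=> x /h; rewrite ler_norml => /andP[].
Qed.

Lemma rint_split a b c f : a <= c -> c <= b -> ctsI a b f ->
  rint a b f = rint a c f + rint c b f.
Proof.
move=> ac cb hf; apply/eqP; rewrite addrC -subr_eq; apply/eqP.
rewrite /rint Rintegral_itvB ?bnd_simp //; last exact: ctsI_integrable.
apply: Rintegral_itv_obnd_cbnd.
have hcb : ctsI c b f by apply: ctsI_sub hf.
apply: integrableS (ctsI_integrable _ _ _ hcb) => //.
by apply: subset_itvr; rewrite bnd_simp.
Qed.

End RealIntegral.

(** * Goursat's theorem on rectangles *)

Definition cont2 {R : realType} (P : R -> R -> R) (x y : R) :=
  {for (x, y), continuous (fun p : R * R => P p.1 p.2)}.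

(** Total differentiability at one point. Nothing is asked of the partial derivatives at nearby
    points, since complex differentiability alone gives no more. *)
Definition diff2 {R : realType} (P : R -> R -> R) (x y al be : R) :=
  forall e, 0 < e -> exists2 d, 0 < d & forall h k, `|h| < d -> `|k| < d ->
    `|P (x + h) (y + k) - P x y - al * h - be * k| <= e * (`|h| + `|k|).

Section Goursat.
Variable R : realType.
Implicit Types (a b c d x y : R) (P Q : R -> R -> R).

Lemma cont2_x P x y : cont2 P x y -> {for x, continuous (P^~ y)}.
Proof.
move=> h.
apply: (@continuous_comp _ _ _ (fun t => (t, y)) (fun p : R * R => P p.1 p.2) x) => //.
rewrite /prop_for /continuous_at /=.
by apply: (cvg_pair (G := nbhs x) (H := nbhs y)); [exact: cvg_id|exact: cvg_cst].
Qed.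

Lemma cont2_y P x y : cont2 P x y -> {for y, continuous (P x)}.
Proof.
move=> h.
apply: (@continuous_comp _ _ _ (fun t => (x, t)) (fun p : R * R => P p.1 p.2) y) => //.
rewrite /prop_for /continuous_at /=.
by apply: (cvg_pair (G := nbhs x) (H := nbhs y)); [exact: cvg_cst|exact: cvg_id].
Qed.

(** The counterclockwise boundary integral of [Q dx + P dy], formally the integral of [P_x - Q_y]
    over the rectangle. *)
Definition flux P Q a b c d : R :=
  rint c d (fun y => P b y - P a y) - rint a b (fun x => Q x d - Q x c).

(** The expansions at [(a, y)] and [(b, y)] share the base value and the term [be * (y - y0)], which
    cancel in the difference; each leaves an error of at most [e * (b - a + (d - c))]. *)
Lemma edge_increment (P : R -> R -> R) x0 y0 al be e r a b c d y :
  (forall h k, `|h| <= r -> `|k| <= r ->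
    `|P (x0 + h) (y0 + k) - P x0 y0 - al * h - be * k| <= e * (`|h| + `|k|)) -> 0 <= e ->
  a <= x0 <= b -> c <= y0 <= d -> b - a <= r -> d - c <= r -> c <= y <= d ->
  `|P b y - P a y - al * (b - a)| <= 2 * e * (b - a + (d - c)).
Proof.
move=> hP e0 /andP[ax xb] /andP[cy yd] bar dcr /andP[cy' yd']; set s := b - a + (d - c).
have yk : `|y - y0| <= d - c by rewrite ler_norml; itv_lra.
have bh : `|b - x0| <= b - a by rewrite ger0_norm; lra.
have ah : `|a - x0| <= b - a by rewrite ler0_norm; lra.
have := hP (b - x0) (y - y0) (le_trans bh bar) (le_trans yk dcr).
have := hP (a - x0) (y - y0) (le_trans ah bar) (le_trans yk dcr).
rewrite !(addrC _ (_ - x0)) !(addrC _ (_ - y0)) !subrK => h1 h2.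
have u1 : e * (`|a - x0| + `|y - y0|) <= e * s by rewrite ler_wpM2l // /s; lra.
have u2 : e * (`|b - x0| + `|y - y0|) <= e * s by rewrite ler_wpM2l // /s; lra.
by move: (le_trans h1 u1) (le_trans h2 u2); clear; rewrite !ler_norml => /andP[? ?] /andP[? ?]; itv_lra.
Qed.

Section Rect.
Variables (P Q : R -> R -> R) (a0 b0 c0 d0 : R).
Hypotheses (cP : forall x y, a0 <= x <= b0 -> c0 <= y <= d0 -> cont2 P x y)
           (cQ : forall x y, a0 <= x <= b0 -> c0 <= y <= d0 -> cont2 Q x y).

Lemma flux_splitx a m b c d : a0 <= a -> a <= m -> m <= b -> b <= b0 ->
  c0 <= c -> c <= d -> d <= d0 ->
  flux P Q a b c d = flux P Q a m c d + flux P Q m b c d.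
Proof.
move=> a0a am mb bb0 c0c cd dd0; rewrite /flux.
have cy x : a0 <= x <= b0 -> ctsI c d (P x).
  move=> xI y /andP[cy yd]; apply: cont2_y; apply: cP => //.
  by rewrite (le_trans c0c) //= (le_trans yd).
have cx y : c0 <= y <= d0 -> ctsI a b (Q^~ y).
  move=> yI x /andP[ax xb]; apply: cont2_x; apply: cQ => //.
  by rewrite (le_trans a0a) //= (le_trans xb).
rewrite (rint_split _ a b m) //; last by apply: ctsIB; apply: cx; itv_lra.
rewrite !(rintB _ c d); [by ring| by apply: cy; lra..].
Qed.

Lemma flux_splity a b c m d : a0 <= a -> a <= b -> b <= b0 ->
  c0 <= c -> c <= m -> m <= d -> d <= d0 ->
  flux P Q a b c d = flux P Q a b c m + flux P Q a b m d.
Proof.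
move=> a0a ab bb0 c0c cm md dd0; rewrite /flux.
have cy x : a0 <= x <= b0 -> ctsI c d (P x).
  move=> xI y /andP[cy yd]; apply: cont2_y; apply: cP => //.
  by rewrite (le_trans c0c) //= (le_trans yd).
have cx y : c0 <= y <= d0 -> ctsI a b (Q^~ y).
  move=> yI x /andP[ax xb]; apply: cont2_x; apply: cQ => //.
  by rewrite (le_trans a0a) //= (le_trans xb).
rewrite (rint_split _ c d m) //; last by apply: ctsIB; apply: cy; itv_lra.
rewrite !(rintB _ a b); [by ring| by apply: cx; lra..].
Qed.

(* The linear parts of the expansions cancel exactly since P_x = Q_y = al. *)
Lemma flux_small x0 y0 al be ga e r a b c d :
  a0 <= a -> b <= b0 -> c0 <= c -> d <= d0 ->
  0 <= e ->
  (forall h k, `|h| <= r -> `|k| <= r ->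
    `|P (x0 + h) (y0 + k) - P x0 y0 - al * h - be * k| <= e * (`|h| + `|k|)) ->
  (forall h k, `|h| <= r -> `|k| <= r ->
    `|Q (x0 + h) (y0 + k) - Q x0 y0 - ga * h - al * k| <= e * (`|h| + `|k|)) ->
  a <= x0 <= b -> c <= y0 <= d -> b - a <= r -> d - c <= r ->
  `|flux P Q a b c d| <= 2 * e * (b - a + (d - c)) ^+ 2.
Proof.
move=> a0a bb0 c0c dd0 e0 hP hQ /andP[ax xb] /andP[cy yd] bar dcr.
have ab : a <= b by lra.
have cd : c <= d by lra.
set s := b - a + (d - c).
have PE y : c <= y <= d -> `|P b y - P a y - al * (b - a)| <= 2 * e * s.
  by move=> yI; apply: (edge_increment P x0 y0 al be e r) => //; rewrite ?ax ?cy.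
have QE x : a <= x <= b -> `|Q x d - Q x c - al * (d - c)| <= 2 * e * s.
  move=> xI; rewrite /s [X in _ <= _ * X]addrC.
  (* The other pair of edges is the same estimate with the coordinates exchanged. *)
  apply: (edge_increment (fun k h => Q h k) y0 x0 al ga e r) => //; rewrite ?ax ?cy //.
  by move=> h k hr kr; rewrite addrAC (addrC `|h|); exact: hQ.
have cyI x : a0 <= x <= b0 -> ctsI c d (P x).
  move=> xI y /andP[? ?]; apply: cont2_y; apply: cP => //.
  by itv_lra.
have cxI y : c0 <= y <= d0 -> ctsI a b (Q^~ y).
  move=> yI x /andP[? ?]; apply: cont2_x; apply: cQ => //.
  by itv_lra.
have cPP : ctsI c d (fun y => P b y - P a y) by apply: ctsIB; apply: cyI; lra.
have cQQ : ctsI a b (fun x => Q x d - Q x c) by apply: ctsIB; apply: cxI; lra.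
have I1 : `|rint c d (fun y => P b y - P a y) - al * (b - a) * (d - c)| <=
    2 * e * s * (d - c).
  rewrite -rint_cst // -rintB //; last exact: ctsI_cst.
  by apply: rint_bound => //; apply: ctsIB => //; exact: ctsI_cst.
have I2 : `|rint a b (fun x => Q x d - Q x c) - al * (d - c) * (b - a)| <=
    2 * e * s * (b - a).
  rewrite -rint_cst // -rintB //; last exact: ctsI_cst.
  by apply: rint_bound => //; apply: ctsIB => //; exact: ctsI_cst.
move: I1 I2.
rewrite /flux -/s !ler_norml => /andP[? ?] /andP[? ?].
have -> : 2 * e * s ^+ 2 = 2 * e * s * (b - a) + 2 * e * s * (d - c).
  by rewrite /s; ring.
by itv_lra.
Qed.

End Rect.
End Goursat.
Arguments flux {R}.

Section GoursatThm.
Variable R : realType.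
Implicit Types (a b c d x y : R) (P Q : R -> R -> R).

(** Every left end lies below every right end, so the supremum of the left ends belongs to all the
    intervals. *)
Lemma nested_point (u : nat -> R) (l : R) : 0 <= l ->
  (forall n, u n <= u n.+1) ->
  (forall n, u n.+1 + l / 2 ^+ n.+1 <= u n + l / 2 ^+ n) ->
  exists x, forall n, u n <= x <= u n + l / 2 ^+ n.
Proof.
move=> l0 ui di.
have l2 n : 0 <= l / 2 ^+ n by rewrite divr_ge0 // exprn_ge0.
have um m n : (m <= n)%N -> u m <= u n.
  by move=> mn; apply: (@homo_leq _ u (fun a b => a <= b)) => //; apply: le_trans.
have dm m n : (m <= n)%N -> u n + l / 2 ^+ n <= u m + l / 2 ^+ m.
  move=> mn; apply: (@homo_leq _ (fun n => u n + l / 2 ^+ n) (fun a b => b <= a)) => //.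
  by move=> ? ? ? h1 h2; exact: le_trans h2 h1.
have ub m n : u m <= u n + l / 2 ^+ n.
  have [mn|/ltnW nm] := leqP m n.
    by rewrite (le_trans (um _ _ mn)) // lerDl.
  by rewrite (le_trans _ (dm _ _ nm)) // lerDl.
exists (sup (range u)) => n; apply/andP; split.
  apply: ub_le_sup; last by exists n.
  by exists (u 0 + l / 2 ^+ 0) => _ [m _ <-].
by apply: ge_sup => [|_ [m _ <-] //]; exists (u 0), 0.
Qed.

(** Bisection: a nonzero flux leaves at least a quarter of itself in one of the four quarters. The
    nested quarters shrink to a point, where [flux_small] makes the flux small compared with the
    area. *)
Lemma goursat_rect P Q a0 b0 c0 d0 : a0 < b0 -> c0 < d0 ->
  (forall x y, a0 <= x <= b0 -> c0 <= y <= d0 -> cont2 P x y /\ cont2 Q x y) ->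
  (forall x y, a0 <= x <= b0 -> c0 <= y <= d0 ->
     exists al be ga, diff2 P x y al be /\ diff2 Q x y ga al) ->
  flux P Q a0 b0 c0 d0 = 0.
Proof.
move=> ab cd cPQ dPQ; apply/eqP/negPn/negP => f0.
have cP x y : a0 <= x <= b0 -> c0 <= y <= d0 -> cont2 P x y.
  by move=> ? ?; have [] := cPQ x y.
have cQ x y : a0 <= x <= b0 -> c0 <= y <= d0 -> cont2 Q x y.
  by move=> ? ?; have [] := cPQ x y.
set A := b0 - a0; set D := d0 - c0.
have A0 : 0 < A by rewrite subr_gt0.
have D0 : 0 < D by rewrite subr_gt0.
pose F n (p : R * R) := `|flux P Q p.1 (p.1 + A / 2 ^+ n) p.2 (p.2 + D / 2 ^+ n)|.
(* The flux per unit area, a lower bound that survives the passage to the best quarter. *)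
pose eta := `|flux P Q a0 b0 c0 d0| / (A * D).
have eta0 : 0 < eta by rewrite divr_gt0 ?normr_gt0 // mulr_gt0.
pose In n (p : R * R) := [/\ a0 <= p.1, p.1 + A / 2 ^+ n <= b0, c0 <= p.2 & p.2 + D / 2 ^+ n <= d0].
pose good n p := In n p /\ eta * (A / 2 ^+ n * (D / 2 ^+ n)) <= F n p.
have pow2 n : 0 < 2 ^+ n :> R by rewrite exprn_gt0.
have half n (x : R) : x / 2 ^+ n = x / 2 ^+ n.+1 + x / 2 ^+ n.+1.
  rewrite exprS; field; exact: lt0r_neq0.
have step n p : good n p -> exists q, good n.+1 q /\
   (p.1 <= q.1 /\ q.1 + A / 2 ^+ n.+1 <= p.1 + A / 2 ^+ n) /\
   (p.2 <= q.2 /\ q.2 + D / 2 ^+ n.+1 <= p.2 + D / 2 ^+ n).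
  case: p => p1 p2 [[/= h1 h2 h3 h4]]; rewrite /F /= => hF.
  set A' := A / 2 ^+ n.+1; set D' := D / 2 ^+ n.+1.
  have A'0 : 0 < A' by rewrite divr_gt0.
  have D'0 : 0 < D' by rewrite divr_gt0.
  move: hF h2 h4; rewrite (half n A) (half n D) -/A' -/D' => hF h2 h4.
  move: hF.
  rewrite (@flux_splitx _ _ _ _ _ _ _ cP cQ p1 (p1 + A')) //; try lra.
  rewrite !(@flux_splity _ _ _ _ _ _ _ cP cQ _ _ p2 (p2 + D') (p2 + (D' + D'))) //; try lra.
  rewrite !(addrA p1) !(addrA p2).
  set f1 := flux _ _ _ _ _ _; set f2 := flux _ _ _ _ _ _.
  set f3 := flux _ _ _ _ _ _; set f4 := flux _ _ _ _ _ _.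
  move=> hF.
  have : eta * (A' * D') <= `|f1| \/ eta * (A' * D') <= `|f2| \/
         eta * (A' * D') <= `|f3| \/ eta * (A' * D') <= `|f4|.
    have [|k1] := leP (eta * (A' * D')) `|f1|; first by left.
    have [|k2] := leP (eta * (A' * D')) `|f2|; first by right; left.
    have [|k3] := leP (eta * (A' * D')) `|f3|; first by right; right; left.
    have [|k4] := leP (eta * (A' * D')) `|f4|; first by right; right; right.
    exfalso.
    have := le_trans hF (ler_normD _ _).
    have := ler_normD f3 f4; have := ler_normD f1 f2.
    have -> : eta * ((A' + A') * (D' + D')) = 4 * (eta * (A' * D')) by ring.
    by move: k1 k2 k3 k4; clear; lra.
  case=> [k|[k|[k|k]]]; [exists (p1, p2)|exists (p1, p2 + D')|exists (p1 + A', p2)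
    |exists (p1 + A', p2 + D')]; (split; first split=> //);
    do ?split; rewrite /= -?/A' -?/D'; move: h1 h2 h3 h4 A'0 D'0; clear; lra.
have /choice[nx nxP] : forall np : nat * (R * R), exists q, good np.1 np.2 -> good np.1.+1 q /\
   (np.2.1 <= q.1 /\ q.1 + A / 2 ^+ np.1.+1 <= np.2.1 + A / 2 ^+ np.1) /\
   (np.2.2 <= q.2 /\ q.2 + D / 2 ^+ np.1.+1 <= np.2.2 + D / 2 ^+ np.1).
  move=> [n p] /=; have [/step[q hq]|ng] := pselect (good n p); first by exists q.
  by exists p.
pose fix u n : R * R := if n is m.+1 then nx (m, u m) else (a0, c0).
have gu n : good n (u n).
  elim: n => [|n ih]; last by have [] := nxP (n, u n) ih.
  split; first by split => //=; rewrite expr0 divr1 /A /D; lra.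
  rewrite /F /= !expr0 !divr1 /A /D !(addrC _ (_ - _)) !subrK -/A -/D /eta.
  by rewrite divfK // mulf_neq0 ?lt0r_neq0.
have [x0 hx] : exists x, forall n, (u n).1 <= x <= (u n).1 + A / 2 ^+ n.
  apply: nested_point => [|n|n]; first exact: ltW.
    by have [_ [[]]] := nxP (n, u n) (gu n).
  by have [_ [[]]] := nxP (n, u n) (gu n).
have [y0 hy] : exists y, forall n, (u n).2 <= y <= (u n).2 + D / 2 ^+ n.
  apply: nested_point => [|n|n]; first exact: ltW.
    by have [_ [_ []]] := nxP (n, u n) (gu n).
  by have [_ [_ []]] := nxP (n, u n) (gu n).
have xI : a0 <= x0 <= b0.
  by have := hx 0; rewrite /= expr0 divr1 /A addrC subrK.
have yI : c0 <= y0 <= d0.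
  by have := hy 0; rewrite /= expr0 divr1 /D addrC subrK.
have [al [be [ga [dP dQ]]]] := dPQ _ _ xI yI.
(* Chosen so that the bound of [flux_small] at scale [n] is exactly half of the lower bound [eta]
   times the area. *)
pose e := eta * (A * D) / (4 * (A + D) ^+ 2).
have AD0 : 0 < A + D by rewrite addr_gt0.
have AmD0 : 0 < A * D by exact: mulr_gt0.
have AD2 : 0 < (A + D) ^+ 2 by exact: exprn_gt0.
have e0 : 0 < e by apply: divr_gt0; apply: mulr_gt0.
have [r1 r10 hP] := dP e e0; have [r2 r20 hQ] := dQ e e0.
have r0 : 0 < Num.min r1 r2 by rewrite lt_min r10.
have [n hn] : exists n, (A + D) / 2 ^+ n < Num.min r1 r2.
  have := cvg_geometric (A + D) (_ : `|2^-1 : R| < 1).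
  rewrite ger0_norm ?invr_ge0 // invf_lt1 // ltr1n => /(_ isT).
  move/cvgrPdist_lt => /(_ _ r0) [N _ /(_ N (leqnn N))].
  rewrite sub0r normrN => /(le_lt_trans (ler_norm _)) h; exists N.
  by rewrite /geometric /= exprVn in h.
have [[h1 h2 h3 h4] hF] := gu n.
have An0 : 0 < A / 2 ^+ n by rewrite divr_gt0.
have Dn0 : 0 < D / 2 ^+ n by rewrite divr_gt0.
move: hn; rewrite lt_min mulrDl => /andP[n1 n2].
have K := @flux_small _ P Q a0 b0 c0 d0 cP cQ x0 y0 al be ga e (A / 2 ^+ n + D / 2 ^+ n) _ _ _ _ h1 h2 h3 h4 (ltW e0).
have {}K := K _ _ (hx n) (hy n).
have : F n (u n) <= 2 * e * (A / 2 ^+ n + D / 2 ^+ n) ^+ 2.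
  have -> : A / 2 ^+ n + D / 2 ^+ n = (u n).1 + A / 2 ^+ n - (u n).1 + ((u n).2 + D / 2 ^+ n - (u n).2) by ring.
  apply: K; try (move: An0 Dn0; clear; lra).
    by move=> h k hr kr; apply: hP; [exact: le_lt_trans hr n1|exact: le_lt_trans kr n1].
  by move=> h k hr kr; apply: hQ; [exact: le_lt_trans hr n2|exact: le_lt_trans kr n2].
move/(le_trans hF); rewrite -mulrDl /e.
have -> : eta * (A / 2 ^+ n * (D / 2 ^+ n)) = eta * (A * D) / (2 ^+ n) ^+ 2.
  by field; exact: lt0r_neq0.
have -> : 2 * (eta * (A * D) / (4 * (A + D) ^+ 2)) * ((A + D) / 2 ^+ n) ^+ 2 =
   (eta * (A * D) / (2 ^+ n) ^+ 2) / 2.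
  by field; rewrite !lt0r_neq0.
have : 0 < eta * (A * D) / (2 ^+ n) ^+ 2 by apply: divr_gt0; [exact: mulr_gt0|exact: exprn_gt0].
by clear; lra.
Qed.

End GoursatThm.

(** * Holomorphy, first-order expansions and polar parameters *)

Definition hol {R : realType} (F : R[i] -> R[i]) (z : R[i]) :=
  @derivable R[i] R[i]^o R[i]^o F z 1.

Notation hol_disc f := (forall z, cabs z < 1 -> hol f z).

Definition cont_at {R : realType} (F : R[i] -> R[i]) (z : R[i]) :=
  {for (z : R[i]^o), continuous (F : R[i]^o -> R[i]^o)}.

Definition rcont_at {R : realType} (u : R[i] -> R) (z : R[i]) :=
  {for (z : R[i]^o), continuous (u : R[i]^o -> R)}.

Definition pol {R : realType} (r t : R) : R[i] := Complex (r * cos t) (r * sin t).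

Notation rint_half := (rint (- (pi / 2)) (pi / 2)).
Notation cts_half := (ctsI (- (pi / 2)) (pi / 2)).

(* The integral of u over the circle of radius r, parametrised by two half
   circles so that t stays in the range of atan. *)
Definition circ {R : realType} (u : R[i] -> R) (r : R) : R :=
  rint_half (fun t => u (pol r t) + u (- pol r t)).

Definition diff2c {R : realType} (F : R -> R -> R[i]) (x y : R) (A B : R[i]) :=
  forall e, 0 < e -> exists2 d, 0 < d & forall h k, `|h| < d -> `|k| < d ->
    cabs (F (x + h) (y + k) - F x y - A * h%:C%C - B * k%:C%C) <= e * (`|h| + `|k|).

Section Expansions.
Variable R : realType.
Implicit Types (x y r t : R) (z w : R[i]) (F : R[i] -> R[i]).

Lemma cReC (x : R) : cRe x%:C%C = x. Proof. by []. Qed.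
Lemma cImC (x : R) : cIm x%:C%C = 0. Proof. by []. Qed.

Lemma hol_cont F z : hol F z -> cont_at F z.
Proof. by move=> /derivable1_diffP/differentiable_continuous. Qed.

Lemma hol_expansion F z : hol F z -> exists L : R[i], forall e, 0 < e ->
  exists2 d, 0 < d & forall h, cabs h < d ->
    cabs (F (z + h) - F z - L * h) <= e * cabs h.
Proof.
move=> hF; exists ('D_1 (F : R[i]^o -> R[i]^o) (z : R[i]^o)) => e e0.
have /(@cvgc_ballP R) := hF => /(_ e e0).
move=> /(@nbhsc_ballP R)[d d0 hd]; exists d => // h hlt.
have [->|h0] := eqVneq h 0; first by rewrite addr0 subrr mulr0 subr0 cabs0 mulr0.
have := hd h; rewrite subr0 => /(_ hlt h0) /=.
rewrite /= (_ : h *: 1 = h :> R[i]); last by rewrite /GRing.scale /= mulr1.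
rewrite (addrC h z) => /ltW hh.
rewrite -ler_pdivrMr ?cabs_gt0 // -cabsV -cabsM mulrBl mulfK //.
by rewrite mulrC.
Qed.

Lemma derive_expansion (f : R -> R) x df : is_derive x 1 f df ->
  forall e, 0 < e -> exists2 d, 0 < d & forall h, `|h| < d ->
    `|f (x + h) - f x - df * h| <= e * `|h|.
Proof.
case=> hf <- e e0.
have /cvgrPdist_lt := hf => /(_ e e0).
move=> /nbhs_ballP[d d0 hd]; exists d => // h hlt.
have [->|h0] := eqVneq h 0; first by rewrite addr0 subrr mulr0 subr0 normr0 mulr0.
have := hd h; rewrite /ball /= sub0r normrN => /(_ hlt h0).
rewrite /GRing.scale /= mulr1 distrC (addrC h) => /ltW hh.
rewrite -ler_pdivrMr ?normr_gt0 // -normfV -normrM mulrBl mulfK //.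
by rewrite mulrC.
Qed.

Lemma diff2_x (f : R -> R) x y df : is_derive x 1 f df ->
  diff2 (fun a _ => f a) x y df 0.
Proof.
move=> /derive_expansion hf e e0; have [d d0 h] := hf e e0.
exists d => // a b ad bd.
by rewrite mul0r subr0 (le_trans (h _ ad)) // ler_wpM2l ?lerDl // ltW.
Qed.

Lemma diff2_y (f : R -> R) x y df : is_derive y 1 f df ->
  diff2 (fun _ b => f b) x y 0 df.
Proof.
move=> /derive_expansion hf e e0; have [d d0 h] := hf e e0.
exists d => // a b ad bd.
by rewrite mul0r subr0 (le_trans (h _ bd)) // ler_wpM2l ?lerDr // ltW.
Qed.

Lemma diff2_lip (P : R -> R -> R) x y a b : diff2 P x y a b ->
  exists2 d, 0 < d & forall h k, `|h| < d -> `|k| < d ->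
    `|P (x + h) (y + k) - P x y| <= (`|a| + `|b| + 1) * (`|h| + `|k|).
Proof.
move=> /(_ 1 ltr01)[d d0 hd]; exists d => // h k hh kk.
have := hd _ _ hh kk; rewrite mul1r => H.
have -> : P (x + h) (y + k) - P x y =
  (a * h + b * k) + (P (x + h) (y + k) - P x y - a * h - b * k) by ring.
rewrite (le_trans (ler_normD _ _)) // (mulrDl _ 1) mul1r.
apply: lerD => //; rewrite mulrDl (le_trans (ler_normD _ _)) // !normrM.
by apply: lerD; apply: ler_wpM2l; rewrite // ?lerDl ?lerDr.
Qed.

Lemma diff2M (P Q : R -> R -> R) x y a b c d : diff2 P x y a b -> diff2 Q x y c d ->
  diff2 (fun s t => P s t * Q s t) x y (a * Q x y + P x y * c) (b * Q x y + P x y * d).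
Proof.
move=> hP hQ e e0.
have [d1 d10 h1] := diff2_lip _ _ _ _ _ hP.
have [d2 d20 h2] := diff2_lip _ _ _ _ _ hQ.
set M1 := `|a| + `|b| + 1 in h1; set M2 := `|c| + `|d| + 1 in h2.
have M10 : 0 < M1 by rewrite ltr_wpDl ?addr_ge0.
have M20 : 0 < M2 by rewrite ltr_wpDl ?addr_ge0.
set p := P x y; set q := Q x y.
pose e1 := e / 3 / (`|q| + 1); pose e2 := e / 3 / (`|p| + 1).
have q1 : 0 < `|q| + 1 by rewrite ltr_wpDl.
have p1 : 0 < `|p| + 1 by rewrite ltr_wpDl.
have e10 : 0 < e1 by rewrite !divr_gt0.
have e20 : 0 < e2 by rewrite !divr_gt0.
have [d3 d30 h3] := hP e1 e10; have [d4 d40 h4] := hQ e2 e20.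
(* Controls the quadratic term of the product: it is at most [M1 * M2 * s ^+ 2], and [s <= 2 * d5]
   makes this at most [e / 3 * s]. *)
pose d5 := e / 6 / (M1 * M2).
have d50 : 0 < d5 by rewrite !divr_gt0 // mulr_gt0.
exists (Num.min (Num.min d1 d2) (Num.min (Num.min d3 d4) d5)).
  by rewrite !lt_min d10 d20 d30 d40.
move=> h k; rewrite !lt_min => /andP[/andP[ha hb] /andP[/andP[hc hd] he]].
move=> /andP[/andP[ka kb] /andP[/andP[kc kd] ke]].
set s := `|h| + `|k|.
have s0 : 0 <= s by rewrite addr_ge0.
have {}h1 := h1 h k ha ka; have {}h2 := h2 h k hb kb.
have {}h3 := h3 h k hc kc; have {}h4 := h4 h k hd kd.
rewrite -/s -/p -/q in h1 h2 h3 h4 *.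
set P' := P (x + h) (y + k); set Q' := Q (x + h) (y + k).
rewrite -/P' -/Q' in h1 h2 h3 h4.
have -> : P' * Q' - p * q - (a * q + p * c) * h - (b * q + p * d) * k =
  (P' - p - a * h - b * k) * q + p * (Q' - q - c * h - d * k) + (P' - p) * (Q' - q) by ring.
rewrite (le_trans (ler_normD _ _)) // (le_trans (lerD (ler_normD _ _) (lexx _))) // !normrM.
have t1 : `|P' - p - a * h - b * k| * `|q| <= e / 3 * s.
  apply: le_trans (ler_wpM2r (normr_ge0 q) h3) _.
  rewrite mulrAC; apply: ler_wpM2r => //.
  rewrite /e1 mulrAC -mulrA ler_piMr ?divr_ge0 ?ltW //.
  by rewrite ltr_pdivrMr // mul1r ltrDl.
have t2 : `|p| * `|Q' - q - c * h - d * k| <= e / 3 * s.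
  apply: le_trans (ler_wpM2l (normr_ge0 p) h4) _.
  rewrite mulrA; apply: ler_wpM2r => //.
  rewrite /e2 mulrCA ler_piMr ?divr_ge0 ?ltW //.
  by rewrite ltr_pdivrMr // mul1r ltrDl.
have t3 : `|P' - p| * `|Q' - q| <= e / 3 * s.
  apply: le_trans (ler_pM _ _ h1 h2) _ => //.
  have -> : M1 * s * (M2 * s) = (M1 * M2 * s) * s by ring.
  apply: ler_wpM2r => //.
  have sd : s <= 2 * d5 by rewrite /s; move: (ltW he) (ltW ke); lra.
  apply: le_trans (ler_wpM2l _ sd) _; first by rewrite mulr_ge0 // ltW.
  rewrite /d5 le_eqVlt; apply/orP; left; apply/eqP; field.
  by rewrite !lt0r_neq0.
have -> : e * s = e / 3 * s + e / 3 * s + e / 3 * s by field.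
by apply: lerD t3; exact: lerD.
Qed.

Lemma diff2D (P Q : R -> R -> R) x y a b c d : diff2 P x y a b -> diff2 Q x y c d ->
  diff2 (fun s t => P s t + Q s t) x y (a + c) (b + d).
Proof.
move=> hP hQ e e0; have e20 : 0 < e / 2 by rewrite divr_gt0.
have [d1 d10 h1] := hP _ e20; have [d2 d20 h2] := hQ _ e20.
exists (Num.min d1 d2); first by rewrite lt_min d10.
move=> h k; rewrite !lt_min => /andP[ha hb] /andP[ka kb].
have := h1 _ _ ha ka; have := h2 _ _ hb kb.
set s := `|h| + `|k|; rewrite !ler_norml => /andP[? ?] /andP[? ?].
have -> : e * s = e / 2 * s + e / 2 * s by field.
by itv_lra.
Qed.

(** The Cauchy-Riemann equations enter here: both partial derivatives of the composite carry the
    same complex factor [L]. *)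
Lemma diff2c_comp F (G : R -> R -> R[i]) x y A B (L : R[i]) :
  (forall e, 0 < e -> exists2 d, 0 < d & forall h, cabs h < d ->
    cabs (F (G x y + h) - F (G x y) - L * h) <= e * cabs h) ->
  diff2c G x y A B -> diff2c (fun s t => F (G s t)) x y (L * A) (L * B).
Proof.
move=> hF hG e e0.
set M := cabs A + cabs B + 1.
have M0 : 0 < M by rewrite ltr_wpDl // addr_ge0 // cabs_ge0.
have [d1 d10 h1] := hF (e / 2 / M) (divr_gt0 (divr_gt0 e0 (ltr0n _ 2)) M0).
have L1 : 0 < cabs L + 1 by rewrite ltr_wpDl // cabs_ge0.
have [d2 d20 h2] := hG (e / 2 / (cabs L + 1)) (divr_gt0 (divr_gt0 e0 (ltr0n _ 2)) L1).
have [d3 d30 h3] := hG 1 ltr01.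
pose d4 := d1 / (2 * M).
have d40 : 0 < d4 by rewrite divr_gt0 // mulr_gt0.
exists (Num.min (Num.min d2 d3) d4); first by rewrite !lt_min d20 d30.
move=> h k; rewrite !lt_min => /andP[/andP[ha hb] hc] /andP[/andP[ka kb] kc].
set s := `|h| + `|k|.
have s0 : 0 <= s by rewrite addr_ge0.
have {}h2 := h2 _ _ ha ka; have {}h3 := h3 _ _ hb kb.
set z := G x y in h1 h2 h3 *; set z' := G (x + h) (y + k) in h2 h3 *.
rewrite -/s mul1r in h2 h3.
have AB : cabs (A * h%:C%C + B * k%:C%C) <= (cabs A + cabs B) * s.
  rewrite (le_trans (ler_cabsD _ _ _)) // !cabsM !cabsR mulrDl lerD //;
  by apply: ler_wpM2l; rewrite ?cabs_ge0 // ?lerDl ?lerDr.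
have zs : cabs (z' - z) <= M * s.
  have -> : z' - z = (A * h%:C%C + B * k%:C%C) +
     (z' - z - A * h%:C%C - B * k%:C%C) by ring.
  by rewrite (le_trans (ler_cabsD _ _ _)) // /M (mulrDl _ 1) mul1r lerD.
have zd : cabs (z' - z) < d1.
  apply: le_lt_trans zs _; rewrite mulrC -ltr_pdivlMr //.
  have -> : d1 / M = d4 + d4 by rewrite /d4; field; exact: lt0r_neq0.
  exact: ltrD.
have {}h1 := h1 _ zd; rewrite (addrC z) subrK in h1.
have -> : F z' - F z - L * A * h%:C%C - L * B * k%:C%C =
  (F z' - F z - L * (z' - z)) + L * (z' - z - A * h%:C%C - B * k%:C%C) by ring.
rewrite (le_trans (ler_cabsD _ _ _)) // cabsM.
have t1 : e / 2 / M * cabs (z' - z) <= e / 2 * s.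
  have -> : e / 2 * s = e / 2 / M * (M * s) by field; exact: lt0r_neq0.
  by rewrite ler_wpM2l // !divr_ge0 // ltW.
have t2 : cabs L * cabs (z' - z - A * h%:C%C - B * k%:C%C) <= e / 2 * s.
  apply: le_trans (ler_wpM2l (cabs_ge0 _ _) h2) _.
  rewrite mulrA; apply: ler_wpM2r => //.
  rewrite mulrCA ler_piMr ?divr_ge0 ?ltW //.
  by rewrite ltr_pdivrMr // mul1r ltrDl.
have -> : e * s = e / 2 * s + e / 2 * s by field.
by apply: lerD t2; exact: le_trans h1 t1.
Qed.

Lemma diff2c_ReIm (G : R -> R -> R[i]) x y A B :
  diff2 (fun s t => cRe (G s t)) x y (cRe A) (cRe B) ->
  diff2 (fun s t => cIm (G s t)) x y (cIm A) (cIm B) ->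
  diff2c G x y A B.
Proof.
move=> hP hQ e e0; have e20 : 0 < e / 2 by rewrite divr_gt0.
have [d1 d10 h1] := hP _ e20; have [d2 d20 h2] := hQ _ e20.
exists (Num.min d1 d2); first by rewrite lt_min d10.
move=> h k; rewrite !lt_min => /andP[ha hb] /andP[ka kb].
rewrite (le_trans (ler_ReIm _ _)) //.
have -> : e * (`|h| + `|k|) = e / 2 * (`|h| + `|k|) + e / 2 * (`|h| + `|k|) by field.
have := h1 _ _ ha ka; have := h2 _ _ hb kb.
rewrite !(cReB, cImB, cReM, cImM, cReC, cImC) !mulr0 !subr0 !add0r => ? ?; exact: lerD.
Qed.

Lemma diff2c_Re (G : R -> R -> R[i]) x y A B : diff2c G x y A B ->
  diff2 (fun s t => cRe (G s t)) x y (cRe A) (cRe B).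
Proof.
move=> hG e e0; have [d d0 hd] := hG e e0; exists d => // h k hh kk.
apply: le_trans (hd _ _ hh kk); apply: le_trans (ler_Re _ _).
by rewrite !(cReB, cReM, cReC, cImC) !mulr0 !subr0.
Qed.

Lemma diff2c_Im (G : R -> R -> R[i]) x y A B : diff2c G x y A B ->
  diff2 (fun s t => cIm (G s t)) x y (cIm A) (cIm B).
Proof.
move=> hG e e0; have [d d0 hd] := hG e e0; exists d => // h k hh kk.
apply: le_trans (hd _ _ hh kk); apply: le_trans (ler_Im _ _).
by rewrite !(cImB, cImM, cReC, cImC) !mulr0 !add0r.
Qed.

(** The radial derivative is [e^(iy)] and the angular one is [i x e^(iy)]. *)
Lemma diff2c_pol x y : diff2c pol x y (pol 1 y) (Complex 0 x * pol 1 y).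
Proof.
have dx : diff2 (fun a _ : R => a) x y 1 0 by apply: diff2_x; exact: is_derive_id.
have dc : diff2 (fun _ t : R => cos t) x y 0 (- sin y) by apply: diff2_y.
have ds : diff2 (fun _ t : R => sin t) x y 0 (cos y) by apply: diff2_y.
apply: diff2c_ReIm; [have := diff2M _ _ _ _ _ _ _ _ dx dc|have := diff2M _ _ _ _ _ _ _ _ dx ds].
  by rewrite /= !mul1r !mul0r !mulr0 !addr0 !add0r ?sub0r mulrN.
by rewrite /= !mul1r !mul0r !mulr0 !addr0 ?add0r.
Qed.

Lemma diff2cN (G : R -> R -> R[i]) x y A B : diff2c G x y A B ->
  diff2c (fun s t => - G s t) x y (- A) (- B).
Proof.
move=> hG e e0; have [d d0 hd] := hG e e0; exists d => // h k hh kk.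
apply: le_trans (hd _ _ hh kk); rewrite -cabsN le_eqVlt; apply/orP; left.
by apply/eqP; congr cabs; ring.
Qed.

Lemma cabs_pol r t : cabs (pol r t) = `|r|.
Proof.
rewrite /cabs /= !exprMn -mulrDr cos2Dsin2 mulr1.
exact: sqrtr_sqr.
Qed.

Lemma pol0 t : pol 0 t = 0 :> R[i].
Proof. by rewrite /pol !mul0r. Qed.

Lemma continuous_pol (p : R * R) :
  {for p, continuous (fun p : R * R => pol p.1 p.2 : R[i]^o)}.
Proof.
apply: (@continuous_comp _ _ _ (fun p : R * R => (p.1 * cos p.2, p.1 * sin p.2))
  (fun q => cplx q : R[i]^o)); last exact: continuous_cplx.
have c1 : (fun q : R * R => q.1) @ p --> p.1 by exact: cvg_fst.
have c2 : (fun q : R * R => q.2) @ p --> p.2 by exact: cvg_snd.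
have cc : (fun q : R * R => cos q.2) @ p --> cos p.2.
  by apply: continuous_comp; [exact: c2|exact: continuous_cos].
have cs : (fun q : R * R => sin q.2) @ p --> sin p.2.
  by apply: continuous_comp; [exact: c2|exact: continuous_sin].
by apply: (cvg_pair (G := nbhs _) (H := nbhs _)); apply: cvgM.
Qed.

Lemma cont_comp_pol (u : R[i] -> R) x y : rcont_at u (pol x y) ->
  cont2 (fun r t => u (pol r t)) x y.
Proof.
move=> h; apply: (@continuous_comp _ _ _ (fun p : R * R => pol p.1 p.2 : R[i]^o)
  (u : R[i]^o -> R)) => //; exact: continuous_pol.
Qed.

Lemma cont_comp_polN (u : R[i] -> R) x y : rcont_at u (- pol x y) ->
  cont2 (fun r t => u (- pol r t)) x y.
Proof.
move=> h; apply: (@continuous_comp _ _ _ (fun p : R * R => - pol p.1 p.2 : R[i]^o)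
  (u : R[i]^o -> R)) => //.
by apply: (@cvgN R[i] R[i]^o); exact: continuous_pol.
Qed.

Lemma cont_Re F z : cont_at F z -> rcont_at (fun z => cRe (F z)) z.
Proof. by move=> h; apply: (@continuous_comp R[i]^o R[i]^o R F (@complex.Re R)) => //; exact: continuous_Re. Qed.

Lemma cont_Im F z : cont_at F z -> rcont_at (fun z => cIm (F z)) z.
Proof. by move=> h; apply: (@continuous_comp R[i]^o R[i]^o R F (@complex.Im R)) => //; exact: continuous_Im. Qed.

Lemma cont_cabs F z : cont_at F z -> rcont_at (fun z => cabs (F z)) z.
Proof. by move=> h; apply: (@continuous_comp R[i]^o R[i]^o R F (@cabs R)) => //; exact: continuous_cabs. Qed.

End Expansions.

(** * Mean value property on circles *)

Section MeanValue.
Variable R : realType.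
Implicit Types (x y r t : R) (z w : R[i]) (F : R[i] -> R[i]) (u : R[i] -> R).

Lemma pihalf_gt0 : 0 < pi / 2 :> R.
Proof. by rewrite divr_gt0 // pi_gt0. Qed.

Lemma cont2D (P Q : R -> R -> R) x y : cont2 P x y -> cont2 Q x y ->
  cont2 (fun s t => P s t + Q s t) x y.
Proof. by move=> hP hQ; apply: cvgD; [exact: hP|exact: hQ]. Qed.

Lemma cont2M (P Q : R -> R -> R) x y : cont2 P x y -> cont2 Q x y ->
  cont2 (fun s t => P s t * Q s t) x y.
Proof. by move=> hP hQ; apply: cvgM; [exact: hP|exact: hQ]. Qed.

Lemma cont2_circ u x y : (forall z, cabs z = `|x| -> rcont_at u z) ->
  cont2 (fun r t => u (pol r t) + u (- pol r t)) x y.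
Proof.
move=> h; apply: cont2D; first by apply: cont_comp_pol; apply: h; rewrite cabs_pol.
by apply: cont_comp_polN; apply: h; rewrite cabsN cabs_pol.
Qed.

Lemma ctsI_circ u r a b : (forall z, cabs z = `|r| -> rcont_at u z) ->
  ctsI a b (fun t => u (pol r t) + u (- pol r t)).
Proof.
move=> h t _.
exact: (@cont2_y _ (fun r t => u (pol r t) + u (- pol r t)) r t (cont2_circ _ _ _ h)).
Qed.

(** Compactness of [[c, d]] makes the joint continuity uniform in [t]: each [t] has a neighbourhood
    on which [p x t'] and [p r t'] are both within [e' / 2] of [p x t], and finitely many of these
    cover the segment. *)
Lemma rint_continuous (p : R -> R -> R) c d x : c < d ->
  (\forall r \near x, ctsI c d (p r)) -> (forall t, c <= t <= d -> cont2 p x t) ->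
  {for x, continuous (fun r => rint c d (p r))}.
Proof.
move=> cd M cp; apply/(@cvgrPdist_le R R R (nbhs x)) => e e0.
have dc0 : 0 < d - c by rewrite subr_gt0.
pose e' := e / (d - c); have e'0 : 0 < e' by rewrite divr_gt0.
have /compact_near_coveringP K := @segment_compact R c d.
have N : \forall r \near x, `[c, d]%classic `<=` (fun t => `|p x t - p r t| < e').
  apply: (K R (nbhs x) (fun r t => `|p x t - p r t| < e')) => t /=.
  rewrite in_itv /= => tI; have /cvgrPdist_lt := cp t tI => /(_ (e' / 2)).
  rewrite divr_gt0 // => /(_ isT) [[/= A B] [hA hB] hAB].
  exists (B, A) => //= -[t' r] /= [Bt Ar].
  have h1 := hAB (x, t') (conj (nbhs_singleton hA) Bt).
  have h2 := hAB (r, t') (conj Ar Bt).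
  rewrite /= in h1 h2.
  have -> : p x t' - p r t' = (p x t - p r t') - (p x t - p x t') by ring.
  by rewrite (le_lt_trans (ler_normB _ _)) // [e']splitr addrC ltrD.
have Mx := nbhs_singleton M.
near=> r.
have rR : ctsI c d (p r) by near: r.
have hr : `[c, d]%classic `<=` (fun t => `|p x t - p r t| < e') by near: r.
have -> : e = e' * (d - c) by rewrite /e' divfK // lt0r_neq0.
rewrite -rintB //.
apply: rint_bound; [exact: ltW|exact: ctsIB|].
by move=> t tI; apply/ltW/hr; rewrite /= in_itv.
Unshelve. all: by end_near. Qed.

Lemma circ_continuous u x R0 : (forall z, cabs z < R0 -> rcont_at u z) ->
  `|x| < R0 -> {for x, continuous (circ u)}.
Proof.
move=> cu xR; have p0 := pihalf_gt0.
have cp r t : `|r| < R0 -> cont2 (fun r t => u (pol r t) + u (- pol r t)) r t.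
  by move=> rR; apply: cont2_circ => z zr; apply: cu; rewrite zr.
apply: (@rint_continuous (fun r t => u (pol r t) + u (- pol r t))); first by lra.
  have := @norm_continuous R R x; move/(@cvgrPdist_lt R R R (nbhs x)) => /(_ (R0 - `|x|)).
  rewrite subr_gt0 => /(_ xR); apply: filterS => r; rewrite distrC => h t _.
  apply: (@cont2_y _ (fun r t => u (pol r t) + u (- pol r t))); apply: cp.
  by have := le_lt_trans (ler_norm _) h; rewrite ltrD2r.
by move=> t _; exact: cp.
Qed.

(** The polar Cauchy-Riemann equations: the radial derivative of the real part is [1 / r] times the
    angular derivative of the imaginary part. The factor [r^-1] is there to make [al] common to both
    expansions, as [goursat_rect] requires. *)
Lemma Q_diff (F : R[i] -> R[i]) x t : 0 < x -> hol F (pol x t) -> hol F (- pol x t) ->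
  exists al be ga,
  diff2 (fun r t => cRe (F (pol r t)) + cRe (F (- pol r t))) x t al be /\
  diff2 (fun r t => (cIm (F (pol r t)) + cIm (F (- pol r t))) * r^-1) x t ga al.
Proof.
move=> x0 /hol_expansion[L1 h1] /hol_expansion[L2 h2].
have g1 := diff2c_comp _ _ _ _ _ _ _ _ h1 (diff2c_pol _ x t).
have g2 := diff2c_comp _ _ (fun r t => - pol r t) _ _ _ _ _ h2 (diff2cN _ _ _ _ _ _ (diff2c_pol _ x t)).
have hP := diff2D _ _ _ _ _ _ _ _ _ (diff2c_Re _ _ _ _ _ _ g1) (diff2c_Re _ _ _ _ _ _ g2).
have hQ := diff2D _ _ _ _ _ _ _ _ _ (diff2c_Im _ _ _ _ _ _ g1) (diff2c_Im _ _ _ _ _ _ g2).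
have hv : diff2 (fun r _ : R => r^-1) x t (- x^-2) 0.
  apply: diff2_x; have := @is_deriveV R id x 1 1 (lt0r_neq0 x0) (is_derive_id _ _).
  by rewrite /GRing.scale /= mulr1.
have := diff2M _ _ _ _ _ _ _ _ _ hQ hv; rewrite mulr0 addr0 => hQv.
do 3 eexists; split; first exact: hP.
set ga := (X in diff2 _ _ _ X _) in hQv.
set be := (X in diff2 _ _ _ _ X) in hQv.
suff -> : cRe (L1 * pol 1 t) + cRe (L2 * - pol 1 t) = be by exact: hQv.
rewrite /be !(cReM, cImM, cReN, cImN) /=.
by field; exact: lt0r_neq0.
Qed.

Lemma limit_const (K : R -> R) c v : {for c, continuous K} ->
  (forall d, 0 < d -> exists2 x, `|x - c| < d & K x = v) -> K c = v.
Proof.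
move=> cK h; apply/eqP/negPn/negP => ne.
have e0 : 0 < `|K c - v| by rewrite normr_gt0 subr_eq0.
have /cvgrPdist_lt/(_ _ e0) := cK => /nbhs_ballP[d d0 hd].
have [x xc Kx] := h d d0.
have := hd x; rewrite /ball /= distrC => /(_ xc).
by rewrite Kx ltxx.
Qed.

(** Goursat in the [(r, t)] rectangle. The edges [t = pi / 2] and [t = - (pi / 2)] cancel because
    the sum over the two half circles merely exchanges the points [i x] and [- i x]; the other two
    edges are the two circle integrals. *)
Lemma circ_hol_const F R0 r0 a b : (forall z, cabs z < R0 -> cont_at F z) ->
  (forall z, cabs z < R0 -> cabs z != r0 -> hol F z) ->
  0 < a -> a < b -> b < R0 -> (forall x, a <= x <= b -> x != r0) ->
  circ (fun z => cRe (F z)) a = circ (fun z => cRe (F z)) b.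
Proof.
move=> cF hF a0 ab bR ne.
pose P r t := cRe (F (pol r t)) + cRe (F (- pol r t)).
pose Q r t := (cIm (F (pol r t)) + cIm (F (- pol r t))) * r^-1.
have p0 := pihalf_gt0.
have nx x : a <= x <= b -> [/\ 0 < x, `|x| = x & x < R0].
  by move=> /andP[ax xb]; have x0 : 0 < x; [lra|split => //; [rewrite gtr0_norm|lra]].
have := @goursat_rect R P Q a b (- (pi / 2)) (pi / 2) ab (gtrN p0).
have cP x y : a <= x <= b -> cont2 P x y.
  move=> /nx[x0 nx' xR]; apply: (cont2_circ (fun z => cRe (F z))) => z zx.
  by apply: cont_Re; apply: cF; rewrite zx nx'.
move=> H; have {}H : flux P Q a b (- (pi / 2)) (pi / 2) = 0.
  apply: H => x y xab _; have [x0 nx' xR] := nx _ xab.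
    split; first exact: cP.
    apply: cont2M.
      apply: (cont2_circ (fun z => cIm (F z))) => z zx.
      by apply: cont_Im; apply: cF; rewrite zx nx'.
    apply: (@continuous_comp _ _ _ (fun q : R * R => q.1) (fun r : R => r^-1)).
      exact: cvg_fst.
    by apply: inv_continuous; exact: lt0r_neq0.
  by apply: Q_diff => //; apply: hF; rewrite ?cabsN cabs_pol nx' // ne.
move: H; rewrite /flux.
have -> : rint a b (fun x => Q x (pi / 2) - Q x (- (pi / 2))) = 0.
  rewrite -(mul0r (b - a)) -(rint_cst _ a b 0 (ltW ab)); apply: eq_rint => x _.
  rewrite /Q /pol cosN sinN cos_pihalf sin_pihalf !mulr0 !mulr1 mulrN1.
  have -> : Complex 0 (- x) = - Complex 0 x by simpc.
  rewrite opprK [X in _ - X * _]addrC.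
  exact: subrr.
rewrite subr0 rintB.
- by move/eqP; rewrite subr_eq0 => /eqP.
- by move=> y _; apply: cont2_y; apply: cP; rewrite lexx ltW.
- by move=> y _; apply: cont2_y; apply: cP; rewrite lexx ltW.
Qed.

Lemma circ0 u : circ u 0 = 2 * pi * u 0.
Proof.
rewrite /circ -[RHS]mulrC (_ : u 0 * _ = (u 0 + u 0) * (pi / 2 - - (pi / 2))); last by field.
rewrite -rint_cst; last by have := pihalf_gt0; lra.
by apply: eq_rint => t _; rewrite pol0 oppr0.
Qed.

(* An exceptional circle |z| = r0 is harmless: the circular mean is continuous
   in the radius and locally constant off r0. *)
Lemma mean_value F R0 r0 b : (forall z, cabs z < R0 -> cont_at F z) ->
  (forall z, cabs z < R0 -> cabs z != r0 -> hol F z) ->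
  0 <= b -> b < R0 ->
  circ (fun z => cRe (F z)) b = 2 * pi * cRe (F 0).
Proof.
move=> cF hF b0 bR; set K := circ _; rewrite -(circ0 (fun z => cRe (F z))) -/K.
have cK x : 0 <= x <= b -> {for x, continuous K}.
  move=> /andP[x0 xb]; apply: (@circ_continuous _ x R0).
    by move=> z zR; apply: cont_Re; exact: cF.
  by rewrite ger0_norm //; exact: le_lt_trans xb bR.
have cst a c : 0 < a -> a <= c -> c <= b -> (forall x, a <= x <= c -> x != r0) -> K a = K c.
  move=> a0; rewrite le_eqVlt => /predU1P[-> //|ac] cb ne.
  apply: (circ_hol_const _ R0 r0) => //; exact: le_lt_trans cb bR.
move: b0; rewrite le_eqVlt => /predU1P[<- //|b0].
have K0 v s : 0 < s -> s <= b -> (forall x, 0 < x -> x < s -> K x = v) -> K 0 = v.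
  move=> s0 sb h; apply: limit_const; first by apply: cK; rewrite lexx ltW.
  move=> d d0; exists (Num.min s d / 2); last first.
    apply: h; first by rewrite divr_gt0 // lt_min s0.
    by rewrite ltr_pdivrMr // gt_min mulr_natr mulr2n ltrDr s0.
  rewrite subr0 ger0_norm ?divr_ge0 ?le_min ?ltW // ltr_pdivrMr // gt_min.
  by apply/orP; right; rewrite mulr_natr mulr2n ltrDr.
have [r00|r00] := leP r0 0.
  apply/esym; apply: (K0 _ b) => // x x0 xb; apply: cst => //; first exact: ltW.
  by move=> y /andP[xy _]; rewrite gt_eqF //; lra.
have [br|rb] := ltP b r0.
  apply/esym; apply: (K0 _ b) => // x x0 xb; apply: cst => //; first exact: ltW.
  by move=> y /andP[xy yb]; rewrite lt_eqF //; lra.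
have cl x : 0 < x -> x < r0 -> K x = K (r0 / 2).
  move=> x0 xr; have [h|h] := leP x (r0 / 2).
    by apply: cst => //; [lra|move=> y /andP[? ?]; rewrite lt_eqF //; lra].
  by apply/esym; apply: cst => //; [lra|lra|lra|move=> y /andP[? ?]; rewrite lt_eqF //; lra].
rewrite (K0 _ r0 r00 rb cl).
have Kr : K r0 = K (r0 / 2).
  apply: limit_const; first by apply: cK; rewrite rb ltW.
  move=> d d0; exists (Num.max (r0 / 2) (r0 - d / 2)); last first.
    by apply: cl; rewrite ?lt_max ?gt_max; lra.
  rewrite ltr0_norm ?opprB; last by rewrite subr_lt0 gt_max; lra.
  by rewrite ltrBlDl -ltrBlDr lt_max; apply/orP; right; lra.
move: rb; rewrite le_eqVlt => /predU1P[<- //|rb].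
rewrite -Kr; apply/esym; apply: limit_const; first by apply: cK; lra.
move=> d d0; exists (Num.min b (r0 + d / 2)).
  rewrite gtr0_norm; last by rewrite subr_gt0 lt_min; lra.
  by rewrite ltrBlDl gt_min; apply/orP; right; lra.
apply: cst; rewrite ?lt_min ?ge_min ?lexx //; first by lra.
by move=> x /andP[]; rewrite ge_min => /orP[]? ?; rewrite gt_eqF //; lra.
Qed.

End MeanValue.

(** * Closure properties of holomorphy and of circle integrals *)

Definition ccirc {R : realType} (u : R[i] -> R) (r : R) :=
  forall z, cabs z = `|r| -> rcont_at u z.

Definition poisson {R : realType} (rho : R) (w z : R[i]) : R :=
  (rho ^+ 2 - cabs w ^+ 2) / cabs (z - w) ^+ 2.

Notation circ_sqr f := (circ (fun z => cabs (f z) ^+ 2)).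

Section HolClosure.
Variable R : realType.
Implicit Types (z w c : R[i]) (F G : R[i] -> R[i]).

Lemma hol_cst c z : hol (fun=> c) z.
Proof. by apply: (@derivable_cst R[i] R[i]^o R[i]^o). Qed.

Lemma hol_id z : hol id z.
Proof. by apply: (@derivable_id R[i] R[i]^o). Qed.

Lemma holD F G z : hol F z -> hol G z -> hol (fun z => F z + G z) z.
Proof. by apply: (@derivableD R[i] R[i]^o R[i]^o). Qed.

Lemma holB F G z : hol F z -> hol G z -> hol (fun z => F z - G z) z.
Proof. by apply: (@derivableB R[i] R[i]^o R[i]^o). Qed.

Lemma holM F G z : hol F z -> hol G z -> hol (fun z => F z * G z) z.
Proof. by apply: (@derivableM R[i] R[i]^o). Qed.

Lemma holV F z : F z != 0 -> hol F z -> hol (fun z => (F z)^-1) z.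
Proof. by apply: (@derivableV R[i] R[i]^o). Qed.

Lemma hol_comp F G z : hol G z -> hol F (G z) -> hol (fun z => F (G z)) z.
Proof.
move=> /derivable1_diffP hG /derivable1_diffP hF; apply/derivable1_diffP.
exact: (differentiable_comp hG hF).
Qed.

Lemma hol_near F G z : (exists2 e : R, 0 < e & forall w, cabs (w - z) < e -> F w = G w) ->
  hol F z -> hol G z.
Proof.
move=> h; apply: (@near_eq_derivable R[i] R[i]^o R[i]^o F G z 1).
by apply/nbhsc_ballP; case: h => e e0 h; exists e.
Qed.

Lemma cont_atD F G z : cont_at F z -> cont_at G z -> cont_at (fun z => F z + G z) z.
Proof. by move=> hF hG; exact: (@cvgD R[i] R[i]^o _ _ _ _ _ _ _ hF hG). Qed.

Lemma cont_atM F G z : cont_at F z -> cont_at G z -> cont_at (fun z => F z * G z) z.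
Proof. by move=> hF hG; exact: (@cvgM R[i] _ _ _ _ _ _ _ hF hG). Qed.

Lemma holZ c F z : hol F z -> hol (fun z => c * F z) z.
Proof. exact: (holM (fun=> c) F z (hol_cst c z)). Qed.

Lemma cont_atZ c F z : cont_at F z -> cont_at (fun z => c * F z) z.
Proof. exact: (cont_atM (fun=> c) F z (hol_cont _ _ _ (hol_cst c z))). Qed.

Lemma cont_atP F z : cont_at F z <-> forall e : R, 0 < e -> exists2 d : R, 0 < d &
  forall w, cabs (w - z) < d -> cabs (F w - F z) < e.
Proof.
split.
  by move=> /(cvgc_ballP R _ (nbhs (z : R[i]^o)) F (F z)) h e /h /nbhsc_ballP.
move=> h; apply/(cvgc_ballP R _ (nbhs (z : R[i]^o)) F (F z)) => e /h h'.
exact/nbhsc_ballP.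
Qed.

(* L stands for the derivative of F at w. *)
Definition dquot F w (L : R[i]) z := if z == w then L else (F z - F w) / (z - w).

Lemma dquotM F w L z : dquot F w L z * (z - w) = F z - F w.
Proof.
rewrite /dquot; case: eqVneq => [->|zw]; first by rewrite !subrr mulr0.
by rewrite divfK // subr_eq0.
Qed.

Lemma hol_dquot F w L z : z != w -> hol F z -> hol (dquot F w L) z.
Proof.
move=> zw hF; apply: (@hol_near (fun z => (F z - F w) / (z - w))); last first.
  apply: (@holM (fun z => F z - F w) (fun z => (z - w)^-1)).
    exact: (holB F (fun=> F w) z hF (hol_cst (F w) z)).
  by apply: (@holV (fun z => z - w)); [rewrite subr_eq0|
    exact: (holB id (fun=> w) z (hol_id z) (hol_cst w z))].
exists (cabs (z - w)); first by rewrite cabs_gt0 subr_eq0.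
move=> v; rewrite /dquot; case: eqVneq => // ->.
by rewrite cabsC ltxx.
Qed.

(** Filled in with the derivative, the difference quotient is continuous at [w]. Its
    differentiability at [w] is left open; the exceptional circle of [mean_value] absorbs this. *)
Lemma cont_dquot F w : hol F w -> exists L, cont_at (dquot F w L) w.
Proof.
move=> /hol_expansion[L hL]; exists L; apply/cont_atP => e e0.
have [d d0 hd] := hL (e / 2) (divr_gt0 e0 (ltr0n _ 2)).
exists d => // z zw; rewrite {2}/dquot eqxx /dquot.
case: eqVneq => [_|ne]; first by rewrite subrr cabs0.
have zw0 : z - w != 0 by rewrite subr_eq0.
have := hd _ zw; rewrite (addrC w) subrK => h.
have -> : (F z - F w) / (z - w) - L = (F z - F w - L * (z - w)) / (z - w).
  by field.
rewrite cabsM cabsV ltr_pdivrMr ?cabs_gt0 // (le_lt_trans h) //.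
by rewrite ltr_pM2r ?cabs_gt0 //; lra.
Qed.

End HolClosure.

Section CircLemmas.
Variable R : realType.
Implicit Types (z w : R[i]) (u v : R[i] -> R) (r : R).

Lemma eq_circ u v r : (forall z, cabs z = `|r| -> u z = v z) -> circ u r = circ v r.
Proof. by move=> h; apply: eq_rint => t _; rewrite !h ?cabsN ?cabs_pol. Qed.

Lemma circD u v r : ccirc u r -> ccirc v r ->
  circ (fun z => u z + v z) r = circ u r + circ v r.
Proof.
move=> cu cv; rewrite /circ -rintD; [|exact: ctsI_circ..].
by apply: eq_rint => t _; rewrite addrACA.
Qed.

Lemma circZ c u r : ccirc u r -> circ (fun z => c * u z) r = c * circ u r.
Proof.
move=> cu; rewrite /circ -rintZ; last exact: ctsI_circ.
by apply: eq_rint => t _; rewrite mulrDr.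
Qed.

Lemma le_circ u v r : ccirc u r -> ccirc v r ->
  (forall z, cabs z = `|r| -> u z <= v z) -> circ u r <= circ v r.
Proof.
move=> cu cv h; apply: le_rint; [exact: ctsI_circ..|] => t _.
by apply: lerD; apply: h; rewrite ?cabsN cabs_pol.
Qed.

Lemma circ_ge0 u r : (forall z, cabs z = `|r| -> 0 <= u z) -> 0 <= circ u r.
Proof.
by move=> h; apply: rint_ge0 => t _; apply: addr_ge0; apply: h; rewrite ?cabsN cabs_pol.
Qed.

Lemma circ_cst c r : circ (fun=> c) r = 2 * pi * c :> R.
Proof.
rewrite /circ rint_cst; first by field.
by have := pihalf_gt0 R; lra.
Qed.

Lemma rcontD u v z : rcont_at u z -> rcont_at v z -> rcont_at (fun z => u z + v z) z.
Proof. by move=> hu hv; exact: (@cvgD R R^o _ _ _ _ _ _ _ hu hv). Qed.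

Lemma rcontM u v z : rcont_at u z -> rcont_at v z -> rcont_at (fun z => u z * v z) z.
Proof. by move=> hu hv; exact: (@cvgM R _ _ _ _ _ _ _ hu hv). Qed.

Lemma rcont_cst c z : rcont_at (fun=> c : R) z.
Proof. exact: (@cst_continuous R[i]^o R c (z : R[i]^o)). Qed.

Lemma rcontZ c u z : rcont_at u z -> rcont_at (fun z => c * u z) z.
Proof. exact: (rcontM (fun=> c) u z (rcont_cst c z)). Qed.

Lemma rcontX u n z : rcont_at u z -> rcont_at (fun z => u z ^+ n) z.
Proof.
move=> hu; elim: n => [|n ih]; first exact: rcont_cst.
rewrite (_ : (fun z => u z ^+ n.+1) = (fun z => u z * u z ^+ n)).
  exact: (rcontM u (fun z => u z ^+ n)).
by apply/funext => ?; rewrite exprS.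
Qed.

Lemma rcontV u z : u z != 0 -> rcont_at u z -> rcont_at (fun z => (u z)^-1) z.
Proof. by move=> u0 hu; exact: (@cvgV R _ _ _ _ _ u0 hu). Qed.

Lemma rcont_poisson rho w z : z != w -> rcont_at (poisson rho w) z.
Proof.
move=> zw; apply: (@rcontM (fun=> rho ^+ 2 - cabs w ^+ 2) (fun z => (cabs (z - w) ^+ 2)^-1)).
  exact: rcont_cst.
apply: (@rcontV (fun z => cabs (z - w) ^+ 2)); first by rewrite expf_neq0 // cabs_eq0 subr_eq0.
apply: (@rcontX (fun z => cabs (z - w))); apply: (@cont_cabs _ (fun z => z - w)).
exact: (hol_cont _ _ z (holB _ id (fun=> w) z (hol_id _ z) (hol_cst _ w z))).
Qed.

Lemma sqr_rcont (f : R[i] -> R[i]) z : hol f z -> rcont_at (fun z => cabs (f z) ^+ 2) z.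
Proof. by move=> h; apply: (@rcontX (fun z => cabs (f z))); apply: cont_cabs; exact: hol_cont. Qed.

End CircLemmas.
Arguments dquot {R}.

Lemma hol_derivable (R : realType) (F : R[i] -> R[i]) z : hol F z <-> @derivable R[i] R[i]^o R[i]^o F z 1.
Proof. by []. Qed.
Global Opaque hol.

(** * Measurability in the plane and Fubini for continuous kernels *)

Section PlaneMeasurability.
Variable R : realType.
Local Notation mu := (@lebesgue_measure R).

(** An open set is the union of the countably many rational boxes inside it, and boxes generate the
    product sigma-algebra. *)
Lemma open_measurable2 (U : set (R * R)) : open U -> measurable U.
Proof.
move=> oU.
pose box (q : rat * rat * (rat * rat)) : set (R * R) :=
  `]ratr q.1.1, ratr q.1.2[%classic `*` `]ratr q.2.1, ratr q.2.2[%classic.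
pose f (n : nat) : set (R * R) :=
  if unpickle n is Some q then (if `[< box q `<=` U >] then box q else set0) else set0.
have -> : U = \bigcup_n f n.
  apply/seteqP; split => [[x y] Uxy|p [n _]]; last first.
    rewrite /f; case: unpickle => // q; case: ifPn => // /asboolP; exact.
  have : nbhs (x, y) U by exact: open_nbhs_nbhs.
  move=> [[/= A B] [/nbhs_ballP[e1 /= e10 h1] /nbhs_ballP[e2 /= e20 h2]] hAB].
  have [a aP] := @rat_in_itvoo R (x - e1) x (ltac:(lra)).
  have [b bP] := @rat_in_itvoo R x (x + e1) (ltac:(lra)).
  have [c cP] := @rat_in_itvoo R (y - e2) y (ltac:(lra)).
  have [d dP] := @rat_in_itvoo R y (y + e2) (ltac:(lra)).
  move: aP bP cP dP; rewrite !in_itv /= => /andP[a1 a2] /andP[b1 b2] /andP[c1 c2] /andP[d1 d2].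
  exists (pickle ((a, b), (c, d))); first exact: I.
  rewrite /f pickleK.
  rewrite ifT; first by rewrite /box /=; split; rewrite /= in_itv /=; apply/andP; split.
  apply/asboolP => -[s t] [/=]; rewrite !in_itv /= => /andP[s1 s2] /andP[t1 t2].
  by apply: hAB; split => /=; [apply: h1|apply: h2]; rewrite /ball /= ltr_norml;
    itv_lra.
apply: bigcup_measurable => n _; rewrite /f; case: unpickle => // q.
by case: ifP => // _; apply: measurableX.
Qed.

Lemma continuous_measurable2 (U : set (R * R)) (F : R * R -> R) : open U ->
  (forall p, U p -> {for p, continuous F}) -> measurable_fun U F.
Proof.
move=> oU cF; apply: (measurability _ (RGenOpens.measurableE R)).
move=> _ [_ [a [b ->] <-]]; apply: open_measurable2.
rewrite openE => p [Up /=]; rewrite in_itv /= => /andP[aF Fb].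
have n1 : nbhs p U by exact: open_nbhs_nbhs.
have n2 : nbhs p [set q | a < F q < b].
  have [e e0 he] : exists2 e, 0 < e & forall y, `|F p - y| < e -> a < y < b.
    exists (Num.min (F p - a) (b - F p)); first by rewrite lt_min !subr_gt0 aF.
    by move=> y; rewrite lt_min !ltr_norml => /andP[/andP[? ?] /andP[? ?]]; itv_lra.
  have /cvgrPdist_lt/(_ _ e0) := cF p Up.
  by apply: filterS => q; exact: he.
apply: filterS2 n1 n2 => q Uq h; split => //=; by rewrite in_itv.
Qed.

Lemma rint_fubini (a b c d : R) (k : R -> R -> R) : a <= b -> c <= d ->
  (forall x y, cont2 k x y) -> (forall x y, 0 <= k x y) ->
  rint a b (fun x => rint c d (k x)) = rint c d (fun y => rint a b (k^~ y)).
Proof.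
move=> ab cd ck k0.
have cx y : ctsI a b (k^~ y) by move=> x _; apply: cont2_x.
have cy x : ctsI c d (k x) by move=> y _; apply: cont2_y.
have mk : measurable_fun [set: R * R] (fun p : R * R => k p.1 p.2).
  by apply: continuous_measurable2 => [|[x y] _]; [exact: openT|exact: ck].
rewrite /rint /Rintegral; congr fine.
pose D : set (R * R) := `[a, b]%classic `*` `[c, d]%classic.
have mD : measurable D by apply: measurableX.
pose f (p : R * R) : \bar R := (((fun p => (k p.1 p.2)%:E) : R * R -> \bar R) \_ D) p.
have mf : measurable_fun [set: R * R] f.
  apply/(measurable_restrict _ mD measurableT); rewrite setTI.
  by apply/measurable_EFinP; exact: measurable_funTS.
have f0 p : (0 <= f p)%E by apply: erestrict_ge0 => q _; rewrite lee_fin.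
have := @fubini_tonelli _ _ _ _ R mu mu f mf f0.
(* Turns an iterated integral over the whole plane, of a function supported in a box, into iterated
   integrals over the sides; applied once in each order. *)
have E (A B : set R) (g : R -> R -> R) (F : R -> R -> \bar R) :
    (forall x y, F x y = if (x \in A) && (y \in B) then (g x y)%:E else 0)%E ->
    (forall x, x \in A -> \int[mu]_(y in B) (g x y)%:E \is a fin_num)%E ->
    (\int[mu]_x \int[mu]_y F x y = \int[mu]_(x in A) (fine (\int[mu]_(y in B) (g x y)%:E))%:E)%E.
  move=> FE gfin; rewrite [RHS]integral_mkcond; apply: eq_integral => x _.
  rewrite [in RHS]/patch; case: ifPn => xA; last first.
    by apply: integral0_eq => y _; rewrite FE (negbTE xA).
  rewrite fineK ?gfin // [RHS]integral_mkcond; apply: eq_integral => y _.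
  by rewrite FE xA.
have fE x y : f (x, y) = if (x \in `[a, b]%classic) && (y \in `[c, d]%classic) then (k x y)%:E else 0%E.
  by rewrite /f /patch in_setX.
rewrite (E `[a, b]%classic `[c, d]%classic k); [|exact: fE|]; last first.
  by move=> x _; apply: integrable_fin_num => //; exact: ctsI_integrable.
rewrite (E `[c, d]%classic `[a, b]%classic (fun y x => k x y)); [by []| |].
  by move=> y x; rewrite fE andbC.
by move=> y _; apply: integrable_fin_num => //; exact: (ctsI_integrable _ _ _ _ (cx y)).
Qed.

End PlaneMeasurability.

(** * Poisson kernel, Poisson formula and Poisson inequality *)

Section Poisson.
Variable R : realType.
Implicit Types (z w : R[i]) (r rho : R) (f F phi : R[i] -> R[i]) (u : R[i] -> R).

Lemma mean_value_hol F R0 b : (forall z, cabs z < R0 -> hol F z) ->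
  0 <= b -> b < R0 ->
  circ (fun z => cRe (F z)) b = 2 * pi * cRe (F 0).
Proof.
move=> hF; apply: (@mean_value _ F R0 (-1)) => [z zR|z zR _]; last exact: hF.
by apply: hol_cont; exact: hF.
Qed.

Lemma real_complexB (x y : R) : (x - y)%:C%C = x%:C%C - y%:C%C.
Proof. exact: (rmorphB (real_complex R)). Qed.

Lemma real_complexM (x y : R) : (x * y)%:C%C = x%:C%C * y%:C%C.
Proof. exact: (rmorphM (real_complex R)). Qed.

Lemma real_complexV (x : R) : (x^-1)%:C%C = (x%:C%C)^-1.
Proof. exact: (fmorphV (real_complex R)). Qed.

Lemma invc_conj z : z^-1 = conjc z * (cabs z ^- 2)%:C%C.
Proof.
have [->|z0] := eqVneq z 0.
  by rewrite invr0 /= oppr0 mul0r.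
have z1 : (cabs z ^+ 2)%:C%C != 0 :> R[i].
  by rewrite -(rmorph0 (real_complex R)) (inj_eq (@complexI R)) expf_neq0 // cabs_eq0.
apply: (mulfI z0); rewrite divff // mulrA conj_mulc -rmorphM /= divff //.
by rewrite expf_neq0 // cabs_eq0.
Qed.

Lemma cRe_div z w : cRe (z / w) = cRe (z * conjc w) / cabs w ^+ 2.
Proof. by rewrite invc_conj mulrA cReM cReC cImC mulr0 subr0. Qed.

(** For [cabs z = rho] the right side is [poisson rho w z], which exhibits the kernel as the real
    part of a function holomorphic in [w]. This is what lets it be averaged after composition with
    [phi]. *)
Lemma Re_cayley z w :
  cRe ((z + w) / (z - w)) = (cabs z ^+ 2 - cabs w ^+ 2) / cabs (z - w) ^+ 2.
Proof.
rewrite cRe_div; congr (_ / _); rewrite !cabs_sqr.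
by case: z => a b; case: w => c d; simpc => /=; ring.
Qed.

Lemma cRe_conj z : cRe (conjc z) = cRe z.
Proof. by case: z. Qed.

Lemma conjcM z w : conjc (z * w) = conjc z * conjc w.
Proof. exact: rmorphM. Qed.

Lemma conjc_inj z : conjc z = 0 -> z = 0.
Proof. by case: z => a b [-> /eqP]; rewrite oppr_eq0 => /eqP->. Qed.

Lemma poisson_ge0 rho w z : cabs w <= rho -> 0 <= poisson rho w z.
Proof.
move=> wr; rewrite /poisson divr_ge0 ?sqr_ge0 // subr_ge0.
by rewrite ler_pXn2r // nnegrE ?cabs_ge0 // (le_trans (cabs_ge0 _ w)).
Qed.

Lemma circle_neq rho w z : cabs w < rho -> cabs z = rho -> z - w != 0.
Proof. by move=> wr zr; rewrite subr_eq0; apply: contraTneq wr => <-; rewrite zr ltxx. Qed.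

(* On the circle |z| = rho, the reflected factor rho^2 - conj w z equals z conj(z-w). *)
Lemma poisson_bracket rho w z : cabs w < rho -> cabs z = rho ->
  z / (z - w) + conjc w * z / ((rho ^+ 2)%:C%C - conjc w * z) = (poisson rho w z)%:C%C.
Proof.
move=> wr zr; have zw := circle_neq _ _ _ wr zr.
have z0 : z != 0 by rewrite -cabs_gt0 zr (le_lt_trans _ wr) // cabs_ge0.
have czw : conjc (z - w) != 0.
  by apply: contra zw => /eqP/conjc_inj ->.
rewrite /poisson real_complexM real_complexB -!zr real_complexV -!conj_mulc.
have -> : z * conjc z - conjc w * z = z * conjc (z - w).
  by rewrite rmorphB /=; ring.
rewrite rmorphB /= in czw *.
by field; rewrite z0 zw czw.
Qed.

(** Conjugating the Cayley quotient and using [cabs z = rho] makes the kernel the real part of a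
    function holomorphic in [z]: the pole at [w] is reflected to [rho ^+ 2 / conjc w], outside the
    circle. *)
Lemma poisson_cayley rho w z : cabs w < rho -> cabs z = rho ->
  cRe (((rho ^+ 2)%:C%C + conjc w * z) / ((rho ^+ 2)%:C%C - conjc w * z)) =
  poisson rho w z.
Proof.
move=> wr zr; rewrite /poisson -zr -Re_cayley -cRe_conj -conj_mulc.
have zw := circle_neq _ _ _ wr zr.
have z0 : z != 0 by rewrite -cabs_gt0 zr (le_lt_trans _ wr) // cabs_ge0.
have cz0 : conjc z != 0 by apply: contra z0 => /eqP/conjc_inj ->.
have e1 : z * conjc z + conjc w * z = z * conjc (z + w) by rewrite rmorphD /=; ring.
have e2 : z * conjc z - conjc w * z = z * conjc (z - w) by rewrite rmorphB /=; ring.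
rewrite e1 e2 -mulf_div divff // mul1r conjcM conjc_inv !conjcK.
by [].
Qed.

(** A zero has modulus [rho ^+ 2 / cabs w]. Replacing [cabs w] by its average [m] with [rho] keeps
    the quotient meaningful at [w = 0] and still larger than [rho]. *)
Lemma reflected_radius rho w : 0 < rho < 1 -> cabs w < rho ->
  exists R0, [/\ rho < R0, R0 <= 1 &
    forall z, cabs z < R0 -> (rho ^+ 2)%:C%C - conjc w * z != 0].
Proof.
move=> /andP[r0 r1] wr; set m := (cabs w + rho) / 2.
have m0 : 0 < m by rewrite /m; have := cabs_ge0 _ w; lra.
exists (Num.min 1 (rho ^+ 2 / m)); split.
- by rewrite lt_min r1 /= ltr_pdivlMr // expr2 ltr_pM2l // /m; lra.
- by rewrite ge_min lexx.
- move=> z; rewrite lt_min => /andP[_ zr]; rewrite subr_eq0; apply/eqP => E.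
  have := congr1 (@cabs R) E; rewrite cabsR cabsM cabs_conj ger0_norm ?sqr_ge0 // => {}E.
  move: zr; rewrite ltr_pdivlMr // E mulrC; apply/negP; rewrite -leNgt.
  by apply: ler_wpM2r; rewrite ?cabs_ge0 // /m; lra.
Qed.

Lemma hol_reflected rho w z : (rho ^+ 2)%:C%C - conjc w * z != 0 ->
  hol (fun z => ((rho ^+ 2)%:C%C - conjc w * z)^-1) z.
Proof.
move=> h.
have h1 := holZ _ (conjc w) id z (hol_id _ z).
exact: (@holV _ (fun z => (rho ^+ 2)%:C%C - conjc w * z) z h
  (holB _ (fun=> (rho ^+ 2)%:C%C) (fun z => conjc w * z) z (hol_cst _ _ z) h1)).
Qed.

Lemma circ_poisson rho w : 0 < rho < 1 -> cabs w < rho ->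
  circ (poisson rho w) rho = 2 * pi.
Proof.
move=> r01 wr; have [R0 [rR _ nz]] := reflected_radius _ _ r01 wr.
have /andP[r0 r1] := r01.
rewrite (eq_circ _ _ (fun z => cRe (((rho ^+ 2)%:C%C + conjc w * z) *
   ((rho ^+ 2)%:C%C - conjc w * z)^-1))); last first.
  by move=> z; rewrite gtr0_norm // => zr; rewrite poisson_cayley.
rewrite (@mean_value_hol (fun z => ((rho ^+ 2)%:C%C + conjc w * z) *
   ((rho ^+ 2)%:C%C - conjc w * z)^-1) R0) //; last exact: ltW.
  rewrite mulr0 addr0 subr0 divff ?mulr1 //.
  by have := nz 0; rewrite cabs0 mulr0 subr0; apply; exact: lt_trans rR.
move=> z zR; have h1 := holZ _ (conjc w) id z (hol_id _ z).
exact: (holM _ (fun z => (rho ^+ 2)%:C%C + conjc w * z) _ z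
  (holD _ (fun=> (rho ^+ 2)%:C%C) (fun z => conjc w * z) z (hol_cst _ _ z) h1)
  (hol_reflected _ _ _ (nz z zR))).
Qed.

Lemma ccirc_poisson rho w : 0 < rho -> cabs w < rho -> ccirc (poisson rho w) rho.
Proof.
move=> r0 wr z; rewrite gtr0_norm // => zr; apply: rcont_poisson.
by rewrite -subr_eq0; exact: circle_neq wr zr.
Qed.

(** By [poisson_bracket] the integrand is the real part of [F] on the circle. The first part of the
    kernel turns [f z - f w] into [z] times a difference quotient, the second is holomorphic beyond
    the circle, and both vanish at 0, so the mean is zero. At [w] only continuity is available,
    whence the exceptional circle of radius [cabs w]. *)
Lemma poisson_formula f rho w c : hol_disc f ->
  0 < rho < 1 -> cabs w < rho ->
  circ (fun z => poisson rho w z * cRe (c * (f z - f w))) rho = 0.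
Proof.
move=> hf r01 wr; have [R0 [rR R1 nz]] := reflected_radius _ _ r01 wr.
have /andP[r0 r1] := r01.
have [L cL] := cont_dquot _ _ _ (hf w (lt_trans wr r1)).
pose K z := ((rho ^+ 2)%:C%C - conjc w * z)^-1.
pose A z := dquot f w L z * z.
pose B z := (f z - f w) * (conjc w * z * K z).
pose F z := c * (A z + B z).
have hB z : cabs z < R0 -> hol B z.
  move=> zR; have h1 := holZ _ (conjc w) id z (hol_id _ z).
  have h2 := holM _ (fun z => conjc w * z) K z h1 (hol_reflected _ _ _ (nz z zR)).
  have h3 := holB _ f (fun=> f w) z (hf z (lt_le_trans zR R1)) (hol_cst _ (f w) z).
  exact: (holM _ (fun z => f z - f w) (fun z => conjc w * z * K z) z h3 h2).
have hA z : cabs z < R0 -> z != w -> hol A z.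
  move=> zR zw; have h1 := hol_dquot _ f w L z zw (hf z (lt_le_trans zR R1)).
  exact: (holM _ (dquot f w L) id z h1 (hol_id _ z)).
have hF z : cabs z < R0 -> z != w -> hol F z.
  move=> zR zw; have h1 := holD _ A B z (hA z zR zw) (hB z zR).
  exact: (holZ _ c (fun z => A z + B z) z h1).
have cF z : cabs z < R0 -> cont_at F z.
  move=> zR; have [zw|zw] := eqVneq z w; last by apply: hol_cont; exact: hF.
  have h0 : cont_at A z.
    rewrite zw; exact: (cont_atM _ (dquot f w L) id w cL (hol_cont _ _ _ (hol_id _ w))).
  have h1 := cont_atD _ A B z h0 (hol_cont _ _ _ (hB z zR)).
  exact: (cont_atZ _ c (fun z => A z + B z) z h1).
have := @mean_value _ F R0 (cabs w) rho cF _ (ltW r0) rR.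
have -> : F 0 = 0 by rewrite /F /A /B !(mulr0, mul0r, addr0).
rewrite mulr0 => H.
rewrite -H; last by move=> z zR zw; apply: hF => //; apply: contra zw => /eqP->.
apply: eq_circ => z; rewrite gtr0_norm // => zr.
have zw : z - w != 0 by exact: circle_neq wr zr.
have -> : F z = c * (f z - f w) * (poisson rho w z)%:C%C.
  rewrite /F /A /B -(poisson_bracket _ _ _ wr zr) -(dquotM _ f w L z).
  rewrite -/(K z); move: (K z) => k; by field.
by rewrite (cReM _ (c * (f z - f w))) cReC cImC mulr0 subr0 mulrC.
Qed.

Lemma sqr_cabsD z w : cabs (z + w) ^+ 2 =
  cabs z ^+ 2 + cabs w ^+ 2 + 2 * cRe (conjc z * w).
Proof. by rewrite !cabs_sqr; case: z => a b; case: w => c d; simpc => /=; ring. Qed.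

(** Expand [|f z|^2] around [f w]: the constant term has mean [|f w|^2], the linear term integrates
    to zero by [poisson_formula] with [c = conjc (f w)], and [|f z - f w|^2] is dropped since the
    kernel is non-negative. *)
Lemma poisson_ineq f rho w : hol_disc f ->
  0 < rho < 1 -> cabs w < rho ->
  2 * pi * cabs (f w) ^+ 2 <= circ (fun z => poisson rho w z * cabs (f z) ^+ 2) rho.
Proof.
move=> hf r01 wr; have /andP[r0 r1] := r01.
have cp := ccirc_poisson _ _ r0 wr.
have z1 z : cabs z = `|rho| -> cabs z < 1 by rewrite gtr0_norm // => ->.
have c1 : ccirc (fun z => poisson rho w z * cRe (conjc (f w) * (f z - f w))) rho.
  move=> z zr; apply: rcontM; first exact: cp.
  have h3 := holB _ f (fun=> f w) z (hf z (z1 z zr)) (hol_cst _ (f w) z).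
  apply: (@cont_Re _ (fun z => conjc (f w) * (f z - f w))); apply: hol_cont.
  exact: (holZ _ (conjc (f w)) (fun z => f z - f w) z h3).
have c2 : ccirc (fun z => poisson rho w z * cabs (f z) ^+ 2) rho.
  move=> z zr; apply: rcontM; first exact: cp.
  exact: (sqr_rcont _ f z (hf z (z1 z zr))).
have c3 k : ccirc (fun z => k * poisson rho w z) rho.
  by move=> z zr; apply: rcontZ; exact: cp.
have c4 : ccirc (fun z => 2 * (poisson rho w z * cRe (conjc (f w) * (f z - f w)))) rho.
  by move=> z zr; apply: rcontZ; exact: c1.
have -> : 2 * pi * cabs (f w) ^+ 2 = circ (fun z => cabs (f w) ^+ 2 * poisson rho w z +
   2 * (poisson rho w z * cRe (conjc (f w) * (f z - f w)))) rho.
  rewrite circD // (circZ _ _ (poisson rho w)) // circ_poisson //.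
  rewrite (circZ _ _ (fun z => poisson rho w z * cRe (conjc (f w) * (f z - f w)))) //.
  by rewrite poisson_formula // mulr0 addr0 mulrC.
apply: le_circ => //.
  by move=> z zr; apply: rcontD; [exact: c3|exact: c4].
move=> z zr; have p0 := poisson_ge0 rho w z (ltW wr).
rewrite -(subrK (f w) (f z)) (addrC _ (f w)) sqr_cabsD (addrC (f w)) subrK.
have := mulr_ge0 p0 (sqr_ge0 (cabs (f z - f w))).
by rewrite !mulrDr; lra.
Qed.

End Poisson.

(** * Littlewood subordination *)

Section Subordination.
Variable R : realType.
Implicit Types (z w : R[i]) (r rho : R) (f F phi : R[i] -> R[i]) (u : R[i] -> R).

Lemma polN r t : - pol r t = pol (- r) t :> R[i].
Proof. by rewrite /pol !mulNr; simpc. Qed.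

Lemma poisson_harnack rho w z : cabs w < rho -> cabs z = rho ->
  poisson rho w z <= (rho + cabs w) / (rho - cabs w).
Proof.
move=> wr zr; rewrite /poisson subr_sqr.
have d0 : 0 < rho - cabs w by rewrite subr_gt0.
have d1 : rho - cabs w <= cabs (z - w) by rewrite -zr ler_cabs_dist.
have d2 : 0 < cabs (z - w) by exact: lt_le_trans d1.
rewrite ler_pdivrMr ?exprn_gt0 // mulrAC ler_pdivlMr //.
have -> : (rho - cabs w) * (rho + cabs w) * (rho - cabs w) =
  (rho + cabs w) * (rho - cabs w) ^+ 2 by ring.
apply: ler_wpM2l; first by have := cabs_ge0 _ w; lra.
by rewrite ler_pXn2r // nnegrE ltW.
Qed.

Lemma cont_pol_fst r (x y : R) : {for (x, y), continuous (fun p : R * R => pol r p.1 : R[i]^o)}.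
Proof.
apply: (@continuous_comp _ _ _ (fun p : R * R => (r, p.1)) (fun q : R * R => pol q.1 q.2 : R[i]^o)).
  by apply: (cvg_pair (G := nbhs r) (H := nbhs x)); [exact: cvg_cst|exact: cvg_fst].
exact: continuous_pol.
Qed.

Lemma cont_pol_snd r (x y : R) : {for (x, y), continuous (fun p : R * R => pol r p.2 : R[i]^o)}.
Proof.
apply: (@continuous_comp _ _ _ (fun p : R * R => (r, p.2)) (fun q : R * R => pol q.1 q.2 : R[i]^o)).
  by apply: (cvg_pair (G := nbhs r) (H := nbhs y)); [exact: cvg_cst|exact: cvg_snd].
exact: continuous_pol.
Qed.

(** The absolute value on [rho] allows the second half circle to be treated as the first one with
    radius [- rho]. *)
Lemma cont2_kernel phi u r rho s t : (forall z, cabs z = `|r| -> hol phi z) ->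
  ccirc u rho -> pol rho t != phi (pol r s) ->
  cont2 (fun s t => poisson `|rho| (phi (pol r s)) (pol rho t) * u (pol rho t)) s t.
Proof.
move=> hp cu ne; have hs : cabs (pol r s) = `|r| by exact: cabs_pol.
have c1 : {for (s, t), continuous (fun p : R * R => phi (pol r p.1) : R[i]^o)}.
  apply: (@continuous_comp _ _ _ (fun p : R * R => pol r p.1 : R[i]^o) (phi : R[i]^o -> R[i]^o)).
    exact: cont_pol_fst.
  by apply: hol_cont; exact: hp.
have c2 := cont_pol_snd rho s t.
have c3 : {for (s, t), continuous (fun p : R * R => u (pol rho p.2))}.
  apply: (@continuous_comp _ _ _ (fun p : R * R => pol rho p.2 : R[i]^o) (u : R[i]^o -> R)) => //.
  by apply: cu; rewrite cabs_pol.
have c4 : {for (s, t), continuous (fun p : R * R => cabs (phi (pol r p.1)))}.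
  apply: (@continuous_comp _ _ _ (fun p : R * R => phi (pol r p.1) : R[i]^o) (@cabs R)).
    exact: c1.
  exact: continuous_cabs.
have c5 : {for (s, t), continuous (fun p : R * R => cabs (pol rho p.2 - phi (pol r p.1)))}.
  apply: (@continuous_comp _ _ _ (fun p : R * R => pol rho p.2 - phi (pol r p.1) : R[i]^o) (@cabs R)).
    exact: (@cvgB R[i] R[i]^o _ _ _ _ _ _ _ c2 c1).
  exact: continuous_cabs.
apply: cvgM; last exact: c3.
apply: cvgM.
  by apply: cvgB; [exact: cvg_cst|apply: cvgM; exact: c4].
apply: cvgV; first by rewrite expf_neq0 // cabs_eq0 subr_eq0.
by apply: cvgM; exact: c5.
Qed.

Lemma circ_poisson_comp phi rho r R0 z0 : (forall z, cabs z < R0 -> hol phi z) ->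
  (forall z, cabs z < R0 -> cabs (phi z) < rho) -> 0 <= r -> r < R0 ->
  cabs z0 = rho ->
  circ (fun z => poisson rho (phi z) z0) r = 2 * pi * poisson rho (phi 0) z0.
Proof.
move=> hp pr r0 rR zr.
have E z : poisson rho (phi z) z0 = cRe ((z0 + phi z) * (z0 - phi z)^-1).
  by rewrite Re_cayley zr.
rewrite E (eq_circ _ _ (fun z => cRe ((z0 + phi z) * (z0 - phi z)^-1))) //.
have H := @mean_value_hol _ (fun z => (z0 + phi z) * (z0 - phi z)^-1) R0 r.
apply: H r0 rR => z zR.
have h1 := holD _ (fun=> z0) phi z (hol_cst _ z0 z) (hp z zR).
have h2 := holB _ (fun=> z0) phi z (hol_cst _ z0 z) (hp z zR).
have ne : z0 - phi z != 0 by apply: circle_neq zr; exact: pr.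
exact: (holM _ (fun z => z0 + phi z) (fun z => (z0 - phi z)^-1) z h1
  (holV _ (fun z => z0 - phi z) z ne h2)).
Qed.

(* Littlewood's subordination principle: integrate the Poisson inequality at
   phi z over |z| = r; the kernel is harmonic in z. *)
Lemma subordination f phi rho r R0 : hol_disc f ->
  (forall z, cabs z < R0 -> hol phi z) ->
  (forall z, cabs z < R0 -> cabs (phi z) < rho) -> 0 <= r -> r < R0 ->
  0 < rho < 1 ->
  circ (fun z => cabs (f (phi z)) ^+ 2) r <=
  (rho + cabs (phi 0)) / (rho - cabs (phi 0)) * circ_sqr f rho.
Proof.
move=> hf hp pr r0 rR r01; have /andP[rho0 rho1] := r01.
set q := (rho + _) / _.
have pi0 := pihalf_gt0 R.
have hpi : - (pi / 2) < pi / 2 :> R by lra.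
have tp0 : 0 < 2 * pi :> R by rewrite mulr_gt0 // pi_gt0.
pose u z := cabs (f z) ^+ 2.
have cu a : `|a| = rho -> ccirc u a.
  by move=> ar z zr; apply: sqr_rcont; apply: hf; rewrite zr ar.
pose K z w := poisson rho (phi z) w * u w.
(* Summing over the four choices of half circles turns the double circle integral into one integral
   over a rectangle, to which [rint_fubini] applies. *)
pose k s t := K (pol r s) (pol rho t) + K (pol r s) (pol (- rho) t) +
  (K (pol (- r) s) (pol rho t) + K (pol (- r) s) (pol (- rho) t)).
have nr : `|r| = r by rewrite ger0_norm.
have nrr : `|rho| = rho by rewrite gtr0_norm.
have cK a b s t : `|a| = r -> `|b| = rho -> cont2 (fun s t => K (pol a s) (pol b t)) s t.
  move=> ar br; rewrite /K -br; apply: cont2_kernel.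
  - by move=> z; rewrite ar => zr; apply: hp; rewrite zr.
  - exact: cu.
  - rewrite -subr_eq0; apply: (@circle_neq _ rho); last by rewrite cabs_pol.
    by apply: pr; rewrite cabs_pol ar.
have K0 a b s t : `|a| = r -> `|b| = rho -> 0 <= K (pol a s) (pol b t).
  move=> ar br; rewrite mulr_ge0 ?sqr_ge0 // poisson_ge0 // ltW // pr //.
  by rewrite cabs_pol ar.
have nmr : `|- r| = r by rewrite normrN.
have nmrr : `|- rho| = rho by rewrite normrN.
have ck s t : cont2 k s t.
  by apply: cont2D; apply: cont2D; apply: cK.
have k0 s t : 0 <= k s t by rewrite !addr_ge0 // K0.
have F := rint_fubini _ (- (pi / 2)) (pi / 2) (- (pi / 2)) (pi / 2) k
  (ltW hpi) (ltW hpi) ck k0.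
have cKw z : cabs z = r -> ccirc (K z) rho.
  move=> zr w wr; apply: rcontM; last by apply: cu wr.
  have pz : cabs (phi z) < rho by apply: pr; rewrite zr.
  exact: (ccirc_poisson _ rho (phi z) rho0 pz w wr).
have Lk s : k s = fun t => K (pol r s) (pol rho t) + K (pol r s) (- pol rho t) +
   (K (- pol r s) (pol rho t) + K (- pol r s) (- pol rho t)).
  by apply/funext => t; rewrite /k !polN.
have L s : 2 * pi * (u (phi (pol r s)) + u (phi (- pol r s))) <=
    rint_half (k s).
  have -> : rint_half (k s) = circ (K (pol r s)) rho + circ (K (- pol r s)) rho.
    rewrite -rintD; [by rewrite Lk| |]; apply: ctsI_circ; apply: cKw;
    by rewrite ?cabsN cabs_pol.
  have p1 : cabs (phi (pol r s)) < rho by apply: pr; rewrite cabs_pol nr.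
  have p2 : cabs (phi (- pol r s)) < rho by apply: pr; rewrite cabsN cabs_pol nr.
  rewrite mulrDr; exact: (lerD (poisson_ineq _ f rho _ hf r01 p1) (poisson_ineq _ f rho _ hf r01 p2)).
(* With the boundary point fixed, the mean of the kernel over [cabs z = r] is its value at [phi 0],
   which Harnack's inequality bounds by [q]. *)
have U t : rint_half (k^~ t) <=
   2 * pi * q * (u (pol rho t) + u (- pol rho t)).
  have M w : cabs w = rho -> circ (K^~ w) r <=
    2 * pi * q * u w.
    move=> wr; have cp : ccirc (fun z => poisson rho (phi z) w) r.
      move=> z zr; have zR : cabs z < R0 by rewrite zr nr.
      have hz := hp z zR.
      apply: rcontM.
        apply: (rcontD _ (fun=> rho ^+ 2) (fun z => - (cabs (phi z) ^+ 2))); first exact: rcont_cst.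
        exact: (@cvgN R R^o _ _ _ _ _ (sqr_rcont _ phi z hz)).
      have ne : cabs (w - phi z) ^+ 2 != 0.
        by rewrite expf_eq0 cabs_eq0 /= (circle_neq _ rho (phi z) w (pr z zR) wr).
      apply: (@rcontV _ (fun z => cabs (w - phi z) ^+ 2) z ne).
      apply: (sqr_rcont _ (fun z => w - phi z)).
      exact: (holB _ (fun=> w) phi z (hol_cst _ w z) hz).
    rewrite (eq_circ _ _ (fun z => u w * poisson rho (phi z) w)); last first.
      by move=> z _; rewrite /K mulrC.
    rewrite (circZ _ _ (fun z => poisson rho (phi z) w) _ cp).
    rewrite (@circ_poisson_comp phi rho r R0 w hp pr r0 rR wr) mulrC.
    have p00 : cabs (phi 0) < rho by apply: pr; rewrite cabs0; exact: le_lt_trans rR.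
    exact: (ler_wpM2r (sqr_ge0 _) (ler_wpM2l (ltW tp0) (poisson_harnack rho _ w p00 wr))).
  have cB b : `|b| = rho -> cts_half
      (fun s => K (pol r s) (pol b t) + K (- pol r s) (pol b t)).
    move=> br s _.
    rewrite (_ : (fun s => _) = (fun s => K (pol r s) (pol b t) + K (pol (- r) s) (pol b t))).
      apply: (@cont2_x _ (fun s t => K (pol r s) (pol b t) + K (pol (- r) s) (pol b t))).
      by apply: cont2D; apply: cK.
    by apply/funext => s'; rewrite polN.
  have -> : rint_half (k^~ t) = circ (K^~ (pol rho t)) r + circ (K^~ (- pol rho t)) r.
    rewrite /circ (polN rho) -(rintD _ _ _ _ _ (cB rho nrr) (cB (- rho) nmrr)).
    by apply: eq_rint => s _; rewrite !polN /k; ring.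
  by rewrite mulrDr; apply: lerD; apply: M; rewrite ?cabsN cabs_pol.
have cup : ccirc (fun z => u (phi z)) r.
  move=> z zr; have zR : cabs z < R0 by rewrite zr nr.
  apply: (sqr_rcont _ (fun z => f (phi z))).
  by apply: hol_comp; [exact: hp|apply: hf; exact: lt_trans (pr z zR) rho1].
have crho := ctsI_circ _ _ _ (- (pi / 2)) (pi / 2) (cu rho nrr).
have cr := ctsI_circ _ _ _ (- (pi / 2)) (pi / 2) cup.
rewrite -(ler_pM2l tp0) mulrA.
have -> : 2 * pi * circ (fun z => cabs (f (phi z)) ^+ 2) r =
  rint_half (fun s => 2 * pi * (u (phi (pol r s)) + u (phi (- pol r s)))).
  by rewrite rintZ.
have -> : 2 * pi * q * circ_sqr f rho
  = rint_half (fun t => 2 * pi * q *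
      (u (pol rho t) + u (- pol rho t))).
  by rewrite rintZ.
have cI : cts_half (fun s => rint_half (k s)).
  move=> s _; apply: (@rint_continuous _ k _ _ s hpi); last by move=> t _; exact: ck.
  exact: (@nearW R (nbhs s) (fun s' => cts_half (k s')) _ (fun s' t _ => cont2_y _ k s' t (ck s' t))).
have cJ : cts_half (fun t => rint_half (k^~ t)).
  have ck' s t : cont2 (fun t s => k s t) t s.
    apply: (@continuous_comp _ _ _ (fun p : R * R => (p.2, p.1)) (fun p : R * R => k p.1 p.2) (t, s)).
      have c2 : (fun q : R * R => q.2) @ (t, s) --> s by exact: cvg_snd.
      have c1 : (fun q : R * R => q.1) @ (t, s) --> t by exact: cvg_fst.
      exact: (cvg_pair c2 c1).
    exact: ck.
  move=> t _; apply: (@rint_continuous _ (fun t s => k s t) _ _ t hpi); last by move=> s _; exact: ck'.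
  exact: (@nearW R (nbhs t) (fun t' => cts_half (k^~ t')) _ (fun t' s _ => cont2_y _ (fun t s => k s t) t' s (ck' s t'))).
have hL := ctsIM _ _ _ _ _ (ctsI_cst _ (- (pi / 2)) (pi / 2) (2 * pi)) cr.
have hR := ctsIM _ _ _ _ _ (ctsI_cst _ (- (pi / 2)) (pi / 2)
  (2 * pi * q)) crho.
apply: le_trans (le_rint _ _ _ _ _ hL cI (fun s _ => L s)) _.
by rewrite F; exact: (le_rint _ _ _ _ _ cJ hR (fun t _ => U t)).
Qed.

(** Subordination for the identity map; the constant is 1 because the identity fixes 0. *)
Lemma circ_mono f r rho : hol_disc f ->
  0 <= r -> r < rho -> rho < 1 ->
  circ_sqr f r <= circ_sqr f rho.
Proof.
move=> hf r0 rr r1; have rho0 : 0 < rho by exact: le_lt_trans rr.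
have := @subordination f id rho r rho hf (fun z _ => hol_id _ z) (fun z h => h) r0 rr.
rewrite rho0 r1 => /(_ isT); rewrite cabs0 addr0 subr0 divff ?mul1r //.
exact: lt0r_neq0.
Qed.

End Subordination.

(** * One-variable substitutions on the line *)

Section LineSubstitutions.
Variable R : realType.
Local Notation mu := (@lebesgue_measure R).
Local Open Scope ereal_scope.

(** Lebesgue measure is determined by its values on half-open intervals, and there it agrees with
    [|c|] times the pushforward under multiplication by [c]. For negative [c] the preimage is closed
    on the left instead, with the same length. *)
Lemma integral_scale (c : R) (f : R -> \bar R) : c != 0%R ->
  measurable_fun setT f -> (forall x, 0 <= f x) ->
  \int[mu]_x f x = `|c|%:E * \int[mu]_x f (c * x)%R.
Proof.
move=> c0 mf f0.
have mphi : measurable_fun [set: R] (fun x : R => c * x)%R by exact: measurable_funM.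
pose phi (x : measurableTypeR R) : measurableTypeR R := (c * x)%R.
pose k : {nonneg R} := NngNum (normr_ge0 c).
pose m0 : {measure set (measurableTypeR R) -> \bar R} := mscale k (pushforward mu phi).
pose m := m0 mphi.
have E : forall A, measurable A -> mu A = m A.
  apply: (@lebesgue_measure_unique R m) => X [[a b] _ <-].
  change (mu `]a, b]%classic = `|c|%:E * mu (phi @^-1` `]a, b]%classic)).
  have [cp|cn] := ltP 0%R c.
    have -> : phi @^-1` `]a, b] = `](a / c)%R, (b / c)%R]%classic.
      apply/seteqP; split => x /=; rewrite /phi !in_itv /= ltr_pdivrMr // ler_pdivlMr //;
      by rewrite mulrC.
    rewrite !lebesgue_measure_itv /= !lte_fin gtr0_norm // ltr_pM2r ?invr_gt0 //.
    case: ifP => _; last by rewrite mule0.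
    by rewrite -!EFinB -EFinM; congr EFin; field.
  have {}cn : (c < 0)%R by rewrite lt_neqAle c0.
  have -> : phi @^-1` `]a, b] = `[(b / c)%R, (a / c)%R[%classic.
    apply/seteqP; split => x /=; rewrite /phi !in_itv /= ler_ndivrMr // ltr_ndivlMr //;
    by rewrite mulrC andbC.
  rewrite !lebesgue_measure_itv /= !lte_fin ltr0_norm // ltr_nM2r ?invr_lt0 //.
  case: ifP => _; last by rewrite mule0.
  by rewrite -!EFinB -EFinM; congr EFin; field.
have -> : \int[mu]_x f x = \int[m]_x f x by apply: eq_measure_integral => A mA _; first [exact: E|exact/esym/E].
rewrite /m /m0 ge0_integral_mscale //=; congr (_ * _).
exact: (@ge0_integral_pushforward _ _ (measurableTypeR R) (measurableTypeR R) R phi mphi mu setT f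
  measurableT mf (fun y _ => f0 y)).
Qed.

Lemma integral_fold (f : R -> \bar R) : measurable_fun setT f -> (forall x, 0 <= f x) ->
  \int[mu]_x f x = \int[mu]_(x in `[0%R, +oo[) (f x + f (- x)%R).
Proof.
move=> mf f0.
have mfN : measurable_fun setT (fun x : R => f (- x)%R).
  by apply: measurableT_comp.
rewrite ge0_integralD //; [|by apply: measurable_funTS..].
rewrite (ge0_integration_by_substitution0 mfN) //.
under [X in _ = _ + X]eq_integral do rewrite opprK.
have -> : \int[mu]_(x in `]-oo, 0%R]) f x = \int[mu]_(x in `]-oo, 0%R[) f x.
  by rewrite integral_itv_bndo_bndc //; exact: measurable_funTS.
rewrite -ge0_integral_setU //.
- by congr (integral _ _ _); apply/seteqP; split => x //= _; rewrite !in_itv /= andbT;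
    case: (leP 0%R x) => _; [left|right].
- exact: measurable_funTS.
- apply/disj_set2P; rewrite -subset0 => x [] /=; rewrite !in_itv /= andbT.
  by rewrite leNgt => /negP.
Qed.

(** The substitution is made on [[- n, n]], and both sides pass to the limit by monotone
    convergence; the images exhaust the open interval between [- (pi / 2)] and [pi / 2]. *)
Lemma integral_atan (v : R -> R) : (forall x, {for x, continuous v}) -> (forall x, (0 <= v x)%R) ->
  \int[mu]_t ((1 + t ^+ 2)^-1 * v (atan t))%:E = (rint_half v)%:E.
Proof.
move=> cv v0.
have mv : measurable_fun setT v by apply: continuous_measurable_fun => x; exact: cv.
have ca : continuous (fun t : R => (1 + t ^+ 2)^-1)%R.
  move=> x; apply: cvgV; first by rewrite gt_eqF // ltr_wpDr ?sqr_ge0.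
  by apply: cvgD; [exact: cvg_cst|exact: exprn_continuous].
have dE : derive1 (@atan R) = (fun t : R => (1 + t ^+ 2)^-1)%R.
  by apply/funext => t; rewrite derive1_atan.
have mw : measurable_fun setT (fun t : R => ((1 + t ^+ 2)^-1 * v (atan t))%R).
  apply: continuous_measurable_fun => x; apply: cvgM; first exact: ca.
  by apply: continuous_comp; [exact: continuous_atan|exact: cv].
have fn n : \int[mu]_(t in `[(- n%:R)%R, n%:R%R]) ((1 + t ^+ 2)^-1 * v (atan t))%:E =
  \int[mu]_(x in `[atan (- n%:R)%R, atan n%:R%R]) (v x)%:E.
  rewrite (@integration_by_substitution_increasing R atan v) //.
  - by apply: eq_integral => t _; rewrite /= fctE derive1_atan mulrC.
  - by rewrite ge0_cp // ler0n.
  - by move=> x y _ _; exact: lt_atan.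
  - by move=> x _; rewrite dE; exact: ca.
  - apply/cvg_ex; exists ((1 + (- n%:R) ^+ 2)^-1)%R.
    by rewrite dE; apply: cvg_at_right_filter; exact: ca.
  - apply/cvg_ex; exists ((1 + n%:R ^+ 2)^-1)%R.
    by rewrite dE; apply: cvg_at_left_filter; exact: ca.
  - split; first by move=> x _; exact: derivable_atan.
      by apply: cvg_at_right_filter; exact: continuous_atan.
    by apply: cvg_at_left_filter; exact: continuous_atan.
  - by apply: continuous_subspaceT => x; exact: cv.
have mono (x y : R^nat) : nonincreasing_seq x -> nondecreasing_seq y ->
    {homo (fun n => `[x n, y n]%classic) : n m / (n <= m)%N >-> (n <= m)%O}.
  move=> hx hy n m nm; apply/subsetPset; apply: subset_itv; rewrite bnd_simp.
    exact: hx.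
  exact: hy.
have L1 : \int[mu]_(t in `[(- n%:R)%R, n%:R%R]) ((1 + t ^+ 2)^-1 * v (atan t))%:E @[n --> \oo]
    --> \int[mu]_t ((1 + t ^+ 2)^-1 * v (atan t))%:E.
  rewrite [X in _ --> X](_ : _ = \int[mu]_(t in \bigcup_n `[(- n%:R)%R, n%:R%R]%classic)
      ((1 + t ^+ 2)^-1 * v (atan t))%:E); last first.
    congr (integral _ _ _); apply/esym/seteqP; split => // x _.
    have hn := archi_boundP (normr_ge0 x).
    exists (Num.bound `|x|%R) => //=; rewrite in_itv /=; rewrite -ler_norml; exact: ltW.
  apply: ge0_nondecreasing_set_cvg_integral => //.
  - by apply: mono => n m nm; rewrite ?lerN2 ler_nat.
  - by move=> n; apply/measurable_EFinP; exact: measurable_funTS.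
  - by move=> n x _; rewrite lee_fin mulr_ge0 // invr_ge0 addr_ge0 ?sqr_ge0.
have L2 : \int[mu]_(x in `[atan (- n%:R)%R, atan n%:R%R]) (v x)%:E @[n --> \oo]
    --> \int[mu]_(x in `](- (pi / 2))%R, (pi / 2)%R[) (v x)%:E.
  rewrite [X in _ --> X](_ : _ = \int[mu]_(x in \bigcup_n `[atan (- n%:R)%R, atan n%:R%R]%classic)
      (v x)%:E); last first.
    congr (integral _ _ _); apply/seteqP; split => x /=.
      rewrite in_itv /= => xI.
      have hn := archi_boundP (normr_ge0 (tan x)).
      have tx : atan (tan x) = x by apply: tanK; rewrite in_itv.
      move/ltW : hn; rewrite ler_norml => /andP[h1 h2].
      exists (Num.bound `|tan x|%R) => //=; rewrite in_itv /=.
      by have := le_atan h1; have := le_atan h2; rewrite tx => -> ->.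
    case=> n _ /=; rewrite !in_itv /= => /andP[h1 h2].
    by rewrite (lt_le_trans (atan_gtNpi2 _) h1) (le_lt_trans h2 (atan_ltpi2 _)).
  apply: ge0_nondecreasing_set_cvg_integral => //.
  - by apply: mono => n m nm; apply: le_atan; rewrite ?lerN2 ler_nat.
  - by move=> n; apply/measurable_EFinP; exact: measurable_funTS.
  - by move=> n x _; rewrite lee_fin.
transitivity (\int[mu]_(x in `](- (pi / 2))%R, (pi / 2)%R[) (v x)%:E).
  have E : (fun n => \int[mu]_(t in `[(- n%:R)%R, n%:R%R]) ((1 + t ^+ 2)^-1 * v (atan t))%:E) =
    (fun n => \int[mu]_(x in `[atan (- n%:R)%R, atan n%:R%R]) (v x)%:E) by apply/funext.
  rewrite E in L1; exact: (cvg_unique _ L1 L2).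
rewrite /rint /Rintegral fineK; last first.
  by apply: integrable_fin_num => //; apply: ctsI_integrable => x _; exact: cv.
apply/esym/integral_itv_bndoo/measurable_EFinP; exact: measurable_funTS.
Qed.

End LineSubstitutions.

(** * Polar coordinates *)

Section PolarCoordinates.
Variable R : realType.
Local Notation mu := (@lebesgue_measure R).

Definition disc2 : set (R * R) := [set p | cabs (cplx p) < 1].

Lemma continuous_cabs2 (p : R * R) : {for p, continuous (fun p : R * R => cabs (cplx p))}.
Proof.
apply: (@continuous_comp _ _ _ (fun p : R * R => cplx p : R[i]^o) (@cabs R)).
  exact: continuous_cplx.
exact: continuous_cabs.
Qed.

Lemma open_disc2 : open disc2.
Proof.
rewrite openE => p; rewrite /disc2 /= => p1.
have e0 : 0 < 1 - cabs (cplx p) by rewrite subr_gt0.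
have /cvgrPdist_lt/(_ _ e0) := continuous_cabs2 p.
apply: filterS => q; rewrite /= distrC => h.
by have := le_lt_trans (ler_norm _) h; lra.
Qed.

Lemma measurable_disc2 : measurable disc2.
Proof. by apply: open_measurable2; exact: open_disc2. Qed.

Lemma measurable_rcont (u : R[i] -> R) : (forall z, cabs z < 1 -> rcont_at u z) ->
  measurable_fun disc2 (fun p => u (cplx p)).
Proof.
move=> cu; apply: continuous_measurable2; first exact: open_disc2.
move=> p p1; apply: (@continuous_comp _ _ _ (fun p : R * R => cplx p : R[i]^o) (u : R[i]^o -> R)).
  exact: continuous_cplx.
exact: cu.
Qed.

Lemma measurable_radial (g : R -> R) : measurable_fun (@I01 R) g ->
  measurable_fun disc2 (fun p => g (cabs (cplx p))).
Proof.
move=> mg.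
have mI : measurable (@I01 R) by rewrite /I01; exact: measurable_itv.
apply: (measurable_comp (F := @I01 R) (g := fun p => cabs (cplx p)) mI _ mg).
  by move=> _ [p p1 <-]; rewrite /I01 /= in_itv /= cabs_ge0.
by apply: measurable_rcont => z _; exact: continuous_cabs.
Qed.

Lemma sin_atanE (t : R) : sin (atan t) = t * cos (atan t).
Proof.
rewrite -{2}(atanK t) /tan divfK // gt_eqF // cos_gt0_pihalf //.
by rewrite atan_gtNpi2 atan_ltpi2.
Qed.

Lemma cos_atan_gt0 (t : R) : 0 < cos (atan t).
Proof. by rewrite cos_gt0_pihalf // atan_gtNpi2 atan_ltpi2. Qed.

Lemma cos_atan_sqr (t : R) : cos (atan t) ^+ 2 = (1 + t ^+ 2)^-1.
Proof. by rewrite cos_atan exprVn sqr_sqrtr // addr_ge0 ?sqr_ge0. Qed.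

(** No two-dimensional Jacobian is used: [y = x t] for fixed [x], then [x = r cos (atan t)] for
    fixed [t], then the angle [atan t], with Tonelli between the steps. The sign of [x] becomes the
    sign of [r]. *)
Lemma polar (g : R -> R) (u : R[i] -> R) : measurable_fun (@I01 R) g ->
  (forall r, 0 <= r < 1 -> 0 <= g r) ->
  (forall z, cabs z < 1 -> rcont_at u z) -> (forall z, 0 <= u z) ->
  (\int[area_meas]_(p in disc2) (u (cplx p) * g (cabs (cplx p)))%:E =
   \int[mu]_(r in `[0%R, 1%R[) (r * g r * circ u r)%:E)%E.
Proof.
move=> mg g0 cu u0.
pose h : R * R -> R := (fun p => u (cplx p) * g (cabs (cplx p))) \_ disc2.
have mh : measurable_fun [set: R * R] h.
  apply/(measurable_restrict _ measurable_disc2 measurableT); rewrite setTI.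
  by apply: measurable_funM; [exact: measurable_rcont|exact: measurable_radial].
have h0 p : 0 <= h p.
  rewrite /h patchE; case: ifPn => // /set_mem p1; rewrite mulr_ge0 // g0 //.
  by rewrite cabs_ge0.
have hpol r t : h (r * cos t, r * sin t) = if `|r| < 1 then u (pol r t) * g `|r| else 0.
  have E : cabs (cplx (r * cos t, r * sin t)) = `|r| := cabs_pol _ r t.
  rewrite /h patchE; have [r1|r1] := boolP (`|r| < 1).
    by rewrite ifT ?E //; apply/mem_set; rewrite /disc2 /= E.
  by rewrite ifF //; apply/negP => /set_mem; rewrite /disc2 /= E; apply/negP.
rewrite integral_mkcond.
have -> : (\int[area_meas]_x ((fun p => (u (cplx p) * g (cabs (cplx p)))%:E) \_ disc2) x =
   \int[mu \x mu]_p (h p)%:E)%E.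
  by apply: eq_integral => p _; rewrite /h !patchE; case: ifP.
rewrite fubini_tonelli1; [|exact/measurable_EFinP|by move=> p; rewrite lee_fin].
pose k1 (p : R * R) : \bar R := (`|p.1| * h (p.1, p.1 * p.2))%:E.
have mk1 : measurable_fun setT k1.
  apply/measurable_EFinP; apply: measurable_funM.
    by apply: measurableT_comp.
  apply: (measurableT_comp mh); apply: measurable_fun_pair => //.
  exact: measurable_funM.
have k10 p : (0 <= k1 p)%E by rewrite lee_fin mulr_ge0.
(* The factor [|x|] of the first substitution becomes [|r| cos (atan t)], and the second contributes
   another [cos (atan t)]; the squared cosine is [(1 + t ^+ 2)^-1], the derivative of [atan]. *)
pose k2 (p : R * R) : \bar R :=
  (`|p.1| * (1 + p.2 ^+ 2)^-1 * h (p.1 * cos (atan p.2), p.1 * sin (atan p.2)))%:E.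
have mca : measurable_fun setT (fun t : R => cos (atan t)).
  apply: continuous_measurable_fun => x; apply: continuous_comp.
    exact: continuous_atan.
  exact: continuous_cos.
have msa : measurable_fun setT (fun t : R => sin (atan t)).
  apply: continuous_measurable_fun => x; apply: continuous_comp.
    exact: continuous_atan.
  exact: continuous_sin.
have mk2 : measurable_fun setT k2.
  apply/measurable_EFinP; apply: measurable_funM.
    apply: measurable_funM; first by apply: measurableT_comp.
    rewrite (_ : (fun p : R * R => _) = (fun t : R => cos (atan t) ^+ 2) \o snd); last first.
      by apply/funext => p /=; rewrite cos_atan_sqr.
    by apply: measurableT_comp => //; apply: measurable_funX.
  apply: (measurableT_comp mh); apply: measurable_fun_pair; apply: measurable_funM => //.
    exact: (measurableT_comp mca).
  exact: (measurableT_comp msa).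
have k20 p : (0 <= k2 p)%E.
  by rewrite lee_fin !mulr_ge0 // invr_ge0 addr_ge0 ?sqr_ge0.
have mhx x : measurable_fun setT (fun y => (h (x, y))%:E).
  by apply/measurable_EFinP; apply: (measurableT_comp mh); exact: measurable_fun_pair.
have S1 x : x != 0 -> (\int[mu]_y (h (x, y))%:E = \int[mu]_t k1 (x, t))%E.
  move=> x0; rewrite (@integral_scale R x _ x0 (mhx x)); last by move=> ?; rewrite lee_fin.
  by rewrite -ge0_integralZl //; [exact: (measurableT_comp (mhx x))|move=> ? _; rewrite lee_fin].
transitivity (\int[mu]_x \int[mu]_t k1 (x, t))%E.
  have mF1 : measurable_fun setT (fun x : R => \int[mu]_y (h (x, y))%:E)%E.
    by apply: (@measurable_fun_fubini_tonelli_F _ _ _ _ R mu (fun p => (h p)%:E));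
      [exact/measurable_EFinP|by move=> p; rewrite lee_fin].
  have mF2 : measurable_fun setT (fun x : R => \int[mu]_t k1 (x, t))%E.
    exact: (@measurable_fun_fubini_tonelli_F _ _ _ _ R mu k1 mk1 k10).
  (* The line [x = 0], where [y = x t] is no substitution, is discarded as a null set. *)
  have mD : measurable ([set: R] `\ 0) by exact: measurableD.
  transitivity (\int[mu]_(x in [set: R] `\ 0%R) \int[mu]_y (h (x, y))%:E)%E.
    by apply/esym/integral_setD1 => //; exact: measurable_funTS.
  transitivity (\int[mu]_(x in [set: R] `\ 0%R) \int[mu]_t k1 (x, t))%E.
    by apply: eq_integral => x /set_mem[_ /eqP]; exact: S1.
  by apply: integral_setD1 => //; exact: measurable_funTS.
rewrite (@fubini_tonelli _ _ _ _ R mu mu k1 mk1 k10).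
have S2 t : (\int[mu]_x k1 (x, t) = \int[mu]_r k2 (r, t))%E.
  have c0 := cos_atan_gt0 t.
  have mk1t : measurable_fun setT (fun x => k1 (x, t)).
    by apply: (measurableT_comp mk1); exact: measurable_fun_pair.
  rewrite (@integral_scale R (cos (atan t)) _ (lt0r_neq0 c0) mk1t); last by move=> ?; exact: k10.
  rewrite -ge0_integralZl //; last exact: (measurableT_comp mk1t).
  apply: eq_integral => r _; rewrite /k1 /k2 /= -EFinM; congr EFin.
  rewrite sin_atanE -cos_atan_sqr normrM gtr0_norm // (mulrC (cos _) r).
  by rewrite -(mulrA r (cos _) t) (mulrC (cos _) t); ring.
under eq_integral do rewrite S2.
rewrite -(@fubini_tonelli _ _ _ _ R mu mu k2 mk2 k20).
(* Negative radii are folded onto positive ones and supply the half circle of the points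
   [- pol r t]. *)
rewrite integral_fold; last 2 first.
- exact: (@measurable_fun_fubini_tonelli_F _ _ _ _ R mu k2 mk2 k20).
- by move=> r; apply: integral_ge0.
have mk2r r : measurable_fun setT (fun t => k2 (r, t)).
  by apply: (measurableT_comp mk2); exact: measurable_fun_pair.
rewrite [RHS]integral_mkcond [LHS]integral_mkcond; apply: eq_integral => r _.
rewrite !patchE; case: ifPn; last first.
  move=> /negP rn; rewrite ifF //; apply/negP => /set_mem /=; rewrite in_itv /= => /andP[r0 _].
  by apply: rn; apply/mem_set; rewrite /= in_itv /= r0.
move=> /set_mem /=; rewrite in_itv /= andbT => r0.
rewrite -ge0_integralD //; [|exact: mk2r..].
have nr : `|r| = r by rewrite ger0_norm.
case: ifPn => [/set_mem|/negP rn]; last first.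
  have r1 : (r < 1) = false.
    by apply/negP => r1; apply: rn; apply/mem_set; rewrite /= in_itv /= r0.
  apply: integral0_eq => t _; rewrite /k2 /= !hpol normrN nr r1.
  by rewrite !mulr0 adde0.
rewrite /= in_itv /= => /andP[_ r1].
have cr : ccirc u r by move=> z zr; apply: cu; rewrite zr nr.
pose v t := r * g r * (u (pol r t) + u (- pol r t)).
have vc t : {for t, continuous v}.
  apply: cvgM; first exact: cvg_cst.
  by apply: (ctsI_circ _ u r t t cr); rewrite lexx.
have v0 t : 0 <= v t by rewrite !mulr_ge0 // ?addr_ge0 // g0 // r0.
have -> : r * g r * circ u r = rint_half v.
  by rewrite /v rintZ //; exact: ctsI_circ.
rewrite -integral_atan //; apply: eq_integral => t _.
rewrite /k2 /= !hpol normrN nr r1 -EFinD; congr EFin; rewrite /v polN.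
by ring.
Qed.

End PolarCoordinates.
Arguments disc2 {R}.

(** * The layer cake comparison *)

Section LayerCake.
Variable R : realType.
Local Notation mu := (@lebesgue_measure R).
Local Open Scope ereal_scope.

(** The density [w] on the region under the graph of [H], with [p.1] the radius and [p.2] the level.
    Its two iterated integrals are the two sides of the layer cake formula. *)
Definition layer (D : set R) (w H : R -> R) (p : R * R) : \bar R :=
  ((w \_ D) p.1 * (\1_[set p : R * R | (0 <= p.2)%R /\ (p.2 < (H \_ D) p.1)%R] p))%:E.

Section Layer.
Variables (D : set R) (w H : R -> R).
Hypotheses (mD : measurable D) (mw : measurable_fun D w) (mH : measurable_fun D H).
Hypotheses (w0 : forall r, D r -> (0 <= w r)%R) (H0 : forall r, D r -> (0 <= H r)%R).

Lemma layer_ge0 p : 0 <= layer D w H p.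
Proof.
rewrite lee_fin mulr_ge0 ?indicE //.
by rewrite patchE; case: ifPn => // /set_mem; exact: w0.
Qed.

Lemma measurable_layer : measurable_fun setT (layer D w H).
Proof.
have mwD : measurable_fun setT (w \_ D) by apply/(measurable_restrict _ mD measurableT); rewrite setTI.
have mHD : measurable_fun setT (H \_ D) by apply/(measurable_restrict _ mD measurableT); rewrite setTI.
apply/measurable_EFinP; apply: measurable_funM; first exact: (measurableT_comp mwD).
apply: measurable_indic.
pose f1 (p : R * R) := (0 <= p.2)%R.
pose f2 (p : R * R) := (p.2 < (H \_ D) p.1)%R.
rewrite [X in measurable X](_ : _ = f1 @^-1` [set true] `&` f2 @^-1` [set true]); last first.
  by apply/seteqP; split => p.
apply: measurableI.
- have : measurable_fun setT f1 by exact: measurable_fun_ler.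
  by move=> /(_ measurableT [set true]); rewrite setTI; exact.
- have : measurable_fun setT f2.
    by apply: measurable_fun_ltr => //; exact: (measurableT_comp mHD).
  by move=> /(_ measurableT [set true]); rewrite setTI; exact.
Qed.

Lemma layer_int1 : \int[mu]_r \int[mu]_t layer D w H (r, t) = \int[mu]_(r in D) (w r * H r)%:E.
Proof.
rewrite [RHS]integral_mkcond; apply: eq_integral => r _.
rewrite patchE /layer /=; case: ifPn => [/set_mem Dr|Dr]; last first.
  by apply: integral0_eq => t _; rewrite patchE (negbTE Dr) mul0r.
pose J : R -> R := \1_(`[0%R, (H r)%R[%classic).
transitivity (\int[mu]_t ((w r)%:E * (EFin \o J) t)).
  apply: eq_integral => t _; rewrite !patchE (mem_set Dr) EFinM; congr (_ * _%:E).
  rewrite /J !indicE; congr (nat_of_bool _)%:R.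
  apply/idP/idP => /set_mem h; apply/mem_set; move: h; rewrite /= in_itv /= patchE (mem_set Dr).
    by case=> -> ->.
  by move/andP.
have n1 t : [set: R] t -> 0 <= (EFin \o J) t by rewrite /= lee_fin /J indicE.
have n2 : measurable_fun setT (EFin \o J) by apply/measurable_EFinP; exact: measurable_indic.
rewrite (ge0_integralZl mu measurableT n2 n1) ?lee_fin ?w0 //.
rewrite EFinM; congr (_ * _).
rewrite integral_indic // setIT [LHS](lebesgue_measure_itv `[0%R, (H r)%R[) /= lte_fin.
have [h|h] := ltP 0%R (H r); first by rewrite oppr0 adde0.
by congr EFin; apply/eqP; rewrite eq_le h andbT H0.
Qed.

Lemma layer_int2 t : (0 <= t)%R ->
  \int[mu]_r layer D w H (r, t) = \int[mu]_(r in D `&` [set r | t < H r]%R) (w r)%:E.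
Proof.
move=> t0; rewrite [RHS]integral_mkcond; apply: eq_integral => r _.
rewrite /layer /= !patchE indicE; case: ifPn => [/set_mem Dr|Dr]; last first.
  by rewrite mul0r ifF //; apply/negP => /set_mem[/mem_set]; rewrite (negbTE Dr).
case: ifPn => [/set_mem[_ /= h]|h].
  by rewrite mem_set ?mulr1 //=; split => //; rewrite patchE mem_set.
rewrite memNset ?mulr0 //= patchE mem_set // => -[_ h'].
by move/negP : h; apply; apply/mem_set.
Qed.

Lemma layer_int2_neg t : (t < 0)%R -> \int[mu]_r layer D w H (r, t) = 0.
Proof.
move=> t0; apply: integral0_eq => r _; rewrite /layer /= indicE memNset ?mulr0 //=.
by move=> [/le_lt_trans/(_ t0)]; rewrite ltxx.
Qed.

End Layer.

(** By Tonelli both integrals are integrals over the level [t] of the [w]-mass of a superlevel set,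
    and negative levels contribute nothing. *)
Lemma layer_comparison (D1 D2 : set R) (w H1 H2 : R -> R) (k : R) :
  measurable D1 -> measurable D2 -> measurable_fun D1 w -> measurable_fun D2 w ->
  measurable_fun D1 H1 -> measurable_fun D2 H2 ->
  (forall r, D1 r -> (0 <= w r)%R) -> (forall r, D2 r -> (0 <= w r)%R) ->
  (forall r, D1 r -> (0 <= H1 r)%R) -> (forall r, D2 r -> (0 <= H2 r)%R) -> (0 <= k)%R ->
  (forall t, (0 <= t)%R ->
    \int[mu]_(r in D1 `&` [set r | t < H1 r]%R) (w r)%:E <=
    k%:E * \int[mu]_(r in D2 `&` [set r | t < H2 r]%R) (w r)%:E) ->
  \int[mu]_(r in D1) (w r * H1 r)%:E <= k%:E * \int[mu]_(r in D2) (w r * H2 r)%:E.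
Proof.
move=> mD1 mD2 mw1 mw2 mH1 mH2 w1 w2 H10 H20 k0 h.
have m1 := measurable_layer _ _ _ mD1 mw1 mH1.
have m2 := measurable_layer _ _ _ mD2 mw2 mH2.
have p1 := layer_ge0 D1 w H1 w1.
have p2 := layer_ge0 D2 w H2 w2.
rewrite -(layer_int1 _ _ _ w1 H10) -(layer_int1 _ _ _ w2 H20).
rewrite (@fubini_tonelli _ _ _ _ R mu mu _ m1 p1) (@fubini_tonelli _ _ _ _ R mu mu _ m2 p2).
have g1 := @measurable_fun_fubini_tonelli_G _ _ _ _ R mu _ m1 p1.
have g2 := @measurable_fun_fubini_tonelli_G _ _ _ _ R mu _ m2 p2.
have n1 t : [set: R] t -> 0 <= \int[mu]_r layer D1 w H1 (r, t).
  by move=> _; apply: integral_ge0 => r _; exact: p1.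
have n2 t : [set: R] t -> 0 <= \int[mu]_r layer D2 w H2 (r, t).
  by move=> _; apply: integral_ge0 => r _; exact: p2.
have k0' : 0 <= k%:E by rewrite lee_fin.
rewrite -(ge0_integralZl mu measurableT g2 n2 k0').
have g3 : measurable_fun setT (fun t => k%:E * \int[mu]_r layer D2 w H2 (r, t)).
  by apply: emeasurable_funM => //; exact: measurable_cst.
apply: (@ge0_le_integral _ _ R mu setT measurableT _ _ n1 g1 g3).
move=> t _; have [t0|t0] := leP 0%R t; first by rewrite !layer_int2 //; exact: h.
by rewrite !layer_int2_neg // mule0.
Qed.

End LayerCake.

(** * The weight: tails, monotonicity and doubling of [Grad] *)

Definition weight_growth {R : realType} (sigma : R -> R) (delta : R) :=
  forall r s : R, I01 r -> I01 s -> r <= s ->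
    omega_of sigma r * (1 - r) `^ (- (1 + delta)) <=
    omega_of sigma s * (1 - s) `^ (- (1 + delta)).

Section Weights.
Variables (R : realType) (sigma : R -> R).
Local Notation mu := (@lebesgue_measure R).
Hypotheses (sc : {within `[0, 1[, continuous sigma})
  (s0 : forall r : R, 0 <= r < 1 -> 0 < sigma r)
  (si : mu.-integrable `[0, 1[ (EFin \o sigma)).

Implicit Types (c r s t e : R).

(** Formally minus the derivative of [omega_of sigma], which is an iterated integral of [sigma]. *)
Definition tail (s : R) : R := \int[mu]_(t in `[s, 1[) sigma t.
(* The function G of the theorem, in terms of r = |z|; it is comparable to [tail]. *)
Definition Grad (r : R) : R := omega_of sigma r / (1 - r).

Lemma mule_integral (D : set R) (f : R -> \bar R) (k : R) : measurable D ->
  measurable_fun D f -> (forall x, D x -> (0 <= f x)%E) -> 0 <= k ->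
  (k%:E * \int[mu]_(x in D) f x = \int[mu]_(x in D) (k%:E * f x))%E.
Proof. by move=> mD mf f0 k0; rewrite ge0_integralZl // lee_fin. Qed.

Lemma sub_I01 (s : R) : 0 <= s -> `[s, 1[%classic `<=` (`[0, 1[%classic : set R).
Proof. by move=> h x /=; rewrite !in_itv /= => /andP[sx ->]; rewrite (le_trans h). Qed.

Lemma sigma_measurable : measurable_fun (@I01 R) sigma.
Proof. by apply: subspace_continuous_measurable_fun => //; rewrite /I01; exact: measurable_itv. Qed.

Lemma tail_integrable s : 0 <= s -> mu.-integrable `[s, 1[ (EFin \o sigma).
Proof. by move=> s00; apply: integrableS si => //; exact: sub_I01. Qed.

Lemma moment_integrable c s : 0 <= s -> 0 <= c <= s ->
  mu.-integrable `[s, 1[ (EFin \o (fun t => (t - c) * sigma t)).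
Proof.
move=> s00 /andP[c0 cs]; have i := tail_integrable s s00.
apply: le_integrable i => //.
  apply/measurable_EFinP; apply: measurable_funM.
    by apply: measurable_funB.
  by have /measurable_int/measurable_EFinP := tail_integrable s s00.
move=> t /=; rewrite in_itv /= => /andP[st t1].
rewrite lee_fin normrM ler_piMl // ger0_norm; lra.
Qed.

Lemma tailE s : 0 <= s -> (tail s)%:E = (\int[mu]_(t in `[s, 1%R[) (sigma t)%:E)%E.
Proof.
by move=> s00; rewrite /tail /Rintegral fineK //; apply: integrable_fin_num => //; exact: tail_integrable.
Qed.

Lemma omegaE s : 0 <= s ->
  (omega_of sigma s)%:E = (\int[mu]_(t in `[s, 1%R[) ((t - s) * sigma t)%:E)%E.
Proof.
move=> s00; rewrite /omega_of fineK //; apply: integrable_fin_num => //.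
by apply: (moment_integrable s s); rewrite ?s00 ?lexx.
Qed.

Lemma sigma_ge0 s t : 0 <= s -> `[s, 1[%classic t -> 0 <= sigma t.
Proof. by move=> s00 /sub_I01-/(_ s00); rewrite /= in_itv /= => /s0/ltW. Qed.

Lemma moment_measurable c s : 0 <= s ->
  measurable_fun `[s, 1[ (fun t => ((t - c) * sigma t)%:E).
Proof.
move=> s00; apply/measurable_EFinP; apply: measurable_funM; first by apply: measurable_funB.
by have /measurable_int/measurable_EFinP := tail_integrable s s00.
Qed.

Lemma moment_ge0 c s t : 0 <= s -> c <= s -> `[s, 1[%classic t -> (0 <= ((t - c) * sigma t)%:E)%E.
Proof.
move=> s00 cs tI; rewrite lee_fin mulr_ge0 ?(sigma_ge0 s) //.
by move: tI; rewrite /= in_itv /= => /andP[? _]; lra.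
Qed.

Lemma omega_le_tail s : 0 <= s < 1 -> omega_of sigma s <= (1 - s) * tail s.
Proof.
move=> /andP[s00 s1]; rewrite -lee_fin omegaE // EFinM tailE //.
have /measurable_int ms := tail_integrable s s00.
have g0 t : `[s, 1[%classic t -> (0 <= (sigma t)%:E)%E by move/(sigma_ge0 _ _ s00); rewrite lee_fin.
rewrite (mule_integral _ _ _ _ ms g0) //; last by lra.
have h1 t := moment_ge0 s s t s00 (lexx s).
apply: (@ge0_le_integral _ _ R mu _ _ _ _ h1 (moment_measurable s s s00)) => //.
  by apply: emeasurable_funM.
move=> t tI; rewrite lee_fin ler_wpM2r ?(sigma_ge0 s) //.
by move: tI; rewrite /= in_itv /= => /andP[? ?]; lra.
Qed.

Lemma tail_le_omega r s : 0 <= r -> r <= s -> s < 1 -> (s - r) * tail s <= omega_of sigma r.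
Proof.
move=> r0 rs s1; have s00 : 0 <= s by exact: le_trans rs.
rewrite -lee_fin omegaE // EFinM tailE //.
have /measurable_int ms := tail_integrable s s00.
have g0 t : `[s, 1[%classic t -> (0 <= (sigma t)%:E)%E by move/(sigma_ge0 _ _ s00); rewrite lee_fin.
rewrite (mule_integral _ _ _ _ ms g0) //; last by lra.
have sub : `[s, 1[%classic `<=` (`[r, 1[%classic : set R).
  by move=> x /=; rewrite !in_itv /= => /andP[sx ->]; rewrite (le_trans rs).
have h1 t := moment_ge0 r r t r0 (lexx r).
apply: (@le_trans _ _ (\int[mu]_(t in `[s, 1%R[) ((t - r) * sigma t)%:E)%E); last first.
  by apply: ge0_subset_integral => //; exact: moment_measurable.
apply: ge0_le_integral => //.
- by move=> t tI; rewrite mule_ge0 // lee_fin ?subr_ge0 ?(sigma_ge0 s).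
- by apply: emeasurable_funM.
- exact: moment_measurable.
- move=> t tI; rewrite -EFinM lee_fin ler_wpM2r ?(sigma_ge0 s) //.
  by move: tI; rewrite /= in_itv /= => /andP[? ?]; lra.
Qed.

(** Monotonicity of [Grad] after cross-multiplication. It holds under the integral over [[s, 1[],
    where the two sides differ by [(s - r) * (1 - t) * sigma t]. *)
Lemma omega_cross r s : 0 <= r -> r <= s -> s < 1 ->
  omega_of sigma s * (1 - r) <= omega_of sigma r * (1 - s).
Proof.
move=> r0 rs s1; have s00 : 0 <= s by exact: le_trans rs.
rewrite mulrC (mulrC _ (1 - s)) -lee_fin !EFinM !omegaE //.
have sub : `[s, 1[%classic `<=` (`[r, 1[%classic : set R).
  by move=> x /=; rewrite !in_itv /= => /andP[sx ->]; rewrite (le_trans rs).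
rewrite (mule_integral _ _ _ _ (moment_measurable s s s00) (fun t => moment_ge0 s s t s00 (lexx s))) //; last by lra.
rewrite (mule_integral _ _ _ _ (moment_measurable r r r0) (fun t => moment_ge0 r r t r0 (lexx r))) //; last by lra.
apply: (@le_trans _ _ (\int[mu]_(t in `[s, 1%R[) ((1 - s)%:E * ((t - r) * sigma t)%:E))%E); last first.
  apply: ge0_subset_integral => //.
    by apply: emeasurable_funM => //; exact: moment_measurable.
  by move=> t tI; apply: mule_ge0; [rewrite lee_fin; lra|exact: (moment_ge0 r r t r0 (lexx r) tI)].
apply: ge0_le_integral => //.
- by move=> t tI; apply: mule_ge0; [rewrite lee_fin; lra|exact: (moment_ge0 s s t s00 (lexx s) tI)].
- by apply: emeasurable_funM => //; exact: moment_measurable.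
- by apply: emeasurable_funM => //; exact: moment_measurable.
move=> t tI; rewrite -!EFinM lee_fin !mulrA ler_wpM2r ?(sigma_ge0 s) //.
move: tI; rewrite /= in_itv /= => /andP[st t1].
have : 0 <= (s - r) * (1 - t) by rewrite mulr_ge0; lra.
lra.
Qed.

Lemma Grad_noninc r s : 0 <= r -> r <= s -> s < 1 -> Grad s <= Grad r.
Proof.
move=> r0 rs s1; rewrite /Grad ler_pdivrMr ?subr_gt0 // mulrAC ler_pdivlMr; last by lra.
exact: omega_cross.
Qed.

Lemma Grad_le_tail s : 0 <= s < 1 -> Grad s <= tail s.
Proof.
move=> h; rewrite /Grad ler_pdivrMr; last by lra.
by rewrite mulrC; exact: omega_le_tail.
Qed.

Lemma tail_noninc r s : 0 <= r -> r <= s -> tail s <= tail r.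
Proof.
move=> r0 rs; have s00 : 0 <= s by exact: le_trans rs.
rewrite -lee_fin !tailE //; apply: ge0_subset_integral => //.
- by have /measurable_int := tail_integrable r r0.
- by move=> t /(sigma_ge0 _ _ r0); rewrite lee_fin.
- by move=> x /=; rewrite !in_itv /= => /andP[sx ->]; rewrite (le_trans rs).
Qed.

Lemma tail_small e : 0 < e -> exists2 s, 0 <= s < 1 & tail s < e.
Proof.
move=> e0; pose F (n : nat) : set R := `[0, 1 - n.+1%:R^-1[%classic.
have n1 (n : nat) : 0 < (n.+1%:R : R)^-1 <= 1.
  by rewrite invr_gt0 ltr0n /= invf_le1 ?ltr0n // ler1n.
have E : \bigcup_n F n = `[0, 1[%classic.
  apply/seteqP; split => x.
    move=> [n _]; rewrite /F /= !in_itv /= => /andP[-> h] /=.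
    by move: (n.+1%:R^-1) h (n1 n) => a ? /andP[? ?]; lra.
  rewrite /= in_itv /= => /andP[x0 x1].
  have := archi_boundP (ltW (_ : 0 < (1 - x)^-1)); rewrite invr_gt0 subr_gt0 => /(_ x1).
  set n := Num.bound _ => hn; exists n => //; rewrite /F /= in_itv /= x0 /=.
  have : n.+1%:R^-1 < 1 - x.
    rewrite invf_plt ?posrE ?subr_gt0 ?ltr0n // (lt_trans hn) // ltr_nat //.
  by move: (n.+1%:R^-1) => a; lra.
have mF n : measurable (F n) by rewrite /F; exact: measurable_itv.
have subF n : F n `<=` `[0, 1[%classic by rewrite -E; exact: bigcup_sup.
have /measurable_int ms := si.
have L : (\int[mu]_(x in F i) (sigma x)%:E @[i --> \oo] --> \int[mu]_(x in `[0%R, 1%R[) (sigma x)%:E)%E.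
  rewrite -E; apply: ge0_nondecreasing_set_cvg_integral => //.
  - move=> n m nm; apply/subsetPset => x; rewrite /F /= !in_itv /= => /andP[-> h] /=.
    apply: lt_le_trans h _; rewrite lerD2l lerN2 lef_pV2 ?posrE ?ltr0n // ler_nat //.
  - by move=> n; exact: measurable_funS ms.
  - by move=> n x /subF; rewrite /= in_itv /= => /s0/ltW; rewrite lee_fin.
rewrite -tailE // in L.
have fn n : (\int[mu]_(x in F n) (sigma x)%:E)%E \is a fin_num.
  apply: integrable_fin_num; first exact: mF.
  by apply: integrableS si => //; exact: mF.
have /fine_cvgP[_ /cvgrPdist_lt/(_ e e0)[N _ /(_ N (leqnn N))]] := L => /= h.
have [a [N0 N1] FN] : exists2 a : R, 0 < a /\ a <= 1 & F N = `[0, 1 - a[%classic.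
  by exists (N.+1%:R^-1) => //; exact/andP/n1.
exists (1 - a); first by itv_lra.
have a0 : 0 <= 1 - a by lra.
have S : (tail 0)%:E = (\int[mu]_(x in F N) (sigma x)%:E + (tail (1 - a))%:E)%E.
  rewrite !tailE // -ge0_integral_setU //.
  - congr (integral _ _ _); rewrite FN; apply/seteqP; split => x /=; rewrite !in_itv /=.
      by move=> /andP[-> ->]; case: (ltP x (1 - a)) => _; [left|right].
    by case => /andP[h1 h2]; itv_lra.
  - exact: mF.
  - by apply: measurable_funS ms => // x [|]; [exact: subF|exact: sub_I01].
  - by move=> x [/subF|/sub_I01-/(_ a0)]; rewrite /= in_itv /= => /s0/ltW; rewrite lee_fin.
  - apply/disj_set2P; rewrite -subset0 => x []; rewrite FN /= !in_itv /=.
    by move=> /andP[_ h1] /andP[h2 _]; lra.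
move: S; rewrite -(fineK (fn N)) -EFinD => -[S].
move: h; rewrite {1}S addrC addKr => h.
by rewrite (le_lt_trans (ler_norm _)).
Qed.

Section W2.
Variable delta : R.
Hypotheses (d0 : 0 < delta) (w0 : forall r, I01 r -> 0 < omega_of sigma r)
 (W2 : weight_growth sigma delta).

(** The factor that (W2) costs when the distance to 1 is halved. *)
Definition Cdbl : R := 2 `^ (1 + delta).

Lemma Cdbl_ge1 : 1 <= Cdbl.
Proof.
rewrite -[leLHS](powRr0 2); apply: ler_powR; first by rewrite ler1n.
by rewrite addr_ge0 // ltW.
Qed.

Lemma omega_doubling r : 0 <= r < 1 -> omega_of sigma r <= Cdbl * omega_of sigma ((1 + r) / 2).
Proof.
move=> /andP[r0 r1]; set s := (1 + r) / 2.
have rI : I01 r by rewrite /I01 /= in_itv /= r0.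
have sI : I01 s by rewrite /I01 /= in_itv /= /s; itv_lra.
have rs : r <= s by rewrite /s; lra.
have E : 1 - r = 2 * (1 - s) by rewrite /s; field.
have s1 : 0 < 1 - s by rewrite /s; lra.
have := W2 r s rI sI rs; rewrite E powRM ?(ltW s1) //.
rewrite mulrA ler_pM2r ?powR_gt0 // powRN => h.
rewrite -ler_pdivrMl ?powR_gt0 //; last by rewrite mulrC.
Qed.

Lemma Grad_gt0 r : 0 <= r < 1 -> 0 < Grad r.
Proof. by move=> h; rewrite /Grad divr_gt0 ?w0 //; lra. Qed.

Lemma Grad_doubling r : 0 <= r < 1 -> Grad r <= Cdbl * Grad ((1 + r) / 2).
Proof.
move=> h; have /andP[r0 r1] := h; have W := omega_doubling r h.
have C1 := Cdbl_ge1.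
have ws : 0 < omega_of sigma ((1 + r) / 2).
  by apply: w0; rewrite /I01 /= in_itv /=; itv_lra.
rewrite /Grad ler_pdivrMr ?subr_gt0 // (le_trans W) //.
rewrite -!mulrA ler_wpM2l //; first by lra.
rewrite ler_peMr ?ltW //.
have -> : 1 - (1 + r) / 2 = (1 - r) / 2 by field.
have r2 : 1 - r != 0 by rewrite gt_eqF // subr_gt0.
by rewrite invf_div divfK // ltr1n.
Qed.

(** The point [2 * s - 1] is twice as far from 1 as [s]: [omega_of sigma] there dominates
    [(1 - s) * tail s], and doubling brings it back to [s]. The bound [2^-1 <= s] keeps that point
    in [[0, 1[]. *)
Lemma tail_le_Grad s : 2^-1 <= s < 1 -> tail s <= Cdbl * Grad s.
Proof.
move=> /andP[hs s1]; have h : 0 <= 2 * s - 1 < 1 by itv_lra.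
have W := omega_doubling _ h; have := tail_le_omega (2 * s - 1) s.
have -> : s - (2 * s - 1) = 1 - s by ring.
rewrite (_ : (1 + (2 * s - 1)) / 2 = s) in W; last by field.
move=> /(_ _ _ s1) T; rewrite /Grad mulrA ler_pdivlMr ?subr_gt0 // mulrC.
by apply: le_trans W; apply: T; lra.
Qed.

Lemma tail_gt0 s : 0 <= s < 1 -> 0 < tail s.
Proof. by move=> h; exact: lt_le_trans (Grad_gt0 s h) (Grad_le_tail s h). Qed.

(* A set on which Grad stays below K lies beyond a radius whose tail is of order K. *)
Lemma weight_sublevel (E : set R) K : measurable E -> E `<=` `[2^-1, 1[%classic ->
  (forall r, E r -> Grad r <= K) -> 0 <= K ->
  (\int[mu]_(r in E) (r * sigma r)%:E <= (Cdbl ^+ 2 * K)%:E)%E.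
Proof.
move=> mE sE hE K0; have C1 := Cdbl_ge1.
have CK : 0 <= Cdbl ^+ 2 * K by rewrite mulr_ge0 ?sqr_ge0.
have [->|/set0P[r1 Er1]] := eqVneq E set0; first by rewrite integral_set0 lee_fin.
have lb r : E r -> 2^-1 <= r < 1 by move/sE; rewrite /= in_itv.
set rs := inf E.
have hinf : has_inf E by split; [exists r1|exists 2^-1 => r /lb/andP[]].
have rsE r : E r -> rs <= r by move=> Er; apply: ge_inf => //; case: hinf.
have rs2 : 2^-1 <= rs by apply: lb_le_inf => [|r /lb/andP[]]; first by exists r1.
have rs1 : rs < 1 by have /andP[_ h] := lb _ Er1; exact: le_lt_trans (rsE _ Er1) h.
(* The infimum may lie outside [E]. Half its distance to 1 as tolerance puts [r2] below
   [(1 + rs) / 2], so one doubling step links [Grad rs] to a radius of [E]. *)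
have e0 : 0 < (1 - rs) / 2 by lra.
have [r2 Er2 hr2] := inf_adherent e0 hinf.
have /andP[r20 r21] := lb _ Er2.
have rs0 : 0 <= rs by lra.
have T : tail rs <= Cdbl ^+ 2 * K.
  have h1 : tail rs <= Cdbl * Grad rs by apply: tail_le_Grad; rewrite rs2.
  have h2 : Grad rs <= Cdbl * Grad ((1 + rs) / 2) by apply: Grad_doubling; rewrite rs0.
  have h3 : Grad ((1 + rs) / 2) <= Grad r2.
    by apply: Grad_noninc; [lra|rewrite -/rs in hr2; lra|lra].
  have h4 := hE _ Er2.
  apply: le_trans h1 _; rewrite expr2 -mulrA ler_wpM2l //; first by lra.
  apply: le_trans h2 _; rewrite ler_wpM2l //; first by lra.
  exact: le_trans h3 h4.
apply: (@le_trans _ _ (tail rs)%:E); last by rewrite lee_fin.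
have sub : E `<=` `[rs, 1[%classic.
  by move=> r Er /=; rewrite in_itv /= rsE //; have /andP[] := lb _ Er.
have /measurable_int ms := tail_integrable rs rs0.
have msE : measurable_fun E sigma.
  by apply/measurable_EFinP; apply: measurable_funS ms.
rewrite tailE //; apply: (@le_trans _ _ (\int[mu]_(r in E) (sigma r)%:E)%E); last first.
  by apply: ge0_subset_integral => // t /(sigma_ge0 _ _ rs0); rewrite lee_fin.
have sg r : E r -> 0 <= sigma r by move/sub/(sigma_ge0 _ _ rs0).
apply: ge0_le_integral => //.
- by move=> r Er; rewrite lee_fin mulr_ge0 ?sg //; have /andP[] := lb _ Er; lra.
- by apply/measurable_EFinP; apply: measurable_funM.
- exact/measurable_EFinP.
by move=> r Er; rewrite lee_fin ler_piMl ?sg //; have /andP[] := lb _ Er; lra.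
Qed.

End W2.
End Weights.

(** * Maximum principle for self-maps of the disc *)

Section SelfMapBound.
Variable R : realType.
Implicit Types (z w : R[i]) (phi : R[i] -> R[i]).

(** On each half of a larger circle [|phi|^2] attains a maximum, which is below 1; [poisson_ineq]
    carries the bound inside because the kernel has mean 1. *)
Lemma selfmap_bound phi r : hol_disc phi ->
  (forall z, cabs z < 1 -> cabs (phi z) < 1) -> r < 1 ->
  exists2 m : R, 0 <= m < 1 & forall z, cabs z <= r -> cabs (phi z) <= m.
Proof.
move=> hp p1 r1; pose rho := (1 + Num.max r 0) / 2.
have r0 : 0 <= Num.max r 0 by rewrite le_max lexx orbT.
have rm1 : Num.max r 0 < 1 by rewrite gt_max r1 ltr01.
have rr : r <= Num.max r 0 by rewrite le_max lexx.
have rho01 : 0 < rho < 1 by apply/andP; split; rewrite /rho; lra.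
have /andP[rho0 rho1] := rho01.
have pih : - (pi / 2) <= pi / 2 :> R by have := pihalf_gt0 R; lra.
pose v z := cabs (phi z) ^+ 2.
have vc z : cabs z < 1 -> rcont_at v z.
  by move=> z1; apply: sqr_rcont; exact: hp.
have cp z : cabs z = `|rho| -> cabs z < 1 by move=> ->; rewrite gtr0_norm.
have EV (a : R) : `|a| = rho -> exists2 m : R, m < 1 & forall t, - (pi / 2) <= t <= pi / 2 -> v (pol a t) <= m.
  move=> ar; have [|c _ hc] := @EVT_max R (fun t => v (pol a t)) _ _ pih.
    apply: ctsI_within => t _.
    apply: (@cont2_y _ (fun r t => v (pol r t)) a t); apply: cont_comp_pol; apply: vc.
    by rewrite cabs_pol ar.
  exists (v (pol a c)); last by move=> t tI; apply: hc; rewrite in_itv.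
  have := p1 (pol a c); rewrite cabs_pol ar => /(_ rho1) h.
  by rewrite /v expr_lt1 ?cabs_ge0.
have [m1 m11 h1] := EV rho (gtr0_norm rho0).
have [m2 m21 h2] := EV (- rho) (etrans (normrN rho) (gtr0_norm rho0)).
pose M := Num.max 0 (Num.max m1 m2).
have M0 : 0 <= M by rewrite le_max lexx.
have M1 : M < 1 by rewrite !gt_max ltr01 m11.
have m1M : m1 <= M by rewrite !le_max lexx !orbT.
have m2M : m2 <= M by rewrite !le_max lexx !orbT.
exists (Num.sqrt M); first by rewrite sqrtr_ge0 -[ltRHS]sqrtr1 ltr_sqrt.
move=> w wr; have wrho : cabs w < rho by rewrite /rho; lra.
have tp0 : 0 < 2 * pi :> R by rewrite mulr_gt0 // pi_gt0.
have cP := ccirc_poisson _ _ w rho0 wrho.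
have cu : ccirc (fun z => poisson rho w z * v z) rho.
  by move=> z zr; apply: rcontM; [exact: cP|exact: vc (cp z zr)].
have cM : ccirc (fun z => M * poisson rho w z) rho.
  by move=> z zr; apply: rcontZ; exact: cP.
have K : 2 * pi * v w <= 2 * pi * M.
  apply: le_trans (poisson_ineq _ phi rho w hp rho01 wrho) _.
  have -> : 2 * pi * M = circ (fun z => M * poisson rho w z) rho.
    by rewrite (circZ _ _ (poisson rho w) _ cP) circ_poisson // mulrC.
  apply: le_rint; [exact: ctsI_circ cu|exact: ctsI_circ cM|] => t tI.
  have pp z : cabs z = `|rho| -> 0 <= poisson rho w z.
    by move=> _; apply: poisson_ge0; exact: ltW.
  apply: lerD; rewrite mulrC; apply: ler_wpM2r.
  - by apply: pp; rewrite cabs_pol.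
  - exact: le_trans (h1 t tI) m1M.
  - by apply: pp; rewrite cabsN cabs_pol.
  - by rewrite polN; exact: le_trans (h2 t tI) m2M.
have {}K : v w <= M by rewrite -(ler_pM2l tp0).
by rewrite -[leLHS]ger0_norm ?cabs_ge0 // -sqrtr_sqr ler_wsqrtr.
Qed.

End SelfMapBound.

(** * Comparison of level sets and the main estimate *)

Section MainEstimate.
Variables (R : realType) (sigma : R -> R) (delta : R).
Local Notation mu := (@lebesgue_measure R).
Hypotheses (sc : {within `[0, 1[, continuous sigma})
  (s0 : forall r : R, 0 <= r < 1 -> 0 < sigma r)
  (si : mu.-integrable `[0, 1[ (EFin \o sigma))
  (d0 : 0 < delta) (w0 : forall r, I01 r -> 0 < omega_of sigma r)
  (W2 : weight_growth sigma delta).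
Local Notation C := (Cdbl R delta).
Local Notation G := (Grad R sigma).
Local Notation T := (tail R sigma).
Implicit Types (r s t e : R).

Lemma tail_open s : 0 <= s -> (T s)%:E = (\int[mu]_(t in `]s, 1%R[) (sigma t)%:E)%E.
Proof.
move=> s00; rewrite tailE //; apply/esym/integral_itv_obnd_cbnd.
have /measurable_int h := tail_integrable R sigma si s s00.
by apply: measurable_funS h => //; apply: subset_itvr; rewrite bnd_simp.
Qed.

(* Applied with N and H the circle means of |f|^2 and |f o phi|^2, and P r rho
   saying that phi maps the disc of radius (1 + r) / 2 into that of radius rho:
   when P r rho holds, subordination bounds H r by N rho; when it fails, the
   hypothesis on phi makes G small against G rho. *)
Lemma level_comparison (H N : R -> R) (P : R -> R -> Prop) (C0 rho0 e1 r1 : R) :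
  2^-1 <= rho0 < 1 -> 0 < C0 -> 0 < e1 ->
  (forall s s', 0 <= s -> s <= s' -> s' < 1 -> N s <= N s') ->
  (forall rho r, rho0 <= rho < 1 -> 0 <= r < 1 -> P r rho -> H r <= C0 * N rho) ->
  (forall r, 0 <= r < 1 -> exists2 rho, rho0 <= rho < 1 & P r rho) ->
  (forall rho r, rho0 <= rho < 1 -> 0 <= r < 1 -> ~ P r rho -> G ((1 + r) / 2) <= e1 * G rho) ->
  2^-1 <= r1 < 1 -> T r1 <= e1 * T ((1 + rho0) / 2) ->
  measurable_fun `]r1, 1[ H -> measurable_fun (@I01 R) (fun r => C0 * N r) ->
  forall t, 0 <= t ->
  (\int[mu]_(r in `]r1, 1%R[ `&` [set r | (t < H r)%R]) (r * sigma r)%:E <=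
   (2 * C ^+ 4 * e1)%:E * \int[mu]_(r in `[0%R, 1%R[ `&` [set r | (t < C0 * N r)%R]) (r * sigma r)%:E)%E.
Proof.
move=> /andP[rho02 rho01] C00 e10 hN hH hP hG /andP[r12 r11] hr1 mH mN t t0.
have C1 : 1 <= C := Cdbl_ge1 R delta d0.
set E : set R := `]r1, 1%R[ `&` [set r | t < H r].
set F : set R := `[0, 1[ `&` [set r | t < C0 * N r].
have mE : measurable E.
  by have := mH (measurable_itv _) `]t, +oo[%classic (measurable_itv _);
    congr measurable; apply/seteqP; split => r [] /=; rewrite !in_itv /= andbT.
have mF : measurable F.
  have := mN (measurable_itv _) `]t, +oo[%classic (measurable_itv _).
  by congr measurable; apply/seteqP; split => r [] /=; rewrite !in_itv /= andbT.
have k0 : 0 <= 2 * C ^+ 4 * e1 by rewrite !mulr_ge0 ?exprn_ge0 //; lra.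
have sg0 r : 0 <= r < 1 -> 0 <= sigma r by move/s0/ltW.
have w00 r : 0 <= r < 1 -> (0 <= (r * sigma r)%:E)%E.
  by move=> h; rewrite lee_fin; apply: mulr_ge0; [lra|exact: sg0].
have [->|/set0P[r2 [Er2 Hr2]]] := eqVneq E set0.
  rewrite integral_set0; apply: mule_ge0; rewrite ?lee_fin //.
  by apply: integral_ge0 => r [] /=; rewrite in_itv /= => h _; exact: w00.
have EI r : E r -> r1 < r < 1 by case; rewrite /= in_itv.
have EI' r : E r -> 0 <= r < 1 by move/EI => /andP[? ?]; itv_lra.
pose S := [set s | 0 <= s < 1 /\ t < C0 * N s].
have E2 : E r2 by split.
have S0 : S !=set0.
  have [rho rI hp] := hP r2 (EI' _ E2).
  exists rho; split; first by lra.
  exact: lt_le_trans Hr2 (hH _ _ rI (EI' _ E2) hp).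
have lbS : lbound S 0 by move=> s [/andP[]].
have hS : has_inf S by split => //; exists 0.
(* As [N] is non-decreasing, the superlevel set of [C0 * N] is an interval starting at [st], up to
   its endpoint; [above] and [below] make this precise. *)
set st := inf S.
have st0 : 0 <= st by apply: lb_le_inf.
have stS s : S s -> st <= s by move=> Ss; apply: ge_inf => //; exists 0.
have st1 : st < 1 by have [s Ss] := S0; have := stS _ Ss; case: Ss => /andP[_ ? _]; lra.
have above s : st < s < 1 -> t < C0 * N s.
  move=> /andP[h1 h2]; have e0 : 0 < s - st by lra.
  have [s' [s'I h3] h4] := inf_adherent e0 hS.
  have /andP[s'0 s'1] := s'I; rewrite -/st in h4.
  apply: (lt_le_trans h3); rewrite ler_pM2l //; apply: hN => //.
  by move: h4; move: (st) h1 => a ? ?; lra.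
have below s : 0 <= s -> s < st -> C0 * N s <= t.
  move=> h1 h2; rewrite leNgt; apply/negP => h3.
  have sI : 0 <= s < 1 by itv_lra.
  by have := stS s (conj sI h3); lra.
pose rho1 := (1 + rho0) / 2.
(* Truncation at [rho1]: as soon as [st] exceeds it, [2 * st - 1] exceeds [rho0] and is a radius to
   which [hH] and [hG] apply. *)
pose s' := Num.max st rho1.
have s'2 : 2^-1 <= s' by rewrite le_max; apply/orP; right; rewrite /rho1; lra.
have s'1 : s' < 1 by rewrite gt_max st1 /rho1; lra.
have s't : st <= s' by rewrite le_max lexx.
have s'0 : 0 <= s' by lra.
have s'I : 0 <= s' < 1 by apply/andP.
have Ts' := tail_gt0 R sigma s0 si w0 s' s'I.
(* [F] contains the whole interval beyond [s'], and the factor [r] in the density is at least one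
   half there. *)
have LF : (((T s') / 2)%:E <= \int[mu]_(r in F) (r * sigma r)%:E)%E.
  have mss : measurable_fun `]s', 1[ sigma.
    have /measurable_int/measurable_EFinP h := tail_integrable R sigma si s' s'0.
    by apply: measurable_funS h => //; apply: subset_itvr; rewrite bnd_simp.
  have sg r : `]s', 1[%classic r -> s' < r < 1 by rewrite /= in_itv.
  rewrite mulrC EFinM tail_open // (mule_integral _ (`]s', 1[%classic)) //; last 2 first.
  - by apply/measurable_EFinP.
  - by move=> r /sg h; rewrite lee_fin; apply: sg0; lra.
  apply: (@le_trans _ _ (\int[mu]_(r in `]s', 1%R[) (r * sigma r)%:E)%E).
    apply: ge0_le_integral => //.
    - by move=> r /sg h; rewrite -EFinM lee_fin; apply: mulr_ge0; [lra|apply: sg0; lra].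
    - by apply: emeasurable_funM => //; apply/measurable_EFinP.
    - by apply/measurable_EFinP; apply: measurable_funM.
    - by move=> r /sg h; rewrite -EFinM lee_fin; apply: ler_wpM2r; [apply: sg0; lra|lra].
  apply: ge0_subset_integral => //.
  - apply/measurable_EFinP; apply: measurable_funM => //.
    have h := sigma_measurable R sigma sc.
    by apply: measurable_funS h => //; [rewrite /I01|move=> r []].
  - by move=> r [] /=; rewrite in_itv /= => h _; exact: w00.
  - move=> r /sg h; split => /=; first by rewrite in_itv /=; lra.
    by apply: above; lra.
have GE r : E r -> G r <= C ^+ 2 * e1 * T s'.
  move=> Er; have rI := EI' _ Er; have /andP[rr1 _] := EI _ Er; have [_ Hr] := Er.
  have /andP[rr0 rr2] := rI.
  (* For small [st] the smallness does not come from [phi] but from [r > r1], where the tail is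
     already below [e1 * T rho1]. *)
  have [hs|hs] := leP st rho1.
    have es' : s' = rho1 by rewrite /s' max_r.
    have g1 : G r <= T r := Grad_le_tail R sigma s0 si r rI.
    have g2 : T r <= T r1 by apply: tail_noninc => //; lra.
    rewrite es'; apply: le_trans g1 (le_trans g2 (le_trans hr1 _)).
    have eT : 0 <= e1 * T rho1 by apply: mulr_ge0; rewrite -?es' ltW.
    by rewrite -/rho1 -mulrA; apply: ler_peMl => //; exact: exprn_ege1.
  have es' : s' = st by rewrite /s' max_l // ltW.
  (* This radius lies below [st], so [C0 * N rho <= t < H r]: subordination is violated and
     [P r rho] must fail. Doubling from [rho] returns to [st], since [(1 + rho) / 2 = st]. *)
  pose rho := 2 * st - 1.
  have rhoI : rho0 <= rho < 1 by rewrite /rho; rewrite /rho1 in hs; itv_lra.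
  have nP : ~ P r rho.
    move=> hp; have := hH _ _ rhoI rI hp; have := below rho; rewrite /rho /= in Hr *.
    move=> h1 h2; have : C0 * N (2 * st - 1) <= t by apply: h1; rewrite /rho1 in hs; lra.
    by move=> h3; have := lt_le_trans Hr (le_trans h2 h3); rewrite ltxx.
  have g1 := Grad_doubling R sigma delta d0 w0 W2 r rI.
  have g2 := hG _ _ rhoI rI nP.
  have rhoI' : 0 <= rho < 1 by move/andP: rhoI => [? ?]; itv_lra.
  have g3 := Grad_doubling R sigma delta d0 w0 W2 rho rhoI'.
  rewrite (_ : (1 + rho) / 2 = st) in g3; last by rewrite /rho; field.
  have g4 : G st <= T st by apply: Grad_le_tail => //; rewrite st0.
  rewrite es'; apply: le_trans g1 _; rewrite expr2 -!mulrA ler_wpM2l //; first by lra.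
  apply: le_trans g2 _; rewrite (mulrCA C) ler_wpM2l //; first by lra.
  apply: le_trans g3 _; rewrite ler_wpM2l //; lra.
have K0 : 0 <= C ^+ 2 * e1 * T s'.
  by apply: mulr_ge0; [apply: mulr_ge0; [exact: sqr_ge0|exact: ltW]|exact: ltW].
have sE : E `<=` `[2^-1, 1[%classic.
  by move=> r /EI /andP[? ?]; rewrite /= in_itv /=; itv_lra.
(* The constant is assembled here: [C ^+ 2] from [weight_sublevel], [C ^+ 2 * e1] from [GE], and 2
   from [LF]. *)
apply: le_trans (weight_sublevel R sigma s0 si delta d0 w0 W2 E _ mE sE GE K0) _.
apply: le_trans (lee_wpmul2l _ LF); last by rewrite lee_fin.
rewrite -EFinM lee_fin le_eqVlt; apply/orP; left.
by apply/eqP; field.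
Qed.

Definition radial_norm (f : R[i] -> R[i]) : \bar R :=
  (\int[mu]_(r in `[0%R, 1%R[) (r * sigma r * circ (fun z => (cabs (f z) ^+ 2)%R) r)%:E)%E.

Definition radial_norm_beyond (r1 : R) (f : R[i] -> R[i]) : \bar R :=
  (\int[mu]_(r in `]r1, 1%R[) (r * sigma r * circ (fun z => (cabs (f z) ^+ 2)%R) r)%:E)%E.

Lemma circ_measurable (f : R[i] -> R[i]) : hol_disc f ->
  measurable_fun (@I01 R) (circ_sqr f).
Proof.
move=> hf; have h : measurable_fun (`](-1 : R), 1[%classic : set R) (circ_sqr f).
  apply: open_continuous_measurable_fun; first exact: interval_open.
  move=> r /set_mem; rewrite /= in_itv /= -ltr_norml => r1.
  by apply: (@circ_continuous _ _ r 1 _ r1) => z z1; apply: sqr_rcont; exact: hf.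
apply: measurable_funS h => //.
by move=> r; rewrite /I01 /= !in_itv /= => /andP[? ->]; rewrite andbT; lra.
Qed.

Lemma circ_sqr_ge0 (f : R[i] -> R[i]) r : 0 <= circ_sqr f r.
Proof. by apply: circ_ge0 => z _; rewrite sqr_ge0. Qed.

(** The radius [r1] is fixed before [f] appears; this uniformity is what turns into compactness. *)
Lemma main_estimate (phi : R[i] -> R[i]) :
  hol_disc phi -> (forall z, cabs z < 1 -> cabs (phi z) < 1) ->
  (forall e, 0 < e -> exists2 r0, r0 < 1 & forall z, cabs z < 1 -> r0 < cabs z ->
     G (cabs z) < e * G (cabs (phi z))) ->
  forall e, 0 < e -> exists2 r1, 0 <= r1 < 1 & forall f, hol_disc f ->
    (radial_norm_beyond r1 (fun z => f (phi z)) <= e%:E * radial_norm f)%E.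
Proof.
move=> hp p1 cond e e0.
have C1 : 1 <= C := Cdbl_ge1 R delta d0.
pose a := cabs (phi 0).
have a1 : a < 1 by apply: p1; rewrite cabs0.
have a0 : 0 <= a := cabs_ge0 _ _.
(* Bounds the subordination constant for every [rho >= (1 + a) / 2], where [rho - a >= (1 - a) / 2]
   and [rho + a <= 1 + a]. *)
pose C0 := 2 * (1 + a) / (1 - a).
have C00 : 0 < C0 by rewrite divr_gt0 ?mulr_gt0 //; lra.
have CC0 : 0 < 2 * C ^+ 4 * C0.
  by apply: mulr_gt0 => //; apply: mulr_gt0 => //; apply: exprn_gt0; lra.
(* The layers of [C0 * N] will be compared, so [C0] leaves the integral at the end and has to be
   compensated along with [2 * C ^+ 4]. *)
pose e1 := e / (2 * C ^+ 4 * C0).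
have e10 : 0 < e1 by rewrite divr_gt0.
have [r0 r01 hr0] := cond e1 e10.
have [m0 /andP[m00 m01] hm0] := selfmap_bound _ phi r0 hp p1 r01.
(* The first term serves the constant [C0]. The second exceeds [m0], so a point with
   [cabs (phi z) >= rho0] satisfies [cabs z > r0] and the hypothesis on [G] applies to it. *)
pose rho0 := Num.max ((1 + a) / 2) ((1 + m0) / 2).
have rhoa : (1 + a) / 2 <= rho0 by rewrite le_max lexx.
have rhom : (1 + m0) / 2 <= rho0 by rewrite le_max lexx orbT.
have rho01 : rho0 < 1 by rewrite gt_max; itv_lra.
have rho02 : 2^-1 <= rho0 by lra.
have rI : 0 <= (1 + rho0) / 2 < 1 by itv_lra.
have eT : 0 < e1 * T ((1 + rho0) / 2) by rewrite mulr_gt0 //; exact: tail_gt0.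
(* Makes the tail small enough for the case of [level_comparison] in which the level is reached
   before [(1 + rho0) / 2]. *)
have [r1' /andP[r1'0 r1'1] hr1'] := tail_small R sigma s0 si _ eT.
pose r1 := Num.max r1' 2^-1.
have r12 : 2^-1 <= r1 by rewrite le_max lexx orbT.
have r11 : r1 < 1 by rewrite gt_max r1'1; lra.
exists r1; first by itv_lra.
move=> f hf.
pose N := circ_sqr f.
pose H := circ (fun z => cabs (f (phi z)) ^+ 2).
have hfp z : cabs z < 1 -> hol (fun z => f (phi z)) z.
  by move=> z1; apply: hol_comp; [exact: hp|apply: hf; exact: p1].
(* Subordination asks for a disc strictly larger than [cabs z <= r]; the midpoint between [r] and 1
   provides it at the price of one doubling of [G]. *)
pose P r rho := forall z, cabs z < (1 + r) / 2 -> cabs (phi z) < rho.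
have hN s s' : 0 <= s -> s <= s' -> s' < 1 -> N s <= N s'.
  move=> h1 h2 h3; have [->|ne] := eqVneq s s'; first exact: lexx.
  by apply: circ_mono => //; rewrite lt_neqAle ne.
have hH rho r : rho0 <= rho < 1 -> 0 <= r < 1 -> P r rho -> H r <= C0 * N rho.
  move=> /andP[h1 h2] /andP[h3 h4] hP.
  have rI1 : 0 < rho < 1 by itv_lra.
  have rlt : r < (1 + r) / 2 by lra.
  have hp' z : cabs z < (1 + r) / 2 -> hol phi z by move=> h; apply: hp; lra.
  apply: le_trans (subordination _ f phi rho r ((1 + r) / 2) hf hp' hP h3 rlt rI1) _.
  apply: ler_wpM2r; first exact: circ_sqr_ge0.
  rewrite -/a /C0; have ar : 0 < rho - a by lra.
  have a10 : 0 < 1 - a by lra.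
  rewrite ler_pdivrMr // mulrAC ler_pdivlMr //.
  have : 0 <= (rho - (1 + a) / 2) * (1 + a) by apply: mulr_ge0; lra.
  have : 0 <= (1 - rho) * (1 - a) by apply: mulr_ge0; lra.
  nra.
have hP r : 0 <= r < 1 -> exists2 rho, rho0 <= rho < 1 & P r rho.
  move=> /andP[h1 h2]; have h3 : (1 + r) / 2 < 1 by lra.
  have [m /andP[m0' m1'] hm] := selfmap_bound _ phi _ hp p1 h3.
  exists (Num.max rho0 ((1 + m) / 2)).
    by rewrite le_max lexx /= gt_max rho01; lra.
  move=> z zr; apply: le_lt_trans (hm z (ltW zr)) _.
  by rewrite lt_max; apply/orP; right; lra.
have hG rho r : rho0 <= rho < 1 -> 0 <= r < 1 -> ~ P r rho -> G ((1 + r) / 2) <= e1 * G rho.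
  move=> /andP[h1 h2] /andP[h3 h4] nP.
  have [z /not_implyP[zr /negP]] := (existsNP _).2 nP.
  rewrite -leNgt => pz.
  have z1 : cabs z < 1 by lra.
  have zr0 : r0 < cabs z.
    rewrite ltNge; apply/negP => h; have := hm0 z h; lra.
  have z0 := cabs_ge0 _ z.
  have g1 : G ((1 + r) / 2) <= G (cabs z).
    by apply: (Grad_noninc R sigma s0 si) => //; [exact: ltW|lra].
  have g2 := hr0 z z1 zr0.
  have g3 : G (cabs (phi z)) <= G rho.
    by apply: (Grad_noninc R sigma s0 si) => //; [lra|exact: p1].
  apply: le_trans g1 (le_trans (ltW g2) _).
  by apply: ler_wpM2l => //; exact: ltW.
have Tr1 : T r1 <= e1 * T ((1 + rho0) / 2).
  apply: le_trans (ltW hr1'); apply: (tail_noninc R sigma s0 si) => //.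
  by rewrite le_max lexx.
have sub1 : `]r1, 1[%classic `<=` (@I01 R).
  by move=> r; rewrite /I01 /= !in_itv /= => /andP[? ->]; rewrite andbT; lra.
have mI : measurable (@I01 R) by rewrite /I01; exact: measurable_itv.
have mH1 : measurable_fun `]r1, 1[ H by apply: measurable_funS mI sub1 (circ_measurable _ hfp).
have mN1 : measurable_fun (@I01 R) N by exact: circ_measurable.
have mN : measurable_fun (@I01 R) (fun r => C0 * N r) by exact: measurable_funM.
have mw : measurable_fun (@I01 R) (fun r => r * sigma r).
  by apply: measurable_funM => //; exact: sigma_measurable.
have mw1 : measurable_fun `]r1, 1[ (fun r => r * sigma r) by exact: measurable_funS mI sub1 mw.
have w1 r : I01 r -> 0 <= r * sigma r.
  rewrite /I01 /= in_itv /= => h; have /andP[? ?] := h.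
  by apply: mulr_ge0 => //; exact: ltW (s0 r h).
have rho0I : 2^-1 <= rho0 < 1 by rewrite rho02.
have r1I : 2^-1 <= r1 < 1 by rewrite r12.
have L := level_comparison H N P C0 rho0 e1 r1 rho0I C00 e10 hN hH hP hG r1I Tr1 mH1 mN.
have k0 : 0 <= 2 * C ^+ 4 * e1 by apply: mulr_ge0; [apply: mulr_ge0 => //; apply: exprn_ge0; lra|exact: ltW].
have N0 r : 0 <= N r by exact: circ_sqr_ge0.
have H0 r : 0 <= H r by exact: circ_sqr_ge0.
have K := layer_comparison R `]r1, 1[%classic (@I01 R) (fun r => r * sigma r) H (fun r => C0 * N r)
  (2 * C ^+ 4 * e1) (measurable_itv _) mI mw1 mw mH1 mN (fun r h => w1 r (sub1 r h)) w1
  (fun r _ => H0 r) (fun r _ => mulr_ge0 (ltW C00) (N0 r)) k0 L.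
apply: le_trans K _; rewrite le_eqVlt; apply/orP; left; apply/eqP.
have -> : e = 2 * C ^+ 4 * e1 * C0.
  by rewrite /e1; move: (lt0r_neq0 CC0); move: (C ^+ 4) => c h; field; move: h; rewrite !mulf_eq0 !negb_or => /andP[/andP[_ ->] ->].
rewrite (EFinM (2 * C ^+ 4 * e1) C0) -muleA; congr (_ * _)%E.
have mwN : measurable_fun (@I01 R) (fun r => (r * sigma r * N r)%:E).
  by apply/measurable_EFinP; exact: measurable_funM.
have wN0 r : I01 r -> (0 <= (r * sigma r * N r)%:E)%E.
  by move=> h; rewrite lee_fin; apply: mulr_ge0; [exact: w1|exact: N0].
rewrite /radial_norm; apply: etrans (esym (mule_integral R (@I01 R) _ C0 mI mwN wN0 (ltW C00))).
by apply: eq_integral => r _; rewrite -EFinM; congr EFin; rewrite mulrCA.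
Qed.

End MainEstimate.

(** * Diagonal subsequences *)

Section Diagonal.
Variable R : realType.

Lemma diagonal_extraction (x : nat -> nat -> R) : (forall j, bounded_fun (x j)) ->
  exists2 f : nat -> nat, {homo f : m n / (m < n)%N >-> (m < n)%N} &
    forall j, cvgn (x j \o f).
Proof.
move=> bx.
have bw j (g : nat -> nat) : exists f : nat -> nat,
    {homo f : m n / (m < n)%N >-> (m < n)%N} /\ cvgn (x j \o g \o f).
  have bg : bounded_fun (x j \o g).
    by have [M [Mr hM]] := bx j; exists M; split => // y /hM h n _; exact: h.
  have [f fi fc] := bolzano_weierstrass bg; exists f; split => //.
  by move=> m n mn; have := fi m n; have := fi n m; rewrite !leEnat; lia.
have /choice[S SP] : forall jg : nat * (nat -> nat), exists f : nat -> nat,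
    {homo f : m n / (m < n)%N >-> (m < n)%N} /\ cvgn (x jg.1 \o jg.2 \o f).
  by move=> [j g]; exact: bw.
pose fix Phi j : nat -> nat := if j is i.+1 then Phi i \o S (i.+1, Phi i) else S (0%N, id).
have Phi_inc j : {homo Phi j : m n / (m < n)%N >-> (m < n)%N}.
  elim: j => [|j ih] m n mn /=; first by apply: (SP (0%N, id)).1.
  by apply: ih; apply: (SP (j.+1, Phi j)).1.
have ge_id (f : nat -> nat) : {homo f : m n / (m < n)%N >-> (m < n)%N} -> forall n, (n <= f n)%N.
  by move=> hf; elim=> // n ih; apply: leq_ltn_trans ih _; exact: hf.
(* Later extractions refine earlier ones without moving indices backwards, so from index [j] on the
   diagonal takes values of [Phi j] at indices no smaller than its own. *)
have sub j d i : exists2 i', (i <= i')%N & Phi (d + j)%N i = Phi j i'.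
  elim: d i => [|d ih] i; first by exists i.
  have [i' h1 h2] := ih (S ((d + j).+1, Phi (d + j)%N) i).
  exists i'; last by rewrite addSn.
  by apply: leq_trans h1; apply: ge_id; apply: (SP _).1.
have Phi_cvg j : cvgn (x j \o Phi j).
  by case: j => [|j]; [exact: (SP (0%N, id)).2|exact: (SP (j.+1, Phi j)).2].
exists (fun k => Phi k k).
  apply: homo_ltn => [a b c|k]; first exact: ltn_trans.
  rewrite /=; apply: Phi_inc; apply: ge_id; exact: (SP _).1.
move=> j; apply/cvg_ex; have /cvg_ex[l hl] := Phi_cvg j; exists l.
apply/cvgrPdist_lt => e e0; move/cvgrPdist_lt : hl => /(_ e e0)[N _ hN].
exists (maxn j N) => // k /=; rewrite geq_max => /andP[jk Nk].
have [i' h1 h2] := sub j (k - j)%N k; rewrite subnK // in h2.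
rewrite h2; apply: (hN i'); exact: leq_trans Nk h1.
Qed.

End Diagonal.

(** * Complex circle integrals and Cauchy's formula *)

(** The integral of [F(r e^(it)) dt]. As [dz = i z dt], contour integrals appear with an additional
    factor [z] in the integrand and with [2 pi] in place of [2 pi i]. *)
Definition ccm {R : realType} (F : R[i] -> R[i]) (r : R) : R[i] :=
  Complex (circ (fun z => cRe (F z)) r) (circ (fun z => cIm (F z)) r).

Definition cont_circ {R : realType} (F : R[i] -> R[i]) (r : R) :=
  forall z, cabs z = `|r| -> cont_at F z.

Section ComplexCircleMean.
Variable R : realType.
Implicit Types (z w c : R[i]) (r rho B : R) (f F G : R[i] -> R[i]).

Lemma eq_ccm F G r : (forall z, cabs z = `|r| -> F z = G z) -> ccm F r = ccm G r.
Proof. by move=> h; rewrite /ccm; congr Complex; apply: eq_circ => z zr; rewrite h. Qed.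

Lemma cont_circ_Re F r : cont_circ F r -> ccirc (fun z => cRe (F z)) r.
Proof. by move=> h z zr; apply: cont_Re; exact: h. Qed.

Lemma cont_circ_Im F r : cont_circ F r -> ccirc (fun z => cIm (F z)) r.
Proof. by move=> h z zr; apply: cont_Im; exact: h. Qed.

Lemma ccmD F G r : cont_circ F r -> cont_circ G r ->
  ccm (fun z => F z + G z) r = ccm F r + ccm G r.
Proof.
move=> cF cG; rewrite /ccm.
rewrite (eq_circ _ _ (fun z => cRe (F z) + cRe (G z))); last by move=> z _; rewrite cReD.
rewrite (circD _ _ _ _ (cont_circ_Re F r cF) (cont_circ_Re G r cG)).
rewrite (eq_circ _ (fun z => cIm (F z + G z)) (fun z => cIm (F z) + cIm (G z))); last by move=> z _; rewrite cImD.
by rewrite (circD _ _ _ _ (cont_circ_Im F r cF) (cont_circ_Im G r cG)).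
Qed.

Lemma ccmZ c F r : cont_circ F r -> ccm (fun z => c * F z) r = c * ccm F r.
Proof.
move=> cF; have kR := cont_circ_Re F r cF; have kI := cont_circ_Im F r cF.
have cK k u : ccirc u r -> ccirc (fun z => k * u z) r.
  by move=> cu z zr; apply: rcontZ; exact: cu.
rewrite /ccm.
rewrite (eq_circ _ _ (fun z => cRe c * cRe (F z) + (- cIm c) * cIm (F z))); last first.
  by move=> z _; rewrite cReM mulNr.
rewrite (circD _ _ _ _ (cK _ _ kR) (cK _ _ kI)).
rewrite (eq_circ _ (fun z => cIm (c * F z)) (fun z => cRe c * cIm (F z) + cIm c * cRe (F z))); last first.
  by move=> z _; rewrite cImM.
rewrite (circD _ _ _ _ (cK _ _ kI) (cK _ _ kR)).
rewrite (circZ _ _ _ _ kR) (circZ _ _ _ _ kI) (circZ _ _ _ _ kR) (circZ _ _ _ _ kI).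
by case: c => a b; simpc => /=; congr Complex; ring.
Qed.

(** Real and imaginary parts are bounded separately, hence 4 where the sharp constant has 2. *)
Lemma ccm_bound F r B : cont_circ F r -> (forall z, cabs z = `|r| -> cabs (F z) <= B) ->
  cabs (ccm F r) <= 4 * pi * B.
Proof.
move=> cF hB; apply: le_trans (ler_ReIm _ _) _; rewrite /ccm /=.
have bnd (u : R[i] -> R) : ccirc u r -> (forall z, cabs z = `|r| -> `|u z| <= B) ->
    `|circ u r| <= 2 * pi * B.
  move=> cu hu; have pih : - (pi / 2) <= pi / 2 :> R by have := pihalf_gt0 R; lra.
  have -> : 2 * pi * B = (B + B) * (pi / 2 - - (pi / 2)) by field.
  apply: rint_bound => //; first exact: ctsI_circ.
  move=> t _; apply: le_trans (ler_normD _ _) _.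
  by apply: lerD; apply: hu; rewrite ?cabsN cabs_pol.
have h1 := bnd _ (cont_circ_Re F r cF) (fun z zr => le_trans (ler_Re _ (F z)) (hB z zr)).
have h2 := bnd _ (cont_circ_Im F r cF) (fun z zr => le_trans (ler_Im _ (F z)) (hB z zr)).
by lra.
Qed.

(** The imaginary part is the real part of [- i F], to which [mean_value] applies again. *)
Lemma ccm_mean_value F R0 r0 b : (forall z, cabs z < R0 -> cont_at F z) ->
  (forall z, cabs z < R0 -> cabs z != r0 -> hol F z) ->
  0 <= b -> b < R0 -> ccm F b = (2 * pi)%:C%C * F 0.
Proof.
move=> cF hF b0 bR; rewrite /ccm (@mean_value _ F R0 r0 b cF hF b0 bR).
pose G z := Complex 0 (-1) * F z.
have cG z : cabs z < R0 -> cont_at G z.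
  move=> zR; exact: (cont_atZ _ (Complex 0 (-1)) F z (cF z zR)).
have hG z : cabs z < R0 -> cabs z != r0 -> hol G z.
  move=> zR zr; exact: (holZ _ (Complex 0 (-1)) F z (hF z zR zr)).
have EG z : cRe (G z) = cIm (F z).
  by rewrite /G cReM /=; ring.
have := @mean_value _ G R0 r0 b cG hG b0 bR.
rewrite EG (eq_circ _ _ (fun z => cIm (F z))); last by move=> z _; rewrite EG.
by move=> ->; case: (F 0) => x y; simpc.
Qed.

Lemma cont_circ_hol F r : (forall z, cabs z = `|r| -> hol F z) -> cont_circ F r.
Proof. by move=> h z zr; apply: hol_cont; exact: h. Qed.

Lemma hol_inv_sub w z : z - w != 0 -> hol (fun z => (z - w)^-1) z.
Proof.
move=> h; apply: (holV _ (fun z => z - w) z h).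
exact: (holB _ id (fun=> w) z (hol_id _ z) (hol_cst _ w z)).
Qed.

Lemma hol_cauchy_kernel w z : z - w != 0 -> hol (fun z => z * (z - w)^-1) z.
Proof. by move=> h; exact: (holM _ id (fun z => (z - w)^-1) z (hol_id _ z) (hol_inv_sub w z h)). Qed.

(** The kernel has a pole inside the disc, but on the circle it is the conjugate of [k], which is
    holomorphic beyond the circle and equals 1 at 0. *)
Lemma ccm_cauchy_kernel rho w : 0 < rho < 1 -> cabs w < rho ->
  ccm (fun z => z * (z - w)^-1) rho = (2 * pi)%:C%C.
Proof.
move=> r01 wr; have [R0 [rR _ nz]] := reflected_radius _ _ w r01 wr.
have /andP[r0 r1] := r01.
pose k z := (rho ^+ 2)%:C%C * ((rho ^+ 2)%:C%C - conjc w * z)^-1.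
have hk z : cabs z < R0 -> hol k z.
  move=> zR; exact: (holZ _ (rho ^+ 2)%:C%C _ z (hol_reflected _ _ _ _ (nz z zR))).
have k0 : k 0 = 1.
  rewrite /k mulr0 subr0 divff //.
  by have := nz 0; rewrite cabs0 mulr0 subr0; apply; exact: lt_trans rR.
have M := @ccm_mean_value k R0 (-1) rho (fun z zR => hol_cont _ _ _ (hk z zR)) (fun z zR _ => hk z zR) (ltW r0) rR.
have E z : cabs z = `|rho| -> z * (z - w)^-1 = conjc (k z).
  rewrite gtr0_norm // => zr; have zw := circle_neq _ _ _ _ wr zr.
  have z0 : z != 0 by rewrite -cabs_gt0 zr.
  have kz : k z = conjc z * (conjc (z - w))^-1.
    have czw : conjc (z - w) != 0 by apply: contra zw => /eqP/conjc_inj ->.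
    rewrite /k -zr -conj_mulc (_ : z * conjc z - conjc w * z = z * conjc (z - w)).
      by move: (conjc z) (conjc (z - w)) czw => a c czw; field; rewrite z0 czw.
    by rewrite rmorphB /=; ring.
  by rewrite kz conjcM conjc_inv !conjcK.
rewrite (eq_ccm _ _ _ E) /ccm.
move: M; rewrite k0 mulr1 /ccm => -[M1 M2].
congr Complex.
  by rewrite -[RHS]M1; apply: eq_circ => z _; rewrite cRe_conj.
rewrite (eq_circ _ _ (fun z => -1 * cIm (k z))); last first.
  by move=> z _; case: (k z) => a b /=; rewrite mulN1r.
rewrite circZ; first by rewrite M2 mulr0.
by apply: cont_circ_Im; apply: cont_circ_hol => z; rewrite gtr0_norm // => zr; apply: hk; rewrite zr.
Qed.

(** Write [f z] as [f w] plus [z - w] times the difference quotient. The quotient contributes [A],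
    which vanishes at 0 and so has mean zero; the constant contributes the mean of the kernel. *)
Lemma cauchy_formula f rho w : hol_disc f ->
  0 < rho < 1 -> cabs w < rho ->
  ccm (fun z => f z * (z * (z - w)^-1)) rho = (2 * pi)%:C%C * f w.
Proof.
move=> hf r01 wr; have /andP[r0 r1] := r01.
have [L cL] := cont_dquot _ _ _ (hf w (lt_trans wr r1)).
pose A z := dquot f w L z * z.
have hA z : cabs z < 1 -> cabs z != cabs w -> hol A z.
  move=> zR zw; have zw' : z != w by apply: contra zw => /eqP->.
  exact: (holM _ (dquot f w L) id z (hol_dquot _ f w L z zw' (hf z zR)) (hol_id _ z)).
have cA z : cabs z < 1 -> cont_at A z.
  move=> zR; have c1 : cont_at (dquot f w L) z.
    have [->|zw] := eqVneq z w; first exact: cL.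
    exact: (hol_cont _ _ z (hol_dquot _ f w L z zw (hf z zR))).
  exact: (cont_atM _ (dquot f w L) id z c1 (hol_cont _ _ _ (hol_id _ z))).
have M := @ccm_mean_value A 1 (cabs w) rho cA hA (ltW r0) r1.
have A0 : A 0 = 0 by rewrite /A mulr0.
rewrite A0 mulr0 in M.
have ck : cont_circ (fun z => z * (z - w)^-1) rho.
  apply: cont_circ_hol => z; rewrite (gtr0_norm r0) => zr.
  exact: (hol_cauchy_kernel w z (circle_neq _ _ _ _ wr zr)).
have cAc : cont_circ A rho by move=> z zr; apply: cA; rewrite zr (gtr0_norm r0).
have ckf : cont_circ (fun z => f w * (z * (z - w)^-1)) rho.
  move=> z zr; exact: (cont_atZ _ (f w) _ z (ck z zr)).
rewrite (eq_ccm _ (fun z => A z + f w * (z * (z - w)^-1))).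
  by rewrite (ccmD _ _ _ cAc ckf) M add0r (ccmZ _ _ _ ck) ccm_cauchy_kernel // mulrC.
move=> z; rewrite gtr0_norm // => zr; have zw := circle_neq _ _ _ _ wr zr.
have -> : f z = dquot f w L z * (z - w) + f w by rewrite dquotM subrK.
by rewrite /A; move: (dquot f w L z) => q; field.
Qed.

End ComplexCircleMean.

(** * Cauchy estimates and Montel's theorem *)

Section Montel.
Variable R : realType.
Implicit Types (z w c : R[i]) (r rho B e : R) (f F G g h : R[i] -> R[i]).

Lemma ccmB F G r : cont_circ F r -> cont_circ G r ->
  ccm (fun z => F z - G z) r = ccm F r - ccm G r.
Proof.
move=> cF cG; rewrite -[ccm G r]mul1r -mulNr -(ccmZ _ _ _ _ cG).
have c2 : cont_circ (fun z => -1 * G z) r.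
  move=> z zr; exact: (cont_atZ _ (-1) G z (cG z zr)).
rewrite -(ccmD _ _ _ _ cF c2); apply: eq_ccm => z zr.
by rewrite mulN1r.
Qed.

Section Circle.
Variables (rho : R) (r01 : 0 < rho < 1).

Lemma circle_norm : `|rho| = rho.
Proof. by have /andP[r0 _] := r01; rewrite gtr0_norm. Qed.

Lemma circle_in z : cabs z = `|rho| -> cabs z < 1.
Proof. by have /andP[_ r1] := r01; rewrite circle_norm => ->. Qed.

(* By Cauchy's formula this is 2 pi f'(w). *)
Definition cauchy_deriv f w : R[i] := ccm (fun z => f z * (z * ((z - w)^-1 * (z - w)^-1))) rho.

Lemma cont_cauchy_deriv f w : hol_disc f -> cabs w < rho ->
  cont_circ (fun z => f z * (z * ((z - w)^-1 * (z - w)^-1))) rho.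
Proof.
move=> hf wr; apply: cont_circ_hol => z zr.
have zw : z - w != 0 by apply: circle_neq wr _; rewrite zr circle_norm.
have hi := hol_inv_sub _ w z zw.
have h1 := holM _ id (fun z => (z - w)^-1 * (z - w)^-1) z (hol_id _ z)
  (holM _ (fun z => (z - w)^-1) (fun z => (z - w)^-1) z hi hi).
exact: (holM _ f (fun z => z * ((z - w)^-1 * (z - w)^-1)) z (hf z (circle_in z zr)) h1).
Qed.

Lemma cauchy_derivB f g w : hol_disc f ->
  hol_disc g -> cabs w < rho ->
  cauchy_deriv (fun z => f z - g z) w = cauchy_deriv f w - cauchy_deriv g w.
Proof.
move=> hf hg wr; rewrite /cauchy_deriv.
have cg := cont_cauchy_deriv g w hg wr.
rewrite -(ccmB _ _ _ (cont_cauchy_deriv f w hf wr) cg); apply: eq_ccm => z zr.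
by rewrite mulrBl.
Qed.

Lemma cauchy_deriv_bound f w rho0 B : hol_disc f ->
  cabs w <= rho0 -> rho0 < rho -> (forall z, cabs z = rho -> cabs (f z) <= B) -> 0 <= B ->
  cabs (cauchy_deriv f w) <= 4 * pi * (B * (rho * ((rho - rho0)^-1 * (rho - rho0)^-1))).
Proof.
move=> hf wr0 rr hB B0; have /andP[r0 r1] := r01.
have wr : cabs w < rho by exact: le_lt_trans rr.
have d0 : 0 < rho - rho0 by rewrite subr_gt0.
apply: ccm_bound; first exact: cont_cauchy_deriv.
move=> z; rewrite circle_norm => zr.
have dz : rho - rho0 <= cabs (z - w) by have := ler_cabs_dist _ z w; rewrite zr; lra.
have iz : (cabs (z - w))^-1 <= (rho - rho0)^-1.
  by rewrite lef_pV2 ?posrE //; exact: lt_le_trans dz.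
rewrite !cabsM !cabsV zr; apply: ler_pM => //.
- exact: cabs_ge0.
- by rewrite mulr_ge0 ?mulr_ge0 ?invr_ge0 ?cabs_ge0 // ltW.
- exact: hB.
apply: ler_wpM2l; first exact: ltW.
by apply: ler_pM; rewrite ?invr_ge0 ?cabs_ge0.
Qed.

(** A Taylor bound uniform in [f], from the exact remainder of the kernel:
    [1/(z-v) - 1/(z-w) - (v-w)/(z-w)^2] equals [(v-w)^2 / ((z-w)^2 (z-v))]. It yields both
    equicontinuity and the holomorphy of limits. *)
Lemma quadratic_bound f w v rho0 B : hol_disc f ->
  cabs w <= rho0 -> cabs v <= rho0 -> rho0 < rho ->
  (forall z, cabs z = rho -> cabs (f z) <= B) -> 0 <= B ->
  cabs ((2 * pi)%:C%C * (f v - f w) - (v - w) * cauchy_deriv f w) <=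
  cabs (v - w) ^+ 2 * (4 * pi * (B * (rho * ((rho - rho0)^-1 ^+ 3)))).
Proof.
move=> hf wr0 vr0 rr hB B0; have /andP[r0 r1] := r01.
have wr : cabs w < rho by exact: le_lt_trans rr.
have vr : cabs v < rho by exact: le_lt_trans rr.
have d0 : 0 < rho - rho0 by rewrite subr_gt0.
pose K z := f z * (z * ((z - w)^-1 * (z - w)^-1 * (z - v)^-1)).
have zwN z u : cabs u < rho -> cabs z = `|rho| -> z - u != 0.
  by move=> ur zr; apply: circle_neq ur _; rewrite zr circle_norm.
have cK : cont_circ K rho.
  apply: cont_circ_hol => z zr.
  have hi := hol_inv_sub _ w z (zwN z w wr zr).
  have hj := hol_inv_sub _ v z (zwN z v vr zr).
  have h0 := holM _ (fun z => (z - w)^-1) (fun z => (z - w)^-1) z hi hi.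
  have h1 := holM _ (fun z => (z - w)^-1 * (z - w)^-1) (fun z => (z - v)^-1) z h0 hj.
  have h2 := holM _ id (fun z => (z - w)^-1 * (z - w)^-1 * (z - v)^-1) z (hol_id _ z) h1.
  exact: (holM _ f _ z (hf z (circle_in z zr)) h2).
have ck u : cabs u < rho -> cont_circ (fun z => f z * (z * (z - u)^-1)) rho.
  move=> ur; apply: cont_circ_hol => z zr.
  exact: (holM _ f (fun z => z * (z - u)^-1) z (hf z (circle_in z zr)) (hol_cauchy_kernel _ u z (zwN z u ur zr))).
have cZ (c : R[i]) F : cont_circ F rho -> cont_circ (fun z => c * F z) rho.
  move=> cF z zr; exact: (cont_atZ _ c F z (cF z zr)).
have cvw : cont_circ (fun z => f z * (z * (z - v)^-1) - f z * (z * (z - w)^-1)) rho.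
  apply: cont_circ_hol => z zr.
  have h u (ur : cabs u < rho) := holM _ f (fun z => z * (z - u)^-1) z (hf z (circle_in z zr))
    (hol_cauchy_kernel _ u z (zwN z u ur zr)).
  exact: (holB _ _ _ z (h v vr) (h w wr)).
have cd := cont_cauchy_deriv f w hf wr.
have -> : (2 * pi)%:C%C * (f v - f w) - (v - w) * cauchy_deriv f w =
    (v - w) ^+ 2 * ccm K rho.
  rewrite -(ccmZ _ _ _ _ cK) mulrBr -(cauchy_formula _ f rho v hf r01 vr).
  rewrite -(cauchy_formula _ f rho w hf r01 wr) /cauchy_deriv.
  rewrite -(ccmZ _ _ _ _ cd) -(ccmB _ _ _ (ck v vr) (ck w wr)).
  rewrite -(ccmB _ _ _ cvw (cZ _ _ cd)).
  apply: eq_ccm => z zr; rewrite /K.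
  by field; rewrite (zwN z w wr zr) (zwN z v vr zr).
rewrite cabsM expr2 cabsM -expr2; apply: ler_wpM2l; first exact: sqr_ge0.
apply: ccm_bound => // z; rewrite circle_norm => zr.
have iz u : cabs u <= rho0 -> (cabs (z - u))^-1 <= (rho - rho0)^-1.
  move=> ur; have dz : rho - rho0 <= cabs (z - u) by have := ler_cabs_dist _ z u; rewrite zr; lra.
  by rewrite lef_pV2 ?posrE //; exact: lt_le_trans dz.
rewrite /K !cabsM !cabsV zr; apply: ler_pM => //.
- exact: cabs_ge0.
- by rewrite mulr_ge0 ?mulr_ge0 ?invr_ge0 ?cabs_ge0 // ltW.
- exact: hB.
apply: ler_wpM2l; first exact: ltW.
rewrite !exprS expr0 mulr1 mulrA; apply: ler_pM; rewrite ?mulr_ge0 ?invr_ge0 ?cabs_ge0 ?iz //.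
by apply: ler_pM; rewrite ?invr_ge0 ?cabs_ge0 ?iz.
Qed.

Lemma lipschitz_bound rho0 B : rho0 < rho -> 0 <= B ->
  exists2 K, 0 < K & forall f v w, hol_disc f -> (forall z, cabs z = rho -> cabs (f z) <= B) ->
    cabs v <= rho0 -> cabs w <= rho0 -> cabs (f v - f w) <= K * cabs (v - w).
Proof.
move=> rr B0; have /andP[r0 r1] := r01.
pose D := 4 * pi * (B * (rho * ((rho - rho0)^-1 * (rho - rho0)^-1))).
pose E := 4 * pi * (B * (rho * ((rho - rho0)^-1 ^+ 3))).
(* [D] bounds the linear term; the quadratic one becomes linear through [cabs (v - w) <= 2]. The
   factor [2 * pi >= 1] on the left is dropped. *)
exists (`|D| + 2 * `|E| + 1); first by rewrite ltr_wpDl // addr_ge0 // mulr_ge0.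
move=> f v w hf hB vr wr; have c0 := cabs_ge0 _ (v - w).
have q := quadratic_bound f w v rho0 B hf wr vr rr hB B0.
have d := cauchy_deriv_bound f w rho0 B hf wr rr hB B0.
have c2 : cabs (v - w) <= 2 by have := ler_cabsB _ v w; lra.
have := ler_cabsD _ ((2 * pi)%:C%C * (f v - f w) - (v - w) * cauchy_deriv f w) ((v - w) * cauchy_deriv f w).
have tp : 1 <= 2 * pi :> R by have := pi_ge2 R; lra.
rewrite subrK !cabsM cabsR ger0_norm => [h|]; last by lra.
rewrite -/D -/E in q d; have f0 := cabs_ge0 _ (f v - f w).
have h1 : cabs (f v - f w) <= 2 * pi * cabs (f v - f w) by rewrite ler_peMl.
have h2 : cabs (v - w) * cabs (cauchy_deriv f w) <= `|D| * cabs (v - w).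
  by rewrite mulrC; apply: ler_wpM2r => //; exact: le_trans d (ler_norm D).
have h3 : cabs (v - w) ^+ 2 * E <= 2 * `|E| * cabs (v - w).
  apply: (@le_trans _ _ (cabs (v - w) ^+ 2 * `|E|)); first by rewrite ler_wpM2l ?sqr_ge0 ?ler_norm.
  rewrite -(mulrA 2) (mulrC `|E|) expr2 -(mulrA (cabs (v - w))).
  by apply: ler_wpM2r => //; exact: mulr_ge0.
move: h h1 h2 h3 q c0; clear; move: (cabs (v - w) ^+ 2 * E) => t; lra.
Qed.

End Circle.

Lemma hol_of_quadratic F w L (C d : R) : 0 < d ->
  (forall v, cabs (v - w) < d -> cabs (F v - F w - (v - w) * L) <= C * cabs (v - w) ^+ 2) ->
  hol F w.
Proof.
move=> d0 h; apply/hol_derivable; apply/cvg_ex; exists L; apply/(@cvgc_ballP R) => e e0.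
pose C1 := `|C| + 1; have C10 : 0 < C1 by rewrite ltr_wpDl.
apply/(@nbhsc_ballP R); exists (Num.min d (e / C1)).
  by rewrite lt_min d0 divr_gt0.
move=> k; rewrite subr0 lt_min => /andP[kd ke] k0 /=.
rewrite /= (_ : k *: 1 = k :> R[i]); last by rewrite /GRing.scale /= mulr1.
have ck : 0 < cabs k by rewrite cabs_gt0.
have := h (k + w); rewrite addrK => /(_ kd) hk.
have -> : k^-1 *: (F (k + w) - F w) - L = k^-1 * (F (k + w) - F w - k * L).
  by rewrite mulrBr mulKf.
rewrite cabsM cabsV mulrC ltr_pdivrMr //; apply: le_lt_trans hk _.
rewrite expr2 mulrA ltr_pM2r //.
apply: (@le_lt_trans _ _ (C1 * cabs k)).
  by apply: ler_wpM2r; [exact: ltW|rewrite (le_trans (ler_norm C))// /C1 lerDl].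
by move: ke; rewrite ltr_pdivlMr // mulrC.
Qed.

Lemma complex_cauchy (x : nat -> R[i]) :
  (forall e, 0 < e -> exists N, forall m n, (N <= m)%N -> (N <= n)%N -> cabs (x m - x n) <= e) ->
  exists l : R[i], forall e, 0 < e -> exists N, forall n, (N <= n)%N -> cabs (x n - l) <= e.
Proof.
move=> hx.
have rc (p : R[i] -> R) : (forall z w, `|p z - p w| <= cabs (z - w)) ->
    exists l : R, forall e, 0 < e -> exists N, forall n, (N <= n)%N -> `|p (x n) - l| <= e.
  move=> hp; have : cvgn (p \o x).
    apply: cauchy_cvg; apply: cauchy_exP => e e0.
    have e20 : 0 < e / 2 by rewrite divr_gt0.
    have [N hN] := hx _ e20; exists (p (x N)); exists N => // n /= Nn.
    rewrite /ball /=; apply: le_lt_trans (hp _ _) _.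
    by apply: le_lt_trans (hN N n (leqnn N) Nn) _; lra.
  move=> /cvg_ex[l hl]; exists l => e e0.
  move/cvgrPdist_le : hl => /(_ e e0)[N _ hN]; exists N => n Nn.
  by rewrite distrC; exact: hN.
have [a ha] := rc (@complex.Re R) (fun z w => eq_ind _ (fun t => `|t| <= _) (ler_Re _ (z - w)) _ (cReB _ z w)).
have [b hb] := rc (@complex.Im R) (fun z w => eq_ind _ (fun t => `|t| <= _) (ler_Im _ (z - w)) _ (cImB _ z w)).
exists (Complex a b) => e e0; have e20 : 0 < e / 2 by rewrite divr_gt0.
have [N1 h1] := ha _ e20; have [N2 h2] := hb _ e20.
exists (maxn N1 N2) => n; rewrite geq_max => /andP[n1 n2].
apply: le_trans (ler_ReIm _ _) _; rewrite cReB cImB /=.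
by have := h1 n n1; have := h2 n n2; lra.
Qed.

Definition rat_point (q : rat * rat) : R[i] := Complex (ratr q.1) (ratr q.2).

Lemma rat_point_dense z (d : R) : 0 < d -> exists q, cabs (rat_point q - z) < d.
Proof.
move=> d0; have d2 : 0 < d / 2 by rewrite divr_gt0.
have [a aP] := @rat_in_itvoo R (cRe z) (cRe z + d / 2) (ltac:(lra)).
have [b bP] := @rat_in_itvoo R (cIm z) (cIm z + d / 2) (ltac:(lra)).
exists (a, b); apply: le_lt_trans (ler_ReIm _ _) _; rewrite cReB cImB /=.
move: aP bP; rewrite !in_itv /= => /andP[a1 a2] /andP[b1 b2].
by rewrite !gtr0_norm; lra.
Qed.

Lemma compact_closed_disc rho : compact [set p : R * R | cabs (cplx p) <= rho].
Proof.
apply: (subclosed_compact _ (compact_setX (@segment_compact R (- rho) rho) (@segment_compact R (- rho) rho))).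
  apply: (preimage_closed (f := fun p : R * R => cabs (cplx p)) _ (@closed_le _ rho)) => p _.
  exact: continuous_cabs2.
move=> [x y] /= h; have := ler_Re _ (cplx (x, y)); have := ler_Im _ (cplx (x, y)).
by rewrite /= !in_itv /= -!ler_norml => a b; split; [exact: le_trans b h|exact: le_trans a h].
Qed.

Section LocallyBounded.
Variable u : nat -> R[i] -> R[i].
Hypothesis hu : forall k z, cabs z < 1 -> hol (u k) z.
Hypothesis bu : forall rho, 0 <= rho < 1 -> exists B, forall k z, cabs z <= rho -> cabs (u k z) <= B.

Lemma rat_point_extraction : exists2 f : nat -> nat, {homo f : m n / (m < n)%N >-> (m < n)%N} &
  forall q e, cabs (rat_point q) < 1 -> 0 < e -> exists K, forall k l, (K <= k)%N -> (K <= l)%N ->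
    cabs (u (f k) (rat_point q) - u (f l) (rat_point q)) <= e.
Proof.
(* One real sequence for each rational point and each choice of real or imaginary part. Points
   outside the disc and invalid codes get the zero sequence, which keeps all of them bounded. *)
pose x (j : nat) (k : nat) : R := if @unpickle ((rat * rat) * bool)%type j is Some (q, b)
  then (if cabs (rat_point q) < 1 then
    (if b then cRe (u k (rat_point q)) else cIm (u k (rat_point q))) else 0) else 0.
have bx j : bounded_fun (x j).
  have b0 : bounded_fun (fun=> 0 : R).
    by exists 0; split => // M M0 k _ /=; rewrite normr0 ltW.
  rewrite /x; case: (unpickle j) => [[q b]|] //; have [q1|_] := boolP (cabs (rat_point q) < 1); last exact: b0.
  have [|B hB] := bu (cabs (rat_point q)); first by rewrite cabs_ge0.
  exists B; split; first exact: num_real.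
  move=> M BM k _ /=; apply: le_trans (ltW BM); apply: le_trans (hB k _ (lexx _)).
  by case: b; [exact: ler_Re|exact: ler_Im].
have [f fi fc] := diagonal_extraction R x bx; exists f => // q e q1 e0.
have H (b : bool) : exists K, forall k l, (K <= k)%N -> (K <= l)%N ->
    `|x (pickle (q, b)) (f k) - x (pickle (q, b)) (f l)| <= e / 2.
  have /cvg_ex[l0] := fc (pickle (q, b)).
  have e40 : 0 < e / 4 by rewrite divr_gt0.
  move=> /cvgrPdist_le/(_ _ e40)[K _ hK]; exists K => k l kK lK.
  have := hK k kK; have := hK l lK; rewrite /=; move: (x _ (f k)) (x _ (f l)) => a b'.
  move=> h1 h2; have -> : a - b' = (l0 - b') - (l0 - a) by ring.
  by apply: le_trans (ler_normB _ _) _; lra.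
have [K1 h1] := H true; have [K2 h2] := H false.
exists (maxn K1 K2) => k l; rewrite !geq_max => /andP[k1 k2] /andP[l1 l2].
apply: le_trans (ler_ReIm _ _) _; rewrite cReB cImB.
have := h1 k l k1 l1; have := h2 k l k2 l2; rewrite /x !pickleK q1.
by lra.
Qed.

(** Convergence at the rational points spreads by the common Lipschitz constant, and a covering of
    the closed disc makes it uniform. *)
Lemma uniformly_cauchy_extraction :
  exists2 f : nat -> nat, {homo f : m n / (m < n)%N >-> (m < n)%N} &
  forall rho0 e, 0 <= rho0 -> rho0 < 1 -> 0 < e -> exists K, forall k l, (K <= k)%N -> (K <= l)%N ->
    forall z, cabs z <= rho0 -> cabs (u (f k) z - u (f l) z) <= e.
Proof.
have [f fi fc] := rat_point_extraction; exists f => // rho0 e rho00 rho01 e0.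
pose rho1 := (rho0 + 1) / 2; pose rho := (rho1 + 1) / 2.
have r01 : 0 < rho < 1 by rewrite /rho /rho1; itv_lra.
have /andP[r0 r1] := r01.
have [|B hB] := bu rho; first by rewrite (ltW r0) r1.
have B0 : 0 <= B.
  by have := hB 0%N 0; rewrite cabs0 => /(_ (ltW r0)); apply: le_trans; exact: cabs_ge0.
have rr : rho1 < rho by rewrite /rho /rho1; lra.
have [C C0 hC] := lipschitz_bound rho r01 rho1 B rr B0.
(* The first bound keeps the rational point in [cabs z <= rho1]. By the second, moving by [2 * d]
   changes each function by at most [e / 4]; two such moves and the [e / 4] at the rational point
   stay below [e]. *)
pose d := Num.min ((1 - rho0) / 2) (e / (8 * C)).
have d0 : 0 < d by rewrite lt_min !divr_gt0 ?mulr_gt0 // subr_gt0.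
have dr : d <= (1 - rho0) / 2 by rewrite /d ge_min lexx.
have dC : C * d <= e / 8.
  have -> : e / 8 = C * (e / (8 * C)) by field; exact: lt0r_neq0.
  by apply: ler_wpM2l; rewrite ?(ltW C0) // /d ge_min lexx orbT.
have /compact_near_coveringP cov := compact_closed_disc rho0.
have [K _ hK] : \forall K \near \oo, [set p : R * R | cabs (cplx p) <= rho0] `<=`
    (fun p => forall k l, (K <= k)%N -> (K <= l)%N -> cabs (cplx p) <= rho0 ->
      cabs (u (f k) (cplx p) - u (f l) (cplx p)) <= e).
  apply: cov => p /= pr; have [q hq] := rat_point_dense (cplx p) d d0.
  have qr : cabs (rat_point q) <= rho1.
    by have := ler_cabs_dist _ (rat_point q) (cplx p); rewrite /rho1; lra.
  have q1 : cabs (rat_point q) < 1 by rewrite /rho in rr r1; lra.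
  have e40 : 0 < e / 4 by rewrite divr_gt0.
  have [K hK] := fc q _ q1 e40.
  have nd : \forall p' \near p, cabs (cplx p' - cplx p) < d
    by have /(@cvgc_ballP R) := @continuous_cplx R p; apply.
  exists ([set p' | cabs (cplx p' - cplx p) < d], [set n | (K <= n)%N]); first by split => //; exists K.
  move=> -[p' n] [/= pp Kn] k l nk nl p'r.
  have hk := hK k l (leq_trans Kn nk) (leq_trans Kn nl).
  have pq : cabs (cplx p' - rat_point q) <= d + d.
    have := ler_cabsB _ (cplx p' - cplx p) (rat_point q - cplx p).
    by rewrite opprB addrA subrK; lra.
  have L j : cabs (u j (cplx p') - u j (rat_point q)) <= e / 4.
    have p'1 : cabs (cplx p') <= rho1 by rewrite /rho1; lra.
    have := hC (u j) _ _ (hu j) (fun z zr => hB j z (eq_ind_r (fun t => t <= rho) (lexx _) zr)) p'1 qr.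
    by have := ler_wpM2l (ltW C0) pq; lra.
  have -> : u (f k) (cplx p') - u (f l) (cplx p') = (u (f k) (rat_point q) - u (f l) (rat_point q)) +
    ((u (f k) (cplx p') - u (f k) (rat_point q)) - (u (f l) (cplx p') - u (f l) (rat_point q))) by ring.
  apply: le_trans (ler_cabsD _ _ _) _; have := ler_cabsB _ (u (f k) (cplx p') - u (f k) (rat_point q)) (u (f l) (cplx p') - u (f l) (rat_point q)).
  by have := L (f k); have := L (f l); lra.
exists K => k l kK lK z zr; have := hK K (leqnn K) (cRe z, cIm z).
by case: z zr => a b zr /(_ zr k l kK lK zr).
Qed.

End LocallyBounded.

(** Holomorphy of the limit is inherited through [quadratic_bound], whose constant does not depend
    on the index: once the derivatives converge too, the bound survives the limit. *)
Lemma montel (u : nat -> R[i] -> R[i]) : (forall k z, cabs z < 1 -> hol (u k) z) ->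
  (forall rho, 0 <= rho < 1 -> exists B, forall k z, cabs z <= rho -> cabs (u k z) <= B) ->
  exists f : nat -> nat, exists g : R[i] -> R[i],
  [/\ {homo f : m n / (m < n)%N >-> (m < n)%N}, forall z, cabs z < 1 -> hol g z &
    forall rho e, 0 <= rho -> rho < 1 -> 0 < e -> exists K, forall k, (K <= k)%N ->
      forall z, cabs z <= rho -> cabs (u (f k) z - g z) <= e].
Proof.
move=> hu bu; have [f fi fc] := uniformly_cauchy_extraction u hu bu.
have /choice[g hg] : forall z, exists l : R[i], cabs z < 1 ->
    forall e, 0 < e -> exists N, forall n, (N <= n)%N -> cabs (u (f n) z - l) <= e.
  move=> z; have [z1|z1] := ltP (cabs z) 1; last by exists 0.
  have [|l hl] := complex_cauchy (fun n => u (f n) z); last by exists l.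
  move=> e e0; have [K hK] := fc (cabs z) e (cabs_ge0 _ z) z1 e0.
  by exists K => m n mK nK; apply: hK.
have ug rho e : 0 <= rho -> rho < 1 -> 0 < e -> exists K, forall k, (K <= k)%N ->
      forall z, cabs z <= rho -> cabs (u (f k) z - g z) <= e.
  move=> r0 r1 e0; have e20 : 0 < e / 2 by rewrite divr_gt0.
  have [K hK] := fc rho _ r0 r1 e20; exists K => k kK z zr.
  have [N hN] := hg z (le_lt_trans zr r1) _ e20.
  have h1 := hK k (maxn K N) kK (leq_maxl _ _) z zr.
  have h2 := hN (maxn K N) (leq_maxr _ _).
  rewrite -(subrKA (u (f (maxn K N)) z)); apply: le_trans (ler_cabsD _ _ _) _.
  by lra.
exists f, g; split => // w w1.
pose rho0 := (cabs w + 1) / 2; pose rho := (rho0 + 1) / 2.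
have w0 := cabs_ge0 _ w.
have wr0 : cabs w < rho0 by rewrite /rho0; lra.
have rr : rho0 < rho by rewrite /rho /rho0; lra.
have r1 : rho < 1 by rewrite /rho /rho0; lra.
have r0 : 0 < rho by rewrite /rho /rho0; lra.
have r01 : 0 < rho < 1 by rewrite r0 r1.
have wr : cabs w < rho by exact: lt_trans rr.
have [|B hB] := bu rho; first by rewrite (ltW r0) r1.
have B0 : 0 <= B.
  by have := hB 0%N 0; rewrite cabs0 => /(_ (ltW r0)); apply: le_trans; exact: cabs_ge0.
pose D k := cauchy_deriv rho (u (f k)) w.
pose C1 := 4 * pi * (rho * ((rho - rho0)^-1 * (rho - rho0)^-1)).
have d0 : 0 < rho - rho0 by rewrite subr_gt0.
have C10 : 0 < C1.
  have i0 : 0 < (rho - rho0)^-1 by rewrite invr_gt0.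
  have p0 := pi_gt0 R; rewrite /C1; move: (rho - rho0)^-1 i0 => i i0.
  apply: mulr_gt0; first by apply: mulr_gt0.
  by apply: mulr_gt0 => //; exact: mulr_gt0.
(* [L] is to be [2 * pi] times the derivative of [g] at [w]: the Cauchy integrals [D n] form a
   Cauchy sequence because the functions do, uniformly on the circle. *)
have [L hL] : exists L : R[i], forall e, 0 < e -> exists N, forall n, (N <= n)%N -> cabs (D n - L) <= e.
  apply: complex_cauchy => e e0; have e'0 : 0 < e / C1 by rewrite divr_gt0.
  have [K hK] := fc rho _ (ltW r0) r1 e'0; exists K => k l kK lK.
  rewrite /D -(cauchy_derivB _ r01 (u (f k)) (u (f l)) w (hu (f k)) (hu (f l)) wr).
  have hd v : cabs v < 1 -> hol (fun z => u (f k) z - u (f l) z) v.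
    by move=> v1; exact: (holB _ _ _ v (hu (f k) v v1) (hu (f l) v v1)).
  have bd z : cabs z = rho -> cabs (u (f k) z - u (f l) z) <= e / C1.
    by move=> zr; apply: hK => //; rewrite zr.
  have h := cauchy_deriv_bound _ r01 _ w rho0 _ hd (ltW wr0) rr bd (ltW e'0).
  apply: le_trans h _; rewrite [leLHS](_ : _ = C1 * (e / C1)); last by rewrite /C1; ring.
  by rewrite mulrC divfK // gt_eqF.
pose C2 := 4 * pi * (B * (rho * ((rho - rho0)^-1 ^+ 3))).
have tp : (2 * pi)%:C%C != 0 :> R[i].
  by rewrite -cabs_gt0 cabsR gtr0_norm ?mulr_gt0 ?pi_gt0.
have hG : hol (fun z => (2 * pi)%:C%C * g z) w.
  apply: (hol_of_quadratic _ w L C2 (rho0 - cabs w)); first by rewrite subr_gt0.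
  move=> v vw; have vr0 : cabs v <= rho0.
    by have := ler_cabsD _ (v - w) w; rewrite subrK; lra.
  have vr : cabs v < rho by exact: le_lt_trans rr.
  apply/ler_addgt0Pr => e e0.
  (* The sum of the coefficients with which the errors at [w], at [v] and in the derivative enter;
     dividing [e] by it balances the three. *)
  pose M := 2 * pi + 2 * pi + cabs (v - w).
  have M0 : 0 < M by have := pi_gt0 R; have := cabs_ge0 _ (v - w); rewrite /M; lra.
  have e'0 : 0 < e / M by rewrite divr_gt0.
  have [K1 h1] := ug rho _ (ltW r0) r1 e'0; have [K2 h2] := hL _ e'0.
  pose k := maxn K1 K2.
  have g1 := h1 k (leq_maxl _ _) v (ltW vr); have g2 := h1 k (leq_maxl _ _) w (ltW wr).
  have g3 := h2 k (leq_maxr _ _).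
  have q := quadratic_bound _ r01 (u (f k)) w v rho0 B (hu (f k)) (ltW wr0) vr0 rr
    (fun z zr => hB (f k) z (eq_ind_r (fun t => t <= rho) (lexx _) zr)) B0.
  rewrite -/C2 -/(D k) in q.
  have -> : (2 * pi)%:C%C * g v - (2 * pi)%:C%C * g w - (v - w) * L =
    ((2 * pi)%:C%C * (u (f k) v - u (f k) w) - (v - w) * D k) +
    (((2 * pi)%:C%C * (u (f k) w - g w) - (2 * pi)%:C%C * (u (f k) v - g v)) + (v - w) * (D k - L)).
    by ring.
  apply: le_trans (ler_cabsD _ _ _) _; rewrite (mulrC C2); apply: lerD => //.
  apply: le_trans (ler_cabsD _ _ _) _.
  apply: le_trans (lerD (ler_cabsB _ _ _) (lexx _)) _.
  rewrite !cabsM cabsR gtr0_norm ?mulr_gt0 ?pi_gt0 //.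
  have p0 : 0 <= 2 * pi :> R by rewrite mulr_ge0 // pi_ge0.
  have m1 := ler_wpM2l p0 g1; have m2 := ler_wpM2l p0 g2.
  have m3 := ler_wpM2l (cabs_ge0 _ (v - w)) g3.
  apply: le_trans (lerD (lerD m2 m1) m3) _.
  rewrite [leLHS](_ : _ = M * (e / M)); last by rewrite /M; move: (e / _) => x; ring.
  by rewrite mulrC divfK // gt_eqF.
have := holZ _ ((2 * pi)%:C%C)^-1 _ w hG.
rewrite (_ : (fun z => _ * _) = g) //.
by apply/funext => z; rewrite mulKf.
Qed.

End Montel.

(** * Bergman norm, point evaluations and compactness *)

Section BergmanNorm.
Variables (R : realType) (sigma : R -> R).
Local Notation mu := (@lebesgue_measure R).
Hypotheses (sc : {within `[0, 1[, continuous sigma})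
  (s0 : forall r : R, 0 <= r < 1 -> 0 < sigma r)
  (si : mu.-integrable `[0, 1[ (EFin \o sigma))
  (w0 : forall r, I01 r -> 0 < omega_of sigma r).
Implicit Types (f g h phi : R[i] -> R[i]) (z w : R[i]) (r rho b e : R).
Local Notation T := (tail R sigma).
Local Notation G := (Grad R sigma).
Local Notation radial := (radial_norm R sigma).
Local Notation beyond := (radial_norm_beyond R sigma).

Lemma radial_density_ge0 f r : (`[0%R, 1%R[%classic : set R) r ->
  (0 <= (r * sigma r * circ_sqr f r)%:E)%E.
Proof.
rewrite /= in_itv /= => /andP[r0 r1]; rewrite lee_fin.
by apply: mulr_ge0; [apply: mulr_ge0 => //; apply/ltW/s0; rewrite r0|exact: circ_sqr_ge0].
Qed.

Lemma radial_norm_ge0 f : (0 <= radial f)%E.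
Proof. by apply: integral_ge0; exact: radial_density_ge0. Qed.

Lemma measurable_radial_density f : hol_disc f ->
  measurable_fun (@I01 R) (fun r => r * sigma r * circ_sqr f r).
Proof.
move=> hf; apply: measurable_funM; last exact: circ_measurable.
by apply: measurable_funM => //; exact: sigma_measurable.
Qed.

Lemma A2norm2E f : hol_disc f -> A2norm2 sigma f = (pi^-1%:E * radial f)%E.
Proof.
move=> hf; have pi0 : 0 <= pi^-1 :> R by rewrite invr_ge0 pi_ge0.
have mD := measurable_radial_density f hf.
rewrite (mule_integral _ (`[0%R, 1%R[%classic) _ _ _ _ _ pi0) //; last 2 first.
- exact/measurable_EFinP.
- exact: radial_density_ge0.
have ms : measurable_fun (@I01 R) (fun r => sigma r / pi).
  by apply: measurable_funM => //; exact: sigma_measurable.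
have P := polar R (fun r => sigma r / pi) (fun z => cabs (f z) ^+ 2) ms _
  (fun z hz => sqr_rcont _ f z (hf z hz)) (fun z => sqr_ge0 _).
rewrite /A2norm2; under eq_integral do rewrite -mulrA.
rewrite P; last by move=> r h; apply: divr_ge0; [exact/ltW/s0|exact: pi_ge0].
by apply: eq_integral => r _; rewrite -EFinM; congr EFin; ring.
Qed.

Lemma measurable_A2_density f : hol_disc f ->
  measurable_fun (@disc2 R) (fun p => (cabs (f (cplx p)) ^+ 2 * sigma (cabs (cplx p)) / pi)%:E).
Proof.
move=> hf; apply/measurable_EFinP; apply: measurable_funM => //.
apply: measurable_funM; last by apply: measurable_radial; exact: sigma_measurable.
by apply: (measurable_rcont _ (fun z => cabs (f z) ^+ 2)) => z z1; apply: sqr_rcont; exact: hf.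
Qed.

Lemma A2_density_ge0 f (p : R * R) : disc2 p ->
  (0 <= (cabs (f (cplx p)) ^+ 2 * sigma (cabs (cplx p)) / pi)%:E)%E.
Proof.
rewrite /disc2 /= => p1; rewrite lee_fin; apply: divr_ge0; last exact: pi_ge0.
by apply: mulr_ge0; [exact: sqr_ge0|apply/ltW/s0; rewrite cabs_ge0].
Qed.

Lemma A2norm2_ge0 f : (0 <= A2norm2 sigma f)%E.
Proof. by apply: integral_ge0; exact: A2_density_ge0. Qed.

Lemma A2norm2_fatou (u : nat -> R[i] -> R[i]) g (M : \bar R) :
  (forall k, hol_disc (u k)) -> hol_disc g -> (forall k, (A2norm2 sigma (u k) <= M)%E) ->
  (forall z e, cabs z < 1 -> 0 < e -> exists K, forall k, (K <= k)%N -> cabs (u k z - g z) <= e) ->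
  (A2norm2 sigma g <= M)%E.
Proof.
move=> hu hg bu ug.
pose F k (p : R * R) := (cabs (u k (cplx p)) ^+ 2 * sigma (cabs (cplx p)) / pi)%:E.
have := @fatou _ _ R area_meas (@disc2 R) (measurable_disc2 R) F
  (fun k => measurable_A2_density (u k) (hu k)) (fun k => A2_density_ge0 (u k)).
have -> : (\int[area_meas]_(x in disc2) limn_einf (F ^~ x) = A2norm2 sigma g)%E.
  apply: eq_integral => p /set_mem p1; apply: (@cvg_limn_einf_sup _ _ _ _).1.
  apply: cvg_EFin; first by apply: nearW.
  apply: cvgMl; apply: cvgMl; apply: (cvg_comp _ (fun x : R => x ^+ 2)); last exact: exprn_continuous.
  apply/cvgrPdist_le => e e0; have [K hK] := ug (cplx p) e p1 e0; exists K => // k /= kK.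
  have h1 := ler_cabs_dist _ (u k (cplx p)) (g (cplx p)).
  have h2 := ler_cabs_dist _ (g (cplx p)) (u k (cplx p)).
  have h3 := hK k kK; rewrite cabsC in h2; rewrite ler_norml; itv_lra.
move=> /le_trans; apply.
rewrite limn_einf_lim; apply: lime_le; first exact: is_cvg_einfs.
by apply: nearW => n; apply: ereal_inf_le; exists (A2norm2 sigma (u n)); [exists n => //=|exact: bu].
Qed.

(** The pointwise bound [|a - b|^2 <= 2 |a|^2 + 2 |b|^2], integrated, replaces the triangle
    inequality for the norm. *)
Lemma A2norm2_sub f g : hol_disc f -> hol_disc g ->
  (A2norm2 sigma (fun z => (f z - g z)%R) <= 2%:E * A2norm2 sigma f + 2%:E * A2norm2 sigma g)%E.
Proof.
move=> hf hg; have mf := measurable_A2_density f hf; have mg := measurable_A2_density g hg.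
have f0 := A2_density_ge0 f; have g0 := A2_density_ge0 g.
rewrite /A2norm2 -/disc2.
rewrite -(ge0_integralZl area_meas (measurable_disc2 R) mf f0) //.
rewrite -(ge0_integralZl area_meas (measurable_disc2 R) mg g0) //.
rewrite -ge0_integralD //; last 5 first.
- exact: measurable_disc2.
- by move=> p p1; apply: mule_ge0 => //; exact: f0.
- by apply: emeasurable_funM => //; exact: measurable_cst.
- by move=> p p1; apply: mule_ge0 => //; exact: g0.
- by apply: emeasurable_funM => //; exact: measurable_cst.
apply: ge0_le_integral => //.
- exact: measurable_disc2.
- exact: (A2_density_ge0 (fun z => f z - g z)).
- apply: (measurable_A2_density (fun z => f z - g z)) => z z1.
  exact: (holB _ f g z (hf z z1) (hg z z1)).
- by apply: emeasurable_funD; apply: emeasurable_funM => //; exact: measurable_cst.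
move=> p p1; rewrite -!EFinM -EFinD lee_fin.
have sp : 0 <= sigma (cabs (cplx p)) / pi.
  by apply: divr_ge0; [apply/ltW/s0; rewrite cabs_ge0|exact: pi_ge0].
have h := ler_cabsB _ (f (cplx p)) (g (cplx p)).
have a0 := cabs_ge0 _ (f (cplx p) - g (cplx p)).
have b0 := cabs_ge0 _ (f (cplx p)); have c0 := cabs_ge0 _ (g (cplx p)).
move: sp h a0 b0 c0; set a := cabs (f _ - _); set b := cabs (f _); set c := cabs (g _).
rewrite -(mulrA (a ^+ 2)) -(mulrA (b ^+ 2)) -(mulrA (c ^+ 2)).
move: (sigma _ / pi) a b c => s a b c s00 h a0 b0 c0.
have -> : 2 * (b ^+ 2 * s) + 2 * (c ^+ 2 * s) = (2 * b ^+ 2 + 2 * c ^+ 2) * s by ring.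
apply: ler_wpM2r => //; apply: (@le_trans _ _ ((b + c) ^+ 2)).
  by rewrite ler_pXn2r ?nnegrE ?addr_ge0.
rewrite -subr_ge0 (_ : _ - _ = (b - c) ^+ 2) ?sqr_ge0 //; ring.
Qed.

Lemma ccirc_sqr f r : hol_disc f -> 0 <= r < 1 -> ccirc (fun z => cabs (f z) ^+ 2) r.
Proof.
move=> hf /andP[r0 r1] z; rewrite ger0_norm // => zr.
by apply: sqr_rcont; apply: hf; rewrite zr.
Qed.

(** Poisson inequality on the circle halfway between [rho] and 1: there the Harnack bound has
    numerator at most 2 and denominator at least [(1 - rho) / 2]. *)
Lemma point_le_circ f rho w : hol_disc f -> 0 <= rho < 1 -> cabs w <= rho ->
  cabs (f w) ^+ 2 <= 4 / (1 - rho) * circ_sqr f ((1 + rho) / 2).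
Proof.
move=> hf /andP[rho0 rho1] wr; pose r := (1 + rho) / 2; rewrite -/r.
have rI : 0 < r < 1 by apply/andP; split; rewrite /r; lra.
have /andP[r0 r1] := rI.
have wr' : cabs w < r by rewrite /r; lra.
have c0 := cabs_ge0 _ w.
have cN : ccirc (fun z => cabs (f z) ^+ 2) r by apply: ccirc_sqr => //; rewrite (ltW r0) r1.
have N0 : 0 <= circ_sqr f r := circ_sqr_ge0 _ f r.
have d0 : 0 < 1 - rho by lra.
have tp : 1 <= 2 * pi :> R by have := pi_ge2 R; lra.
apply: (@le_trans _ _ (2 * pi * cabs (f w) ^+ 2)).
  by rewrite ler_peMl // sqr_ge0.
apply: le_trans (poisson_ineq _ f r w hf rI wr') _.
rewrite -(circZ _ _ _ _ cN); apply: le_circ.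
- move=> z zr; apply: (rcontM _ (poisson r w)); last exact: cN.
  exact: ccirc_poisson.
- by move=> z zr; apply: rcontZ; exact: cN.
move=> z; rewrite gtr0_norm // => zr; apply: ler_wpM2r; first exact: sqr_ge0.
apply: le_trans (poisson_harnack _ r w z wr' zr) _.
have d1 : 0 < r - cabs w by lra.
rewrite ler_pdivrMr // mulrAC ler_pdivlMr //.
have h1 : r - cabs w >= (1 - rho) / 2 by rewrite /r; lra.
have h2 : (r + cabs w) * (1 - rho) <= 2 * (1 - rho) by apply: ler_wpM2r; lra.
by lra.
Qed.

Lemma measurable_sigma_beyond r : 0 <= r -> measurable_fun `]r, 1[ sigma.
Proof.
move=> r0; apply: measurable_funS (sigma_measurable R sigma sc) => //.
  by rewrite /I01; exact: measurable_itv.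
by move=> x; rewrite /I01 /= !in_itv /= => /andP[? ->]; rewrite andbT; lra.
Qed.

(** Circle means increase with the radius, so those beyond [r] are at least the one at [r]; the
    factor 2 absorbs the [x >= 2^-1] in the density. *)
Lemma circ_le_radial f r : hol_disc f -> 2^-1 <= r < 1 ->
  ((circ_sqr f r * (T r / 2))%:E <= radial f)%E.
Proof.
move=> hf /andP[r2 r1]; have N0 : 0 <= circ_sqr f r := circ_sqr_ge0 _ f r.
have r0 : 0 <= r by lra.
have sr x : `]r, 1[%classic x -> r < x < 1 by rewrite /= in_itv.
have sg x : `]r, 1[%classic x -> (0 <= (sigma x)%:E)%E.
  by move/sr => /andP[? ?]; rewrite lee_fin; apply/ltW/s0; lra.
have ms := measurable_sigma_beyond r r0.
have k0 : 0 <= circ_sqr f r / 2 by lra.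
have -> : circ_sqr f r * (T r / 2) = circ_sqr f r / 2 * T r by ring.
rewrite EFinM (tail_open R sigma si r r0).
have msE : measurable_fun `]r, 1[ (EFin \o sigma) by exact/measurable_EFinP.
rewrite (mule_integral _ (`]r, 1%R[%classic) _ _ (measurable_itv _) msE sg k0).
have mD := measurable_radial_density f hf.
have sub : `]r, 1[%classic `<=` `[0%R, 1%R[%classic.
  by move=> x /sr /andP[? ?]; rewrite /= in_itv /=; itv_lra.
apply: (@le_trans _ _ (\int[mu]_(x in `]r, 1%R[) (x * sigma x * circ_sqr f x)%:E)%E).
  apply: ge0_le_integral => //.
  - by move=> x xI; rewrite -EFinM lee_fin; apply: mulr_ge0 => //; exact: sg.
  - apply/measurable_EFinP; apply: (measurable_funM (measurable_cst (circ_sqr f r / 2)) ms).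
  - by apply/measurable_EFinP; apply: measurable_funS mD => //; rewrite /I01; exact: measurable_itv.
  move=> x xI; rewrite -EFinM lee_fin; have /andP[rx x1] := sr _ xI.
  have Nx : circ_sqr f r <= circ_sqr f x by apply: circ_mono.
  have sx := sg x xI; move: (sigma x) (circ_sqr f r) (circ_sqr f x) N0 Nx sx => s a b a0 ab s00.
  have -> : a / 2 * s = 2^-1 * s * a by ring.
  apply: ler_pM => //; first by apply: mulr_ge0.
  by apply: ler_wpM2r => //; lra.
apply: ge0_subset_integral => //.
  by apply/measurable_EFinP.
exact: radial_density_ge0.
Qed.

(** Point evaluations are bounded on [cabs w <= rho] uniformly in [f]. This is the local boundedness
    that [montel] takes as input. *)
Lemma point_bound rho : 0 <= rho < 1 -> exists2 C, 0 < C & forall f w (M : R), hol_disc f ->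
  cabs w <= rho -> (radial f <= M%:E)%E -> cabs (f w) ^+ 2 <= C * M.
Proof.
move=> rI; have /andP[rho0 rho1] := rI; pose r := (1 + rho) / 2.
have r2 : 2^-1 <= r < 1 by apply/andP; split; rewrite /r; lra.
have r0 : 0 <= r < 1 by move/andP: r2 => [? ?]; itv_lra.
have T0 := tail_gt0 R sigma s0 si w0 r r0.
have d0 : 0 < 1 - rho by lra.
exists (4 / (1 - rho) * (2 / T r)).
  by apply: mulr_gt0; apply: divr_gt0.
move=> f w M hf wr fM; apply: le_trans (point_le_circ f rho w hf rI wr) _.
rewrite -[leRHS]mulrA; apply: ler_wpM2l; first by rewrite ltW // divr_gt0.
have := le_trans (circ_le_radial f r hf r2) fM; rewrite lee_fin -/r.
move: (circ_sqr f r) (T r) T0 => n t t0 h.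
by rewrite mulrAC ler_pdivlMr //; lra.
Qed.

Lemma radial_norm_split f r b : hol_disc f -> 0 <= r < 1 ->
  (forall z, cabs z <= r -> cabs (f z) ^+ 2 <= b) -> 0 <= b ->
  (radial f <= (2 * pi * b * T 0)%:E + beyond r f)%E.
Proof.
move=> hf /andP[r0 r1] hb b0; have mD := measurable_radial_density f hf.
have pb : 0 <= 2 * pi * b by apply: mulr_ge0 => //; apply: mulr_ge0 => //; exact: pi_ge0.
have E : `[0%R, 1%R[%classic = `[0, r]%classic `|` `]r, 1[%classic :> set R.
  apply/seteqP; split => x /=; rewrite !in_itv /=.
    by move=> /andP[x0 x1]; case: (leP x r) => h; [left; rewrite x0|right; rewrite x1].
  by case => /andP[h1 h2]; itv_lra.
rewrite /radial_norm E ge0_integral_setU //=; last 3 first.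
- by rewrite -E; exact/measurable_EFinP.
- by move=> x h; apply: radial_density_ge0; rewrite E.
- apply/disj_set2P; rewrite -subset0 => x []; rewrite /= !in_itv /=.
  by move=> /andP[_ h1] /andP[h2 _]; lra.
apply: leeD => //; rewrite EFinM (tailE R sigma si 0 (lexx _)).
have ms := sigma_measurable R sigma sc.
have sg x : 0 <= x < 1 -> 0 <= sigma x by move/s0/ltW.
have sgE x : `[0%R, 1%R[%classic x -> (0 <= (sigma x)%:E)%E.
  by rewrite /= in_itv /= lee_fin; exact: sg.
have msE : measurable_fun (`[0%R, 1%R[%classic : set R) (EFin \o sigma) by exact/measurable_EFinP.
rewrite (mule_integral _ (`[0%R, 1%R[%classic) _ _ (measurable_itv _) msE sgE pb).
have sub : `[0, r]%classic `<=` `[0%R, 1%R[%classic.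
  by move=> x; rewrite /= !in_itv /= => /andP[-> ?] /=; lra.
apply: (@le_trans _ _ (\int[mu]_(x in `[0%R, r]) ((2 * pi * b)%:E * (sigma x)%:E))%E).
  apply: ge0_le_integral => //.
  - by move=> x /sub; exact: radial_density_ge0.
  - by apply/measurable_EFinP; apply: measurable_funS mD => //; rewrite /I01; exact: measurable_itv.
  - apply/measurable_EFinP; apply: (measurable_funM (measurable_cst (2 * pi * b))).
    by apply: measurable_funS ms => //; rewrite /I01; exact: measurable_itv.
  move=> x xI; rewrite -EFinM lee_fin; move: xI; rewrite /= in_itv /= => /andP[x0 xr].
  have x1 : x < 1 by lra.
  have xx : 0 <= x < 1 by rewrite x0.
  have Nx : circ_sqr f x <= 2 * pi * b.
    rewrite -(circ_cst _ b x); apply: le_circ; first exact: ccirc_sqr.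
      by move=> z _; exact: rcont_cst.
    by move=> z; rewrite ger0_norm // => zx; apply: hb; rewrite zx.
  rewrite mulrC; apply: ler_pM => //; first exact: circ_sqr_ge0.
    by apply: mulr_ge0 => //; exact: sg.
  by rewrite ler_piMl //; [exact: sg|lra].
apply: ge0_subset_integral => //.
  apply/measurable_EFinP; exact: (measurable_funM (measurable_cst (2 * pi * b)) ms).
move=> x; rewrite /= in_itv /= => xI; rewrite -EFinM lee_fin; apply: mulr_ge0 => //; exact: sg.
Qed.

Variable delta : R.
Hypotheses (d0 : 0 < delta)
  (W2 : weight_growth sigma delta).
Variable phi : R[i] -> R[i].
Hypotheses (hp : hol_disc phi) (p1 : forall z, cabs z < 1 -> cabs (phi z) < 1)
  (cond : forall e, 0 < e -> exists2 r0, r0 < 1 & forall z, cabs z < 1 -> r0 < cabs z ->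
     G (cabs z) < e * G (cabs (phi z))).

(** [m] bounds [cabs (phi z)] on the disc where [main_estimate] gives no control, so [h] is needed
    there only on [cabs w <= m]. With [e = 1] this is boundedness of the operator, with small [e]
    compactness. *)
Lemma radial_norm_comp e : 0 < e -> exists2 m, 0 <= m < 1 &
  forall h b, hol_disc h -> 0 <= b -> (forall w, cabs w <= m -> cabs (h w) ^+ 2 <= b) ->
  (radial (fun z => h (phi z)) <= (2 * pi * b * T 0)%:E + e%:E * radial h)%E.
Proof.
move=> e0.
have [r1 /andP[r10 r11] hr1] := main_estimate R sigma delta sc s0 si d0 w0 W2 phi hp p1 cond e e0.
have [m mI hm] := selfmap_bound R phi r1 hp p1 r11; exists m => // h b hh b0 hb.
have hc z : cabs z < 1 -> hol (fun z => h (phi z)) z.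
  by move=> z1; apply: hol_comp; [exact: hp|apply: hh; exact: p1].
have rI : 0 <= r1 < 1 by rewrite r10.
apply: le_trans (radial_norm_split (fun z => h (phi z)) r1 b hc rI _ b0) _.
  by move=> z zr; apply: hb; exact: hm.
by apply: leeD => //; exact: hr1.
Qed.

Lemma inA2P f : inA2 sigma f <-> hol_disc f /\ exists M : R, (radial f <= M%:E)%E.
Proof.
have pi0 := pi_gt0 R; split=> -[hf].
  have hf' : hol_disc f by move=> z z1; apply/hol_derivable; exact: hf.
  rewrite (A2norm2E f hf') => h; split => //.
  have := radial_norm_ge0 f; move: h; case: (radial f) => [M| |] //.
    by move=> _ _; exists M.
  by rewrite mulry gtr0_sg ?invr_gt0 // mul1e ltxx.
move=> [M hM]; split; first by move=> z /hf/hol_derivable.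
rewrite (A2norm2E f hf).
apply: (@le_lt_trans _ _ (pi^-1 * M)%:E); last exact: ltry.
by rewrite EFinM; apply: lee_wpmul2l => //; rewrite lee_fin invr_ge0 ltW.
Qed.

Lemma comp_inA2 f : inA2 sigma f -> inA2 sigma (f \o phi).
Proof.
move=> /inA2P[hf [M hM]]; apply/inA2P; split.
  by move=> z z1; apply: hol_comp; [exact: hp|apply: hf; exact: p1].
have [m mI hm] := radial_norm_comp 1 ltr01.
have [C C0 hC] := point_bound m mI.
have M0 : 0 <= M by rewrite -lee_fin; apply: le_trans hM; exact: radial_norm_ge0.
have CM : 0 <= C * M by rewrite mulr_ge0 // ltW.
exists (2 * pi * (C * M) * T 0 + M); apply: le_trans (hm f (C * M) hf CM _) _.
  by move=> w wm; exact: hC.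
by rewrite EFinD mul1e; apply: leeD.
Qed.

Lemma radial_norm_le h (M : R) : hol_disc h -> (A2norm2 sigma h <= M%:E)%E ->
  (radial h <= (pi * M)%:E)%E.
Proof.
move=> hh; rewrite (A2norm2E h hh) => q; have pi0 := pi_gt0 R.
have := lee_wpmul2l (ltW (eq_ind_r is_true pi0 (lte_fin 0 pi))) q.
by rewrite muleA -EFinM divff ?gt_eqF // mul1e.
Qed.

(** The Montel limit [g0] need not be a norm limit of the subsequence. The differences [h n] are
    merely norm-bounded and locally uniformly small, which is exactly what [radial_norm_comp]
    converts into small norms after composition. *)
Lemma comp_compact : Ccomp_compact sigma phi.
Proof.
split; first by move=> f; exact: comp_inA2.
move=> u hu [M bM].
have hu' k : hol_disc (u k) by have /inA2P[] := hu k.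
have pi0 := pi_gt0 R.
have bR k := radial_norm_le (u k) M (hu' k) (bM k).
have M0 : 0 <= M by rewrite -lee_fin; apply: le_trans (bM 0%N); exact: A2norm2_ge0.
have loc rho : 0 <= rho < 1 -> exists B, forall k z, cabs z <= rho -> cabs (u k z) <= B.
  move=> rI; have [C C0 hC] := point_bound rho rI.
  exists (Num.sqrt (C * (pi * M))) => k z zr.
  have h := hC (u k) z _ (hu' k) zr (bR k).
  by rewrite -[leLHS]ger0_norm ?cabs_ge0 // -sqrtr_sqr ler_wsqrtr.
have [k [g0 [ki hg0 ug]]] := montel R u hu' loc.
have bg : (A2norm2 sigma g0 <= M%:E)%E.
  apply: (A2norm2_fatou (fun n => u (k n)) g0) => [n|//|n|z e z1 e0].
  - exact: hu'.
  - exact: bM.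
  - have [K hK] := ug (cabs z) e (cabs_ge0 _ z) z1 e0.
    by exists K => n nK; exact: hK.
have Ag0 : inA2 sigma g0.
  by split; [move=> z /hg0/hol_derivable|exact: le_lt_trans bg (ltry _)].
exists k, (g0 \o phi); split; first exact: ki.
split; first exact: (comp_inA2 g0 Ag0).
pose h n z := u (k n) z - g0 z.
have hh n : hol_disc (h n) by move=> z z1; exact: (holB _ (u (k n)) g0 z (hu' _ z z1) (hg0 z z1)).
have bh n : (A2norm2 sigma (h n) <= (4 * M)%:E)%E.
  apply: le_trans (A2norm2_sub (u (k n)) g0 (hu' _) hg0) _.
  rewrite (_ : (4 * M)%:E = 2%:E * M%:E + 2%:E * M%:E)%E; last by rewrite -!EFinM -EFinD; congr EFin; ring.
  by apply: leeD; apply: lee_wpmul2l => //; rewrite lee_fin.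
have bhR n := radial_norm_le (h n) (4 * M) (hh n) (bh n).
have hc n z : cabs z < 1 -> hol (fun z => h n (phi z)) z.
  by move=> z1; apply: hol_comp; [exact: hp|apply: hh; exact: p1].
have T0 : 0 <= T 0 by rewrite ltW //; apply: (tail_gt0 R sigma s0 si w0); rewrite lexx ltr01.
have small e : 0 < e -> exists K, forall n, (K <= n)%N -> (A2norm2 sigma (fun z => h n (phi z)) <= e%:E)%E.
  move=> e0.
  (* Keeps the contribution [e1 * (4 * M)] of the boundary part below [e / 2]; the added 1 covers
     [M = 0]. *)
  pose e1 := e / (2 * (4 * M + 1)).
  have e10 : 0 < e1 by apply: divr_gt0 => //; apply: mulr_gt0 => //; lra.
  have [m mI hm] := radial_norm_comp e1 e10; have /andP[m0 m1] := mI.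
  (* [d <= 1] turns a bound [d] on the modulus into the same bound on its square; the second term
     keeps the inner contribution [2 * d * T 0] below [e / 2]. *)
  pose d := Num.min 1 (e / (4 * (T 0 + 1))).
  have d00 : 0 < d by rewrite lt_min ltr01 divr_gt0 // mulr_gt0 //; lra.
  have [K hK] := ug m d m0 m1 d00; exists K => n nK.
  rewrite (A2norm2E _ (hc n)).
  have hb w : cabs w <= m -> cabs (h n w) ^+ 2 <= d.
    move=> wm; have q := hK n nK w wm; have q0 := cabs_ge0 _ (h n w).
    have d1 : d <= 1 by rewrite ge_min lexx.
    rewrite expr2; apply: (@le_trans _ _ (d * 1)); last by rewrite mulr1.
    by apply: ler_pM => //; exact: le_trans q d1.
  have H := hm (h n) d (hh n) (ltW d00) hb.
  have pv : (0 <= (pi^-1)%:E :> \bar R)%E by rewrite lee_fin invr_ge0 ltW.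
  apply: le_trans (lee_wpmul2l pv H) _.
  have H2 : (e1%:E * radial (h n) <= e1%:E * (pi * (4 * M))%:E)%E.
    by apply: lee_wpmul2l => //; rewrite lee_fin ltW.
  apply: le_trans (lee_wpmul2l pv (leeD (lexx _) H2)) _.
  change ((pi^-1 * (2 * pi * d * T 0 + e1 * (pi * (4 * M))))%:E <= e%:E)%E; rewrite lee_fin.
  have -> : pi^-1 * (2 * pi * d * T 0 + e1 * (pi * (4 * M))) = 2 * d * T 0 + e1 * (4 * M).
    have E p : 0 < p -> p^-1 * (2 * p * d * T 0 + e1 * (p * (4 * M))) = 2 * d * T 0 + e1 * (4 * M).
      by move=> q0; field; exact: lt0r_neq0.
    exact: E.
  have q1 : d * (4 * (T 0 + 1)) <= e.
    by rewrite -ler_pdivlMr ?ge_min ?lexx ?orbT // mulr_gt0 //; lra.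
  have q2 : e1 * (2 * (4 * M + 1)) = e by rewrite /e1 divfK // gt_eqF // mulr_gt0 //; lra.
  by nra.
apply/(@fine_cvgP R nat \oo _ _ 0); split.
  have [K hK] := small 1 ltr01; exists K => // n /= nK.
  rewrite ge0_fin_numE; first exact: le_lt_trans (hK n nK) (ltry _).
  exact: A2norm2_ge0.
apply/cvgrPdist_le => e e0; have [K hK] := small e e0; exists K => // n /= nK.
rewrite sub0r normrN ger0_norm; last by apply: fine_ge0; exact: A2norm2_ge0.
have q := hK n nK; have q0 := A2norm2_ge0 (fun z => h n (phi z)).
rewrite -lee_fin fineK // ge0_fin_numE //; exact: le_lt_trans q (ltry _).
Qed.

End BergmanNorm.

(** * Condition (kappa) and the reduction of the second criterion to the first *)

Section Kappa.
Variables (R : realType) (sigma : R -> R).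
Local Notation mu := (@lebesgue_measure R).
Hypotheses (s0 : forall r : R, 0 <= r < 1 -> 0 < sigma r)
  (si : mu.-integrable `[0, 1[ (EFin \o sigma))
  (w0 : forall r, I01 r -> 0 < omega_of sigma r).
Local Notation G := (Grad R sigma).
Implicit Types (eta x y e : R).

(** The quotient in condition (kappa) is precisely [G (1 - eta * x) / G (1 - x)]: the extra [eta] in
    its denominator is the ratio of the two distances to 1. *)
Lemma kappa_Grad e : kappa_cond (omega_of sigma) -> 0 < e ->
  exists2 eta, 0 < eta < 1 & exists2 x0, 0 < x0 < 1 &
    forall x, 0 < x -> x < x0 -> G (1 - eta * x) < e * G (1 - x).
Proof.
move=> K e0.
have nb : nbhs (0 : \bar R) [set y : \bar R | (y < e%:E)%E].
  by apply: open_nbhs_nbhs; split; [exact: open_ereal_lt_ereal|rewrite /= lte_fin].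
pose L eta := limf_esup (fun x : R => (omega_of sigma (1 - eta * x) / (eta * omega_of sigma (1 - x)))%:E) 0^'+.
have He : \forall eta \near 0^'+, (L eta < e%:E)%E := K _ nb.
have H1 : \forall eta \near 0^'+, eta < (1 : R) by apply: nbhs_right_lt.
have H0 : \forall eta \near 0^'+, (0 : R) < eta by exact: nbhs_right_gt.
have [eta [[/= h h1] h0]] := @filter_ex _ _ (at_right_proper_filter (0 : R)) _ (filterI (filterI He H1) H0).
exists eta; first by rewrite h0.
(* The upper limit is an infimum of suprema over the sets of the filter, so a value below [e]
   provides a set [V] on which the quotient itself is below [e]. *)
move: h; rewrite /L limf_esupE => /ereal_inf_lt[_ [V VF <-]] hV.
have Hx : \forall x \near 0^'+, V x /\ (0 : R) < x by exact: filterI.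
move: VF; rewrite /at_right /= => /nbhs_ballP[d /= d0 hd].
exists (Num.min (d / 2) 2^-1).
  by rewrite lt_min gt_min divr_gt0 //=; itv_lra.
move=> x x0; rewrite lt_min => /andP[xd x2].
have Vx : V x.
  by apply: hd => //; rewrite /ball /= sub0r normrN gtr0_norm //; lra.
have hx := le_lt_trans (ereal_sup_ubound (ex_intro2 _ _ x Vx erefl)) hV.
move: hx; rewrite lte_fin => hx.
have wx : 0 < omega_of sigma (1 - x).
  by apply: w0; rewrite /I01 /= in_itv /=; itv_lra.
have -> : G (1 - eta * x) = omega_of sigma (1 - eta * x) / (eta * x).
  by rewrite /Grad; congr (_ / _); ring.
have -> : G (1 - x) = omega_of sigma (1 - x) / x by rewrite /Grad; congr (_ / _); ring.
have ex0 : 0 < eta * x by rewrite mulr_gt0.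
rewrite ltr_pdivrMr //; move: hx; rewrite ltr_pdivrMr ?mulr_gt0 //.
move: (omega_of sigma (1 - eta * x)) (omega_of sigma (1 - x)) => a b h.
by rewrite (_ : e * (b / x) * (eta * x) = e * (eta * b)) //; field; exact: lt0r_neq0.
Qed.

Lemma kappa_ratio (phi : R[i] -> R[i]) : kappa_cond (omega_of sigma) ->
  (forall z, cabs z < 1 -> cabs (phi z) < 1) ->
  (forall M : R, exists r0 : R, r0 < 1 /\ forall z, disc z -> r0 < cabs z ->
     M < (1 - cabs (phi z)) / (1 - cabs z)) ->
  forall e, 0 < e -> exists2 r0, r0 < 1 & forall z, cabs z < 1 -> r0 < cabs z ->
     G (cabs z) < e * G (cabs (phi z)).
Proof.
move=> K p1 hM e e0; have [eta /andP[h0 h1] [x0 /andP[x00 x01] hx]] := kappa_Grad e K e0.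
have [r1 [r11 hr1]] := hM eta^-1.
have c0 : 0 < e * G (1 - x0).
  by apply: mulr_gt0 => //; apply: (Grad_gt0 R sigma w0); itv_lra.
have [r2 /andP[r20 r21] hr2] := tail_small R sigma s0 si _ c0.
exists (Num.max r1 r2); first by rewrite gt_max r11.
move=> z z1; rewrite gt_max => /andP[zr1 zr2].
have z0 := cabs_ge0 _ z; have f1 := p1 z z1; have f0 := cabs_ge0 _ (phi z).
have [h|h] := ltP (1 - cabs (phi z)) x0.
  have x1 : 0 < 1 - cabs (phi z) by rewrite subr_gt0.
  have := hx _ x1 h; rewrite (_ : 1 - (1 - cabs (phi z)) = cabs (phi z)); last by ring.
  apply: le_lt_trans; apply: (Grad_noninc R sigma s0 si) => //.
    suff : eta * (1 - cabs (phi z)) <= 1 by lra.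
    by apply: mulr_ile1; lra.
  have := hr1 z z1 zr1; rewrite ltr_pdivlMr ?subr_gt0 // mulrC -ltr_pdivlMr ?invr_gt0 //.
  rewrite invrK; move: (1 - cabs (phi z)) => x q.
  by rewrite mulrC; lra.
(* When [phi z] stays at distance [x0] from the circle, (kappa) says nothing. There
   [G (cabs (phi z))] is at least [G (1 - x0)], and [r2] was chosen to make [G (cabs z)] smaller
   than [e] times that. *)
have zI : 0 <= cabs z < 1 by rewrite z0.
apply: le_lt_trans (Grad_le_tail R sigma s0 si (cabs z) zI) _.
apply: le_lt_trans (tail_noninc R sigma s0 si _ _ r20 (ltW zr2)) _.
apply: lt_le_trans hr2 _; apply: ler_wpM2l; first exact: ltW.
by apply: (Grad_noninc R sigma s0 si) => //; lra.
Qed.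

End Kappa.

Theorem theorem3p3 (R : realType) (phi : R[i] -> R[i]) (sigma : R -> R) :
  analytic_on disc phi ->
  (forall z, disc z -> disc (phi z)) ->
  {within `[0, 1[, continuous sigma} ->
  (forall r : R, 0 <= r < 1 -> 0 < sigma r) ->
  (@lebesgue_measure R).-integrable `[0, 1[ (EFin \o sigma) ->
  I_admissible (omega_of sigma) ->
  ((forall eps : R, 0 < eps -> exists r0 : R, r0 < 1 /\
      forall z, disc z -> r0 < cabs z ->
        `| Gw (omega_of sigma) z / Gw (omega_of sigma) (phi z) | < eps) ->
    Ccomp_compact sigma phi) /\
  (kappa_cond (omega_of sigma) ->
   (forall M : R, exists r0 : R, r0 < 1 /\
      forall z, disc z -> r0 < cabs z ->
        M < (1 - cabs (phi z)) / (1 - cabs z)) ->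
   Ccomp_compact sigma phi).
Proof.
move=> hp p1 sc s0 si [w0 [_ [w1 [w2 [_ [_ [[delta [d0 W2]] _]]]]]]].
have hp' z : cabs z < 1 -> hol phi z by move=> z1; apply/hol_derivable; exact: hp.
have compact := comp_compact R sigma sc s0 si w0 delta d0 W2 phi hp' p1.
split=> [cond|K hM]; apply: compact; last exact: kappa_ratio.
move=> e e0; have [r0 [r01 h]] := cond e e0; exists r0 => // z z1 zr.
have Gp : 0 < Grad R sigma (cabs (phi z)).
  by apply: Grad_gt0 => //; rewrite cabs_ge0; exact: p1.
have := le_lt_trans (ler_norm _) (h z z1 zr).
by rewrite /Gw -/(Grad R sigma (cabs z)) -/(Grad R sigma (cabs (phi z))) ltr_pdivrMr.
Qed.
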